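(* Let $m\ge1$ be an integer, $\rho\in(0,+\infty)$, and let $F\colon\mathbb{R}\to\mathbb{R}$ satisfy: (f0) $F\in C^1(\mathbb{R})$ and $F'(s)=O(|s|)$ as $s\to0$; (f1) $\lim_{s\to0}F(s)s^{-2}=0$; (f2) $\sigma:=\limsup_{|s|\to+\infty}F(s)s^{-(2+4m)}<+\infty$; (f3) $\lim_{s\to0}F(s)s^{-(2+4m)}=+\infty$. If $2\sigma C_{2+4m}^{2+4m}\rho^{2m}<1$, then there exist $u\in\mathcal{S}$ and $\lambda>0$ such that $J(u)=\min_{\mathcal{D}}J<0$ and $(\lambda,u)$ is a solution to $$\Bigl(-\frac{\mathrm{d}^2}{\mathrm{d}x^2}\Bigr)^mu+\lambda u=F'(u)\ \text{ in }\mathbb{R},\qquad \int_{\mathbb{R}}u^2\,\mathrm{d}x=\rho.$$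
   Context: Functions are real-valued on $\mathbb{R}$; $|\cdot|_q$ is the norm of $L^q(\mathbb{R})$ and $u^{(m)}$ is the $m$-th derivative. Solutions in $H^m(\mathbb{R})$ of the differential equation are understood in the weak sense. Define $$J(u)=\int_{\mathbb{R}}\tfrac12|u^{(m)}|^2-F(u)\,\mathrm{d}x\quad(u\in H^m(\mathbb{R})),$$ $$\mathcal{S}:=\Bigl\{v\in H^m(\mathbb{R}):\int_{\mathbb{R}}v^2\,\mathrm{d}x=\rho\Bigr\},\qquad \mathcal{D}:=\Bigl\{v\in H^m(\mathbb{R}):\int_{\mathbb{R}}v^2\,\mathrm{d}x\le\rho\Bigr\}.$$ For $p>2$, $C_p>0$ denotes the sharp (smallest) constant in the Gagliardo--Nirenberg inequality $|v|_p\le C_p|v^{(m)}|_2^{\delta_p}|v|_2^{1-\delta_p}$ for all $v\in H^m(\mathbb{R})$, where $\delta_p=(1/2-1/p)/m$. *)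

(* Defs.v *)
From HB Require Import structures.
From mathcomp Require Import all_boot all_order all_algebra.
From mathcomp Require Import all_classical all_reals all_analysis.
Set Implicit Arguments.
Unset Strict Implicit.
Unset Printing Implicit Defensive.
Import Order.TTheory GRing.Theory Num.Theory.
Import numFieldNormedType.Exports.
Local Open Scope classical_set_scope.
Local Open Scope ring_scope.

Definition test_function (R : realType) (phi : R -> R) : Prop :=
  (forall n x, derivable (derive1n n phi) x 1) /\
  compact (closure [set x | phi x != 0]).

Definition is_weak_deriv (R : realType) (k : nat) (u g : R -> R) : Prop :=
  [/\ locally_integrable setT u, locally_integrable setT g &
    forall phi : R -> R, test_function phi ->
      (\int[@lebesgue_measure R]_x (u x * derive1n k phi x) =
       (-1) ^+ k * \int[@lebesgue_measure R]_x (g x * phi x))%R].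

(* Elements of H^m are represented by functions rather than by classes modulo
   a.e. equality; everything below is invariant under a.e. modification. *)
Definition sobolevH (R : realType) (m : nat) : set (R -> R) :=
  [set u | u \in Lfun (@lebesgue_measure R) 2%:E /\
    forall k, (k <= m)%N -> exists2 g : R -> R,
      g \in Lfun (@lebesgue_measure R) 2%:E & is_weak_deriv k u g].

(* A representative of u^(k), which is unique up to a.e. equality; the default
   value 0 is only used when u has no weak derivative of order k. *)
Definition weak_deriv (R : realType) (k : nat) (u : R -> R) : R -> R :=
  xget (cst 0) [set g | is_weak_deriv k u g].

Definition LqNorm (R : realType) (q : R) (v : R -> R) : \bar R :=
  'N[@lebesgue_measure R]_(q%:E)[EFin \o v]%E.

Definition GN_exponent (R : realType) (m : nat) (p : R) : R :=
  (1 / 2 - 1 / p) / m%:R.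

(* For m >= 1 and p > 2 the set of admissible constants is a nonempty closed
   half-line, so that its infimum is its least element. *)
Definition GN_constant (R : realType) (m : nat) (p : R) : R :=
  inf [set C : R | 0 <= C /\ forall v, sobolevH m v ->
    (LqNorm p v <= C%:E * poweR (LqNorm 2 (weak_deriv m v)) (GN_exponent m p)
                        * poweR (LqNorm 2 v) (1 - GN_exponent m p))%E].

(* The real-valued integral is the intended one as soon as F is continuous and
   F(s) = O(s^2) at 0: elements of H^m being essentially bounded for m >= 1,
   the integrand is then integrable for every u in H^m. *)
Definition energy (R : realType) (m : nat) (F : R -> R) (u : R -> R) : R :=
  (\int[@lebesgue_measure R]_x (1 / 2 * (weak_deriv m u x) ^+ 2 - F (u x)))%R.

Definition mass (R : realType) (u : R -> R) : R :=
  (\int[@lebesgue_measure R]_x (u x) ^+ 2)%R.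

Definition mass_sphere (R : realType) (m : nat) (rho : R) : set (R -> R) :=
  [set v | sobolevH m v /\ mass v = rho].

Definition mass_ball (R : realType) (m : nat) (rho : R) : set (R -> R) :=
  [set v | sobolevH m v /\ mass v <= rho].

(* The neighbourhood filter of |s| = +oo. *)
Definition norm_infty_nbhs (R : realType) : set_system R :=
  [set A | exists M : R, forall s : R, M < `|s| -> A s].

(* Weak formulation of (-d^2/dx^2)^m u + lambda u = f(u), tested against H^m:
   after m integrations by parts (-1)^m u^(2m) v becomes u^(m) v^(m). *)
Definition weak_solution (R : realType) (m : nat) (f : R -> R) (lambda : R)
    (u : R -> R) : Prop :=
  sobolevH m u /\ forall v, sobolevH m v ->
    (@lebesgue_measure R).-integrable setT (EFin \o (fun x => f (u x) * v x)) /\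
    (\int[@lebesgue_measure R]_x (weak_deriv m u x * weak_deriv m v x) +
     lambda * \int[@lebesgue_measure R]_x (u x * v x) =
     \int[@lebesgue_measure R]_x (f (u x) * v x))%R.

(* Main.v *)
Require Import Defs.
From HB Require Import structures.
From mathcomp Require Import all_boot all_order all_algebra.
From mathcomp Require Import all_classical all_reals all_analysis.
From mathcomp Require Import measurable_realfun ring lra.
Set Implicit Arguments.
Unset Strict Implicit.
Unset Printing Implicit Defensive.
Import Order.TTheory GRing.Theory Num.Theory.
Import numFieldNormedType.Exports.
Local Open Scope classical_set_scope.
Local Open Scope ring_scope.

(** By the Gagliardo-Nirenberg inequality and the smallness of rho, J is coercive
    on D, so c = inf J over D is finite and a minimizing sequence is bounded in
    H^m; (f3) gives c < 0. By (f1), functions of D with energy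
    below c / 2 have sup norm bounded from below, so up to translations the
    sequence converges locally uniformly to a nonzero weak limit u.
    Dilating a function w of mass t rho, t <= 1, to mass rho shows that
    J(w) >= t c + (1 - t^(2m)) |w^(m)|_2^2 / 2. Applied to the remainders
    u_n - u in the Brezis-Lieb splitting of J, this gives J(u) <= t c for u of
    mass t rho; applied to u itself, it then forces t = 1, hence J(u) = c.
    Since u is a minimizer on the ball, J'(u) v >= 0 whenever (u, v) < 0, which
    gives a multiplier lambda >= 0; comparison with (1 - t) u yields
    J'(u) u <= 2 c < 0, hence lambda > 0. *)

(** The exponent 2 + 4m is mass-critical: by Gagliardo-Nirenberg the integral of v^(2+4m) is at most
    a constant times |v^(m)|_2^2 times the 2m-th power of the mass. The critical part of F therefore
    has the homogeneity of the kinetic energy: smallness keeps its coefficient below 1/2, and since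
    both terms scale alike, negative energy at the prescribed mass comes from the limit in (f3)
    being infinite. The obstacle is that mass may escape to infinity, as H^m(R) does not embed
    compactly in L^2(R). Working on the ball rather than on the sphere keeps both the local limit
    and the remainders admissible competitors, so that c bounds the energy of each piece from below.
    Estimates are stated for continuous functions, which represent all of H^m, so that bounds and
    limits hold at every point. No weakly convergent sequence of derivatives is extracted: to split
    the kinetic energy, a one-sided inequality at one large index is enough. *)

Section real_integral.
Context {R : realType}.
Implicit Types f g : R -> R.
Local Notation mu := (@lebesgue_measure R).

Lemma ae_imp (P Q : R -> Prop) : (forall x, P x -> Q x) ->
  {ae mu, forall x, P x} -> {ae mu, forall x, Q x}.
Proof.
by move=> PQ; apply: filterS => //; exact: (ae_filter_ringOfSetsType mu).
Qed.

Lemma ae_and (P Q : R -> Prop) :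
  {ae mu, forall x, P x} -> {ae mu, forall x, Q x} ->
  {ae mu, forall x, P x /\ Q x}.
Proof.
move=> hP hQ; have F := ae_filter_ringOfSetsType mu.
exact: (@filterI _ _ F).
Qed.

(** A null set cannot contain an interval of positive length. This provides a Lebesgue point as base
    point, and identifies continuous functions that agree a.e. *)
Lemma ae_ex_itv (P : R -> Prop) (a b : R) : a < b ->
  {ae mu, forall x, P x} -> exists x, a < x < b /\ P x.
Proof.
move=> ab [N [mN N0 sub]]; apply: contrapT => /forallNP h.
have : (mu `]a, b[%classic <= mu N)%E.
  apply: le_measure; rewrite ?inE//.
  move=> x /=; rewrite in_itv/= => xab; apply: sub => Px.
  by apply: (h x).
by rewrite N0 lebesgue_measure_itv/= lte_fin ab -EFinB lee_fin leNgt subr_gt0 ab.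
Qed.

Definition integR f : Prop := mu.-integrable setT (EFin \o f).

Lemma integR_meas f : integR f -> measurable_fun setT f.
Proof. by move/measurable_int/measurable_EFinP. Qed.

Lemma EFin_meas f : measurable_fun setT f -> measurable_fun setT (EFin \o f).
Proof. by move=> mf; apply/measurable_EFinP; exact: mf. Qed.

Lemma integRD f g : integR f -> integR g -> integR (fun x => f x + g x).
Proof. by move=> hf hg; exact: (integrableD measurableT hf hg). Qed.

Lemma integRB f g : integR f -> integR g -> integR (fun x => f x - g x).
Proof. by move=> hf hg; exact: (integrableB measurableT hf hg). Qed.

Lemma integRZ c f : integR f -> integR (fun x => c * f x).
Proof. by move=> hf; exact: (integrableZl measurableT c hf). Qed.

Lemma integR_norm f : integR f -> integR (fun x => `|f x|).
Proof. exact: integrable_norm. Qed.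

Lemma integR_dom f g : measurable_fun setT f -> (forall x, `|f x| <= g x) ->
  integR g -> integR f.
Proof.
move=> mf fg ig; apply: (le_integrable measurableT _ _ ig).
  exact: EFin_meas.
by move=> x _; rewrite lee_fin (le_trans (fg x))// ler_norm.
Qed.

Lemma IntD f g : integR f -> integR g ->
  \int[mu]_x (f x + g x) = \int[mu]_x f x + \int[mu]_x g x.
Proof. by move=> hf hg; rewrite RintegralD. Qed.

Lemma IntB f g : integR f -> integR g ->
  \int[mu]_x (f x - g x) = \int[mu]_x f x - \int[mu]_x g x.
Proof. by move=> hf hg; rewrite RintegralB. Qed.

Lemma IntZ c f : integR f -> \int[mu]_x (c * f x) = c * \int[mu]_x f x.
Proof. by move=> hf; rewrite RintegralZl. Qed.

Lemma le_Int f g : integR f -> integR g -> (forall x, f x <= g x) ->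
  \int[mu]_x f x <= \int[mu]_x g x.
Proof. by move=> hf hg fg; apply: le_Rintegral => // x _; exact: fg. Qed.

Lemma Int_ge0 f : (forall x, 0 <= f x) -> 0 <= \int[mu]_x f x.
Proof. by move=> f0; apply: Rintegral_ge0. Qed.

Lemma le_norm_Int f g : integR f -> integR g -> (forall x, `|f x| <= g x) ->
  `|\int[mu]_x f x| <= \int[mu]_x g x.
Proof.
move=> hf hg fg; apply: (le_trans (le_normr_Rintegral measurableT hf)).
by apply: le_Int => //; exact: integR_norm.
Qed.

Lemma eq_Int f g : (forall x, f x = g x) -> \int[mu]_x f x = \int[mu]_x g x.
Proof. by move=> fg; apply: eq_Rintegral => x _. Qed.

Lemma eq_integR f g : (forall x, f x = g x) -> integR f -> integR g.
Proof. by move=> /funext ->. Qed.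

Lemma ae_Int f g : measurable_fun setT f -> measurable_fun setT g ->
  {ae mu, forall x, f x = g x} -> \int[mu]_x f x = \int[mu]_x g x.
Proof.
move=> mf mg fg; rewrite /Rintegral; congr fine; apply: ae_eq_integral => //.
- exact: EFin_meas.
- exact: EFin_meas.
- by apply: ae_imp fg => x /= -> _.
Qed.

Lemma ae_integR f g : measurable_fun setT g ->
  {ae mu, forall x, f x = g x} -> integR f -> integR g.
Proof.
move=> mg fg hf; have mf := integR_meas hf.
case/integrableP: hf => ? h; apply/integrableP; split; first exact: EFin_meas.
rewrite (_ : integral _ _ _ = \int[mu]_x `|(f x)%:E|)%E //.
apply: ae_eq_integral => //.
- by apply: measurableT_comp => //; exact: EFin_meas.
- by apply: measurableT_comp => //; exact: EFin_meas.
- by apply: ae_imp fg => x /= -> _.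
Qed.

Lemma integR_EFin f : integR f -> (\int[mu]_x (f x)%:E)%E = (\int[mu]_x f x)%:E.
Proof. by move=> hf; rewrite /Rintegral fineK// integrable_fin_num. Qed.

Lemma integR_ge0 f : measurable_fun setT f -> (forall x, 0 <= f x) ->
  (\int[mu]_x (f x)%:E < +oo)%E -> integR f.
Proof.
move=> mf f0 h; apply/integrableP; split; first exact: EFin_meas.
by under eq_integral => x _ do rewrite /= ger0_norm ?f0//.
Qed.

Lemma Int_eq0 f : integR f -> (forall x, 0 <= f x) -> \int[mu]_x f x = 0 ->
  {ae mu, forall x, f x = 0}.
Proof.
move=> hf f0 h0.
have mf : measurable_fun setT (EFin \o f) by apply/measurable_EFinP; exact: integR_meas.
have := (ae_eq_integral_abs mu measurableT mf).1.
have -> : (\int[mu]_x `|(EFin \o f) x|)%E = 0%E.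
  under eq_integral => x _ do rewrite /= ger0_norm ?f0//.
  by rewrite integR_EFin// h0.
by move=> /(_ erefl); apply: ae_imp => x /= /(_ I) [].
Qed.

Lemma dct (f_ : nat -> R -> R) f g : (forall n, measurable_fun setT (f_ n)) ->
  measurable_fun setT f ->
  {ae mu, forall x, f_ n x @[n --> \oo] --> f x} -> integR g ->
  (forall n x, `|f_ n x| <= g x) ->
  integR f /\ \int[mu]_x f_ n x @[n --> \oo] --> \int[mu]_x f x.
Proof.
move=> mf_ mf cf ig fg.
have [||||| h1 h2 h3] := @dominated_convergence _ _ _ mu setT measurableT
  (fun n => EFin \o f_ n) (EFin \o f) (EFin \o g).
- by move=> n; exact: EFin_meas.
- exact: EFin_meas.
- by apply: ae_imp cf => x h _; apply: cvg_EFin; [exact: nearW|].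
- exact: ig.
- by apply: aeW => x n _; rewrite lee_fin.
split=> //.
by apply: fine_cvg; rewrite fineK//; exact: integrable_fin_num.
Qed.

Lemma lim_meas (f_ : nat -> R -> R) f : (forall n, measurable_fun setT (f_ n)) ->
  (forall x, f_ n x @[n --> \oo] --> f x) -> measurable_fun setT f.
Proof. by move=> mf h; apply: (measurable_fun_cvg mf) => x _; exact: h. Qed.

(** Fatou's lemma in a form that also yields integrability of the limit; the limits constructed
    later are shown to be square integrable in this way. *)
Lemma fatouR (f_ : nat -> R -> R) f C : (forall n, integR (f_ n)) ->
  measurable_fun setT f -> (forall n x, 0 <= f_ n x) ->
  {ae mu, forall x, f_ n x @[n --> \oo] --> f x} ->
  (forall n, \int[mu]_x f_ n x <= C) ->
  integR f /\ \int[mu]_x f x <= C.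
Proof.
move=> hf_ mf f0 cf hC.
have mf_ n := integR_meas (hf_ n).
have aef : {ae mu, forall x, (`|f x|%:E = limn_einf (fun n => (f_ n x)%:E))%E}.
  apply: ae_imp cf => x cx.
  have f0x : 0 <= f x.
    rewrite -(cvg_lim (@Rhausdorff R) cx); apply: limr_ge.
      by apply/cvg_ex; exists (f x).
    exact: nearW.
  rewrite ger0_norm//; apply/esym.
  rewrite is_cvg_limn_einfE.
    by apply/cvg_lim => //; apply: cvg_EFin => //; exact: nearW.
  by apply/cvg_ex; exists (f x)%:E; apply: cvg_EFin => //; exact: nearW.
have le1 : (\int[mu]_x `|f x|%:E <= C%:E)%E.
  apply: (@le_trans _ _ (\int[mu]_x limn_einf (fun n => (f_ n x)%:E))%E).
    rewrite le_eqVlt; apply/orP; left; apply/eqP; apply: ae_eq_integral => //.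
    - by apply/measurable_EFinP; exact: measurableT_comp.
    - rewrite (_ : (fun _ => _) =
        (fun x => - limn_esup (fun n => - (f_ n x)%:E))%E); last first.
        by apply/funext => x; rewrite -limn_einfN; congr limn_einf;
          apply/funext => n; rewrite /= opprK.
      apply: measurableT_comp => //; apply: measurable_fun_limn_esup => n.
      by apply: measurableT_comp => //; exact: EFin_meas.
    - by apply: ae_imp aef => x /= -> _.
  apply: (le_trans (fatou mu measurableT _ _)).
  - by move=> n; exact: EFin_meas.
  - by move=> n x _; rewrite lee_fin.
  rewrite limn_einf_lim; apply: lime_le; first exact: is_cvg_einfs.
  apply: nearW => n; apply: (@le_trans _ _ (\int[mu]_x (f_ n x)%:E)%E).
    by apply: ereal_inf_lbound; exists n => /=.
  by rewrite integR_EFin// lee_fin.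
have hf : integR f.
  apply/integrableP; split; first exact: EFin_meas.
  by apply: le_lt_trans le1 _; rewrite ltry.
split=> //; rewrite -lee_fin -integR_EFin//; apply: le_trans le1.
apply: le_integral => //; first exact: integR_norm.
by move=> x _; rewrite lee_fin ler_norm.
Qed.

End real_integral.

(** * Test functions *)

Section smooth_functions.
Context {R : realType}.
Implicit Types (f g : R -> R) (n k : nat) (x : R).
Local Notation mu := (@lebesgue_measure R).

(** Recursion on the derivative gives closure properties by induction on [n]. Only [n]-fold
    differentiability is required, not continuity of the last derivative; quantified over all [n],
    this is smoothness. *)
Fixpoint Ck n f : Prop :=
  if n is n.+1 then (forall x, derivable f x 1) /\ Ck n (derive1 f) else True.

Lemma Ck_derive1n f : (forall n, Ck n f) -> forall n x, derivable (derive1n n f) x 1.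
Proof.
move=> h n; suff : forall g, Ck n.+1 g -> forall x, derivable (derive1n n g) x 1.
  by apply; exact: h.
elim: n => [|n ih] g; first by case.
by rewrite /derive1n iterSr => -[_ /ih].
Qed.

Lemma CkP f (f' : R -> R) n : (forall x, is_derive x (1:R) f (f' x)) -> Ck n f' ->
  Ck n.+1 f.
Proof.
move=> h hf'; split; first by move=> x; case: (h x).
by rewrite (_ : derive1 f = f')//; apply/funext => x; rewrite derive1E; case: (h x).
Qed.

Lemma Ck_is_derive f n : Ck n.+1 f -> forall x, is_derive x (1:R) f (derive1 f x).
Proof. by move=> [h _] x; rewrite derive1E; exact: derivableP. Qed.

Lemma CkW f n : Ck n.+1 f -> Ck n f.
Proof. by elim: n f => // n ih f [h1 h2]; split=> //; exact: ih. Qed.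

Lemma Ck_cst (c : R) n : Ck n (fun=> c).
Proof.
elim: n c => // n ih c; apply: (@CkP _ (fun=> 0)).
exact: ih.
Qed.

Lemma CkD f g n : Ck n f -> Ck n g -> Ck n (fun x => f x + g x).
Proof.
elim: n f g => // n ih f g hf hg.
apply: (@CkP _ (fun x => derive1 f x + derive1 g x)).
  by move=> x; exact: (is_deriveD (Ck_is_derive hf x) (Ck_is_derive hg x)).
by apply: ih; [case: hf|case: hg].
Qed.

Lemma CkM f g n : Ck n f -> Ck n g -> Ck n (fun x => f x * g x).
Proof.
elim: n f g => // n ih f g hf hg.
apply: (@CkP _ (fun x => f x * derive1 g x + g x * derive1 f x)).
  by move=> x; exact: (is_deriveM (Ck_is_derive hf x) (Ck_is_derive hg x)).
have [[_ hf'] [_ hg']] := (hf, hg).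
by apply: CkD; apply: ih => //; exact: CkW.
Qed.

Lemma CkZ (c : R) f n : Ck n f -> Ck n (fun x => c * f x).
Proof. by move=> hf; apply: CkM => //; exact: Ck_cst. Qed.

Lemma is_derive_affine (s h x d : R) f : is_derive (s * x + h) (1:R) f d ->
  is_derive x (1:R) (fun y => f (s * y + h)) (s * d).
Proof.
move=> hf; rewrite mulrC.
have ha : is_derive x (1:R) (fun y => s * y + h) s.
  have := is_deriveD (is_deriveZ s (is_derive_id x (1:R)))
            (is_derive_cst (h : R^o) x 1).
  by rewrite addr0 /GRing.scale/= mulr1.
exact: (@is_derive1_comp R f (fun y => s * y + h) x d s hf ha).
Qed.

Lemma Ck_affine f (s h : R) n : Ck n f -> Ck n (fun x => f (s * x + h)).
Proof.
elim: n f => // n ih f hf.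
apply: (@CkP _ (fun x => s * derive1 f (s * x + h))).
  by move=> x; exact: (is_derive_affine (Ck_is_derive hf (s * x + h))).
by apply: CkZ; apply: ih; case: hf.
Qed.

Lemma CkV f n : (forall x, f x != 0) -> Ck n f -> Ck n (fun x => (f x)^-1).
Proof.
move=> f0; elim: n f f0 => // n ih f f0 hf.
apply: (@CkP _ (fun x => (- 1 * ((f x)^-1 * (f x)^-1)) * derive1 f x)).
  move=> x; have := @is_deriveV R f x (derive1 f x) 1 (f0 x) (Ck_is_derive hf x).
  by move=> h; apply: (is_derive_eq h); rewrite /GRing.scale/= mulN1r -exprVn expr2.
have h1 : Ck n (fun x => (f x)^-1) by apply: ih => //; exact: CkW.
by apply: CkM; [apply: CkZ; exact: CkM|case: hf].
Qed.

Lemma derive1n_affine f (s h : R) n : (forall n, Ck n f) ->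
  derive1n n (fun x => f (s * x + h)) = fun x => s ^+ n * derive1n n f (s * x + h).
Proof.
move=> hf; elim: n => [|n ih]; first by apply/funext => x; rewrite expr0 mul1r.
rewrite /derive1n iterS -/(derive1n n _) ih; apply/funext => x.
rewrite derive1E.
have hd : is_derive (s * x + h) (1:R) (derive1n n f) (derive1n n.+1 f (s * x + h)).
  by rewrite /derive1n iterS derive1E; apply: derivableP; exact: Ck_derive1n.
have := is_deriveZ (s ^+ n) (is_derive_affine hd).
case=> _; rewrite /GRing.scale/= => ->.
by rewrite mulrA -exprSr.
Qed.

(* The functions x^-k exp(-1/x) on the half-line form a family closed under
   differentiation, up to linear combinations. *)
Definition flat k x : R := if 0 < x then x^-1 ^+ k * expR (- x^-1) else 0.

Lemma flat_ge0 k x : 0 <= flat k x.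
Proof.
rewrite /flat; case: ifP => // x0.
by rewrite mulr_ge0 ?expR_ge0// exprn_ge0// invr_ge0 ltW.
Qed.

Lemma flatS k x : flat k x = x * flat k.+1 x.
Proof.
rewrite /flat; case: ifP => x0; last by rewrite mulr0.
by rewrite exprS !mulrA divff ?mul1r// gt_eqF.
Qed.

(** For x > 0, the exponential series gives exp(1/x) >= x^-(k+1) / (k+1)!. *)
Lemma flat_le k x : `|flat k x| <= (k.+1)`!%:R * `|x|.
Proof.
rewrite ger0_norm ?flat_ge0// /flat; case: ifPn => x0; last by rewrite mulr_ge0.
rewrite gtr0_norm// expRN ler_pdivrMr ?expR_gt0//.
have y0 : 0 <= x^-1 by rewrite invr_ge0 ltW.
have h := expR_ge1Dxn k y0.
have hf : (0 : R) < (k.+1)`!%:R by rewrite ltr0n fact_gt0.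
have : (k.+1)`!%:R * x * (x^-1 ^+ k.+1 / (k.+1)`!%:R) <=
       (k.+1)`!%:R * x * expR x^-1.
  apply: ler_wpM2l; first by rewrite mulr_ge0 ?ltW.
  by apply: le_trans h; rewrite lerDr.
apply: le_trans; rewrite exprS le_eqVlt; apply/orP; left; apply/eqP.
by field; rewrite !gt_eqF.
Qed.

(** By [flatS], the difference quotient at 0 is [flat k.+1], which vanishes in the limit by
    [flat_le]. *)
Lemma flat_derive0 k : is_derive (0:R) (1:R) (flat k) 0.
Proof.
have h : h^-1 *: (flat k (h *: (1:R) + 0) - flat k 0) @[h --> (0:R)^'] --> (0:R).
  have e : \forall h \near (0:R)^',
      flat k.+1 h = h^-1 *: (flat k (h *: (1:R) + 0) - flat k 0).
    near=> h.
    rewrite [flat k 0]/flat ltxx subr0 addr0 /GRing.scale/= mulr1 [in RHS]flatS.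
    by rewrite mulKf//; near: h; exact: nbhs_dnbhs_neq.
  apply: cvg_trans; first exact: near_eq_cvg e.
  apply: (@cvg_trans _ (flat k.+1 h @[h --> (0:R)])).
    by apply: cvg_fmap2; exact: cvg_within.
  have hn : (k.+2)`!%:R * `|h| @[h --> (0:R)] --> (0:R).
    rewrite -[X in _ --> X](mulr0 ((k.+2)`!%:R)); apply: cvgM; first exact: cvg_cst.
    rewrite -[X in _ --> X](@normr0 _ R); apply: cvg_norm; exact: cvg_id.
  have : flat k.+1 h @[h --> (0:R)] --> (0:R); last by [].
  apply: norm_cvg0; apply: (squeeze_cvgr _ (cvg_cst 0) hn).
  by apply: nearW => h; rewrite normr_ge0 flat_le.
by apply: DeriveDef; [apply/cvg_ex; exists 0|exact: cvg_lim].
Unshelve. all: by end_near. Qed.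

Lemma flat_is_derive k x :
  is_derive x (1:R) (flat k) ((- k%:R) * flat k.+1 x + flat k.+2 x).
Proof.
have [x0|x0|->] := ltgtP x 0; last first.
- by rewrite /flat ltxx mulr0 addr0; exact: flat_derive0.
- apply: (@near_eq_is_derive _ _ _ (fun x => x^-1 ^+ k * expR (- x^-1))).
    near=> y; rewrite /flat ifT//.
    by near: y; exact: lt_nbhsr.
  have xn0 : x != 0 by rewrite gt_eqF.
  have hV := @is_deriveV R id x 1 1 xn0 (is_derive_id x 1).
  have hX := @is_deriveX R R^o _ k x 1 _ hV.
  have hE := @is_derive1_comp R expR _ x _ _ (is_derive_expR _) (is_deriveN hV).
  have := is_deriveM hX hE.
  have eX (j : nat) (y : R) : ([eta GRing.inv] ^+ j : R -> R) y = y^-1 ^+ j.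
    by elim: j => [|j ih]; rewrite ?expr0// !exprS -ih.
  move=> h; rewrite (_ : (fun _ => _) = ([eta GRing.inv] ^+ k * (expR \o - [eta GRing.inv])));
    last by apply/funext => y; rewrite -eX.
  apply: (is_derive_eq h); rewrite /flat x0 eX /GRing.scale/=.
  rewrite -exprVn -[(- [eta GRing.inv]) x]/(- x^-1) mulr1.
  case: k {h hX} => [|k]; first by rewrite !exprS !expr0; ring.
  by rewrite /= !exprS !expr0; ring.
- rewrite /flat ltNge (ltW x0)/= mulr0 addr0.
  apply: (@near_eq_is_derive _ _ _ (fun=> 0)).
  near=> y; rewrite /flat ifF//; apply/negbTE; rewrite -leNgt; apply: ltW.
  by near: y; exact: lt_nbhsl.
Unshelve. all: by end_near. Qed.

Lemma Ck_flat k n : Ck n (flat k).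
Proof.
elim: n k => // n ih k.
apply: (CkP (flat_is_derive k)).
by apply: CkD => //; apply: CkZ.
Qed.

End smooth_functions.

(** * Smooth cutoffs and compactly supported functions *)

Section test_functions.
Context {R : realType}.
Implicit Types (f g phi u : R -> R) (n k : nat) (x a b : R).
Local Notation mu := (@lebesgue_measure R).

Lemma Ck1_continuous f : Ck 1 f -> continuous f.
Proof.
by move=> [h _] x; apply: differentiable_continuous; exact/derivable1_diffP.
Qed.

Lemma continuous_bounded_itv f a b : continuous f ->
  exists2 B, 0 < B & forall x, a <= x <= b -> `|f x| <= B.
Proof.
move=> cf; have [ab|ba] := leP a b; last first.
  by exists 1 => // x /andP[h1 h2]; have := lt_le_trans ba (le_trans h1 h2); rewrite ltxx.
have cn : {within `[a, b], continuous (fun x => `|f x|)}.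
  by apply: continuous_subspaceT => x; apply: cvg_norm; exact: cf.
have [c _ hc] := EVT_max ab cn.
exists (`|f c| + 1); first by rewrite ltr_wpDl.
by move=> x hx; rewrite (le_trans (hc x _)) ?in_itv// lerDl.
Qed.

Lemma derive1_locally_cst f x c : (\forall y \near x, f y = c) -> derive1 f x = 0.
Proof.
move=> h; rewrite derive1E (@near_eq_derive _ _ _ _ (cst c)).
  by rewrite derive_cst.
exact: h.
Qed.

(** The smooth transition from 0 on x <= 0 to 1 on x >= 1; the denominator is positive because x and
    1 - x are never both nonpositive. *)
Definition step x : R := flat 0 x / (flat 0 x + flat 0 (1 - x)).

Lemma flat0_gt0 x : 0 < x -> 0 < flat 0 x.
Proof. by move=> x0; rewrite /flat x0 expr0 mul1r expR_gt0. Qed.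

Lemma flat_le0 k x : x <= 0 -> flat k x = 0.
Proof. by move=> x0; rewrite /flat ltNge x0. Qed.

Lemma step_den_gt0 x : 0 < flat 0 x + flat 0 (1 - x).
Proof.
have [x0|x0] := ltP 0 x; first by rewrite ltr_pwDl ?flat0_gt0 ?flat_ge0.
by rewrite ltr_wpDl ?flat_ge0// flat0_gt0// subr_gt0 (le_lt_trans x0).
Qed.

Lemma step_le0 x : x <= 0 -> step x = 0.
Proof. by move=> x0; rewrite /step flat_le0 ?mul0r. Qed.

Lemma step_ge1 x : 1 <= x -> step x = 1.
Proof.
move=> x1; have := step_den_gt0 x; rewrite /step (@flat_le0 _ (1 - x)) ?subr_le0//.
by rewrite addr0 => h; rewrite divff// gt_eqF.
Qed.

Lemma step_itv x : 0 <= step x <= 1.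
Proof.
have d := step_den_gt0 x.
by rewrite /step divr_ge0 ?flat_ge0 ?(ltW d)//= ler_pdivrMr// mul1r lerDl flat_ge0.
Qed.

Lemma Ck_step n : Ck n step.
Proof.
apply: CkM; first exact: Ck_flat.
apply: CkV; first by move=> x; rewrite gt_eqF// step_den_gt0.
apply: CkD; first exact: Ck_flat.
rewrite (_ : (fun x => _) = (fun x : R => flat 0 (- 1 * x + 1))); last first.
  by apply/funext => x; rewrite mulN1r addrC.
by apply: Ck_affine; exact: Ck_flat.
Qed.

Lemma Ck_derive1 f : (forall n, Ck n f) -> forall n, Ck n (derive1 f).
Proof. by move=> h n; case: (h n.+1). Qed.

Lemma dstep_continuous : continuous (derive1 step).
Proof. by apply: Ck1_continuous; apply: Ck_derive1; exact: Ck_step. Qed.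

Lemma dstep0 x : ~~ (0 <= x <= 1) -> derive1 step x = 0.
Proof.
rewrite negb_and -!ltNge => /orP[x0|x1].
  apply: (@derive1_locally_cst _ _ 0); near=> y; apply: step_le0; apply: ltW.
  by near: y; exact: lt_nbhsl.
apply: (@derive1_locally_cst _ _ 1); near=> y; apply: step_ge1; apply: ltW.
by near: y; exact: lt_nbhsr.
Unshelve. all: by end_near. Qed.

Lemma dstep_bounded : exists2 B, 0 < B & forall x, `|derive1 step x| <= B.
Proof.
have [B B0 hB] := @continuous_bounded_itv _ 0 1 dstep_continuous.
exists B => // x; have [/hB//|/dstep0 ->] := boolP (0 <= x <= 1).
by rewrite normr0 ltW.
Qed.

Lemma test_functionI phi a b : (forall n, Ck n phi) ->
  (forall x, ~~ (a <= x <= b) -> phi x = 0) -> test_function phi.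
Proof.
move=> hs h0; split; first exact: Ck_derive1n.
apply: (@subclosed_compact _ _ `[a, b]%classic).
- exact: closed_closure.
- exact: segment_compact.
- rewrite [X in _ `<=` X](closure_id _).1; last exact: itv_closed.
  apply: closure_subset => x /= /eqP hx; rewrite in_itv/=.
  by apply: contrapT => /negP /h0.
Qed.

Lemma test_function_Ck phi : test_function phi -> forall n, Ck n phi.
Proof.
move=> [h _] n.
suff : forall m g, (forall k x, derivable (derive1n k g) x 1) -> Ck m g by exact.
elim=> // m ih g hg; split; first exact: (hg 0).
by apply: ih => k x; have := hg k.+1 x; rewrite /derive1n iterSr.
Qed.

Lemma test_function_supp phi : test_function phi ->
  exists2 r, 0 < r & forall x, r < `|x| -> phi x = 0.
Proof.
move=> [_ /compact_bounded [M [_ hM]]].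
exists (`|M| + 1); first by rewrite ltr_wpDl.
move=> x hx; apply/eqP; apply: contraTT hx => hx; rewrite -leNgt.
apply: (hM (`|M| + 1)); first by rewrite (le_lt_trans (ler_norm M))// ltrDl.
exact: subset_closure.
Qed.

Lemma test_function_derive1 phi : test_function phi -> test_function (derive1 phi).
Proof.
move=> tphi; have [r r0 hr] := test_function_supp tphi.
apply: (@test_functionI _ (- (r + 1)) (r + 1)).
  by apply: Ck_derive1; exact: test_function_Ck.
move=> x; rewrite -ler_norml -ltNge => hx.
apply: (@derive1_locally_cst _ _ 0); near=> y; apply: hr.
near: y; have : `|y| @[y --> x] --> `|x| by apply: cvg_norm; exact: cvg_id.
move=> /cvgr_gt; apply; apply: lt_trans hx; by rewrite ltrDl.
Unshelve. all: by end_near. Qed.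

Lemma test_function_derive1n phi n : test_function phi -> test_function (derive1n n phi).
Proof.
by move=> h; elim: n => // n; rewrite /derive1n iterS; exact: test_function_derive1.
Qed.

Lemma test_function_continuous phi : test_function phi -> continuous phi.
Proof. by move=> h; apply: Ck1_continuous; exact: test_function_Ck. Qed.

Lemma continuous_meas f : continuous f -> measurable_fun setT f.
Proof. by move=> cf; exact: continuous_measurable_fun. Qed.

Lemma test_function_bounded phi : test_function phi ->
  exists2 B, 0 < B & forall x, `|phi x| <= B.
Proof.
move=> h; have [r r0 hr] := test_function_supp h.
have [B B0 hB] := @continuous_bounded_itv _ (- r) r (test_function_continuous h).
exists B => // x; have [|/hr ->] := leP `|x| r; first by rewrite ler_norml => /hB.
by rewrite normr0 ltW.
Qed.

Lemma locint_itv u a b : locally_integrable setT u ->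
  integR (fun x => `|u x| * \1_(`[a, b]%classic) x).
Proof.
move=> [mu_ _ hu].
have hi : mu.-integrable `[a, b]%classic (EFin \o u).
  apply/integrableP; split.
    by apply/measurable_EFinP; apply: measurable_funS mu_.
  by apply: hu => //; exact: segment_compact.
have := (@integrable_mkcond _ _ _ mu `[a, b]%classic
   (fun x => (`|u x|)%:E) (measurable_itv _)).1 (integrable_norm hi).
apply: eq_integrable => // x _; rewrite patchE /= indicE.
by case: ifP => _; rewrite ?mulr1 ?mulr0.
Qed.

Lemma locint_mul_bounded u g a b B : locally_integrable setT u ->
  measurable_fun setT g -> (forall x, `|g x| <= B) ->
  (forall x, ~~ (a <= x <= b) -> g x = 0) ->
  integR (fun x => u x * g x).
Proof.
move=> lu mg hB h0; have [mu_ _ _] := lu.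
apply: (@integR_dom _ _ (fun x => B * (`|u x| * \1_(`[a, b]%classic) x))).
- exact: measurable_funM.
- move=> x; rewrite normrM indicE; have [|/h0 ->] := boolP (a <= x <= b).
    by move=> xab; rewrite mem_set/= ?in_itv//= mulr1 mulrC ler_wpM2r.
  rewrite normr0 mulr0; apply: mulr_ge0; last by rewrite mulr_ge0.
  by apply: le_trans (hB x).
- by apply: integRZ; exact: locint_itv.
Qed.

Lemma locint_test u phi : locally_integrable setT u -> test_function phi ->
  integR (fun x => u x * phi x).
Proof.
move=> lu h; have [r r0 hr] := test_function_supp h.
have [B B0 hB] := test_function_bounded h.
apply: (@locint_mul_bounded _ _ (- r) r B) => //.
  by apply: continuous_meas; exact: test_function_continuous.
by move=> x; rewrite -ler_norml -ltNge => /hr.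
Qed.

Lemma integR_test phi : test_function phi -> integR phi.
Proof.
move=> h; apply: (@eq_integR _ (fun x => 1 * phi x)); first by move=> x; rewrite mul1r.
apply: locint_test => //; split => //; first exact: openT.
move=> K _ cK; under eq_integral => x _ do rewrite normr1.
by rewrite integral_cst//= ?mul1e; [exact: compact_finite_measure|exact: compact_measurable].
Qed.

Lemma Int_derive1 f a b : a < b -> (forall x, derivable f x 1) ->
  continuous (derive1 f) -> (forall x, ~~ (a <= x <= b) -> derive1 f x = 0) ->
  \int[mu]_x derive1 f x = f b - f a.
Proof.
move=> ab df cf h0.
have cf0 : continuous f.
  by move=> x; apply: differentiable_continuous; exact/derivable1_diffP.
have <- : \int[mu]_(x in `[a, b]) derive1 f x = f b - f a.
  rewrite /Rintegral (@continuous_FTC2 _ (derive1 f) f a b)//.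
  - by apply: continuous_subspaceT => x; exact: cf.
  - split=> //.
    + by apply: cvg_at_right_filter; exact: cf0.
    + by apply: cvg_at_left_filter; exact: cf0.
rewrite [RHS]Rintegral_mkcond; apply: eq_Int => x.
rewrite patchE; case: ifPn => //; rewrite notin_setE/= in_itv/= => /negP.
by move/h0.
Qed.

Lemma Int_dtest phi : test_function phi -> \int[mu]_x derive1 phi x = 0.
Proof.
move=> h; have h' := test_function_derive1 h; have [r r0 hr] := test_function_supp h.
have [r' r'0 hr'] := test_function_supp h'.
have rr : 0 < r + r' + 1 by rewrite ltr_wpDl// addr_ge0// ltW.
rewrite (@Int_derive1 _ (- (r + r' + 1)) (r + r' + 1)).
- rewrite !hr ?subrr// ?normrN ger0_norm ?(ltW rr)// -addrA ltrDl.
  by rewrite ltr_wpDl// ltW.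
  by rewrite ltr_wpDl// ltW.
- by rewrite -subr_gt0 opprK addr_gt0.
- by case: (test_function_Ck h 1).
- exact: test_function_continuous.
- move=> x; rewrite -ler_norml -ltNge => hx; apply: hr'; apply: lt_trans hx.
  by rewrite (addrC r) -addrA ltrDl ltr_wpDl// ltW.
Qed.

End test_functions.

(** * Weak derivatives *)

Section weak_derivatives.
Context {R : realType}.
Implicit Types (f g phi u : R -> R) (n k : nat) (x a b : R).
Local Notation mu := (@lebesgue_measure R).

(** The transition compressed into [a, a + 1/(n+1)]: its derivative is a one-sided approximate
    identity at [a], of integral 1. *)
Definition stepn n a x : R := step (n.+1%:R * x + - (n.+1%:R * a)).

Lemma Ck_stepn n a m : Ck m (stepn n a).
Proof. by apply: Ck_affine; exact: Ck_step. Qed.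

Lemma stepn_itv n a x : 0 <= stepn n a x <= 1.
Proof. exact: step_itv. Qed.

Lemma stepn_le n a x : x <= a -> stepn n a x = 0.
Proof. by move=> xa; apply: step_le0; rewrite subr_le0 ler_pM2l. Qed.

Lemma stepn_ge n a x : a + n.+1%:R^-1 <= x -> stepn n a x = 1.
Proof.
move=> xa; apply: step_ge1; rewrite -mulrBr -ler_pdivrMl// mulr1 lerBrDl.
exact: xa.
Qed.

Lemma derive1_stepn n a :
  derive1 (stepn n a) = fun x => n.+1%:R * derive1 step (n.+1%:R * x + - (n.+1%:R * a)).
Proof.
have := @derive1n_affine R step n.+1%:R (- (n.+1%:R * a)) 1 (@Ck_step R).
by rewrite expr1.
Qed.

Lemma derive1_stepn0 n a x : ~~ (a <= x <= a + n.+1%:R^-1) -> derive1 (stepn n a) x = 0.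
Proof.
move=> h; rewrite derive1_stepn dstep0 ?mulr0//; apply: contra h.
rewrite -mulrBr pmulr_rge0// subr_ge0 => /andP[-> /=].
by rewrite -ler_pdivlMl// mulr1 lerBlDl.
Qed.

Lemma inv_nat_le1 n : n.+1%:R^-1 <= 1 :> R.
Proof. by rewrite invf_le1// ler1n. Qed.

Lemma test_derive1_stepn n a : test_function (derive1 (stepn n a)).
Proof.
apply: (@test_functionI _ _ a (a + n.+1%:R^-1)).
  by apply: Ck_derive1 => m; exact: Ck_stepn.
by move=> x; exact: derive1_stepn0.
Qed.

Lemma Int_derive1_stepn n a : \int[mu]_x derive1 (stepn n a) x = 1.
Proof.
rewrite (@Int_derive1 _ _ a (a + n.+1%:R^-1)).
- by rewrite (@stepn_ge _ _ (_ + _))// stepn_le// subr0.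
- by rewrite ltrDl.
- by case: (Ck_stepn n a 1).
- by apply: test_function_continuous; exact: test_derive1_stepn.
- by move=> x; exact: derive1_stepn0.
Qed.

(** The mollifier is bounded by (n+1) B and supported in a ball of radius r = 2/(n+1) and measure
    2r. Hence the error is at most 4 B times the mean oscillation [davg u a r], which tends to 0 at
    a Lebesgue point. *)
Lemma lebesgue_pt_mollify u a : locally_integrable setT u -> lebesgue_pt u a ->
  \int[mu]_x (u x * derive1 (stepn n a) x) @[n --> \oo] --> u a.
Proof.
move=> lu la; have [B B0 hB] := @dstep_bounded R.
have mu_ : measurable_fun setT u by case: lu.
apply/cvgrPdist_le => e e0.
have e4 : 0 < e / (4 * B) by rewrite divr_gt0// mulr_gt0.
have : \forall r \near (0:R)^'+, (davg u a r < (e / (4 * B))%:E)%E.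
  have h := la; apply: (h [set z | (z < (e / (4 * B))%:E)%E]).
  by apply: open_ereal_lt'; rewrite lte_fin.
move=> [d /= d0 hd].
have : \forall n \near \oo, (2 / n.+1%:R : R) < d.
  near=> n; rewrite ltr_pdivrMr// mulrC -ltr_pdivrMr//.
  apply: (@lt_trans _ _ n%:R); last by rewrite ltr_nat.
  by near: n; exact: nbhs_infty_gtr.
apply: filterS => n hn.
have rn0 : 0 < 2 / n.+1%:R :> R by rewrite divr_gt0.
have {hd} hd : (davg u a (2 / n.+1%:R) < (e / (4 * B))%:E)%E.
  by apply: hd => //=; rewrite sub0r normrN gtr0_norm.
have i1 := locint_test lu (test_derive1_stepn n a).
have i2 := integR_test (test_derive1_stepn n a).
have -> : u a = \int[mu]_x (u a * derive1 (stepn n a) x).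
  by rewrite IntZ// Int_derive1_stepn mulr1.
rewrite -IntB//; last exact: integRZ.
rewrite -lee_fin.
(* Twice the length of the support, so that the open ball contains its endpoint a + 1/(n+1). *)
set r := 2 / _ in rn0 hd.
pose D : set R := ball a r.
have mD : measurable D by exact: measurable_ball.
have idom : integR (fun x => n.+1%:R * B * (`|u x - u a| * \1_D x)).
  apply: integRZ.
  apply: (@integR_dom _ _ (fun x => `|u x - u a| * \1_(`[a - r, a + r]%classic) x)).
  - apply: measurable_funM; last exact: measurable_indic.
    by apply: measurableT_comp => //; exact: measurable_funB.
  - move=> x; rewrite ger0_norm ?mulr_ge0// ler_wpM2l// !indicE.
    rewrite /D ball_itv; case: (boolP (x \in _)) => //=; rewrite inE/= in_itv/=.
    by move=> /andP[h1 h2]; rewrite mem_set//= in_itv/= !ltW.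
  - have hc : locally_integrable setT (fun x => u x - u a).
      apply: locally_integrableB => //; split => //; first exact: openT.
      move=> K _ cK; rewrite integral_cst; last exact: compact_measurable.
      by apply: lte_mul_pinfty => //; exact: compact_finite_measure.
    exact: locint_itv.
apply: (@le_trans _ _ (\int[mu]_x (n.+1%:R * B * (`|u x - u a| * \1_D x)))%:E).
  rewrite lee_fin; apply: le_norm_Int => //.
    by apply: integRB => //; exact: integRZ.
  move=> x; rewrite -mulrBl normrM distrC.
  have [hx|hx] := boolP (a <= x <= a + n.+1%:R^-1); last first.
    by rewrite derive1_stepn0// normr0 mulr0 !mulr_ge0// ltW.
  have xD : x \in D.
    rewrite inE /D /ball/= distrC; case/andP: hx => h1 h2.
    rewrite ger0_norm ?subr_ge0// ltrBlDl (le_lt_trans h2)// ltrD2l /r.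
    by rewrite -[ltLHS]mul1r ltr_pM2r// ltr1n.
  rewrite indicE xD mulr1 [leRHS]mulrC distrC ler_wpM2l// derive1_stepn normrM.
  by rewrite ger0_norm// ler_wpM2l.
have hD : mu D = (2 * r)%:E.
  by rewrite /D lebesgue_measure_ball ?ltW// mulr2n mulrDl mul1r.
have idom' : integR (fun x => `|u x - u a| * \1_D x).
  have := integRZ (n.+1%:R * B)^-1 idom; apply: eq_integR => x.
  by rewrite mulKf// mulf_neq0// gt_eqF.
rewrite IntZ// EFinM -(integR_EFin idom').
have -> : (\int[mu]_x (`|u x - u a| * \1_D x)%:E = (2 * r)%:E * davg u a r)%E.
  have r20 : (2 * r == 0) = false by rewrite gt_eqF// mulr_gt0.
  rewrite /davg /iavg -/D hD muleA inver r20.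
  rewrite -EFinM divff ?r20// mul1e.
  rewrite [RHS]integral_mkcond; apply: eq_integral => x _.
  rewrite patchE indicE; case: ifP => _; rewrite ?mulr1 ?mulr0//=.
apply: (@le_trans _ _ ((n.+1%:R * B * (2 * r))%:E * (e / (4 * B))%:E)%E).
  rewrite muleA -EFinM; apply: lee_wpmul2l; last exact: ltW.
  by rewrite lee_fin !mulr_ge0// ltW.
rewrite -EFinM lee_fin /r le_eqVlt; apply/orP; left; apply/eqP.
by field; rewrite gt_eqF//= pnatr_eq0.
Unshelve. all: by end_near. Qed.

(** Fundamental lemma of the calculus of variations: the mollifiers recover the value of [g] at each
    Lebesgue point, and almost every point is one. *)
Lemma locint_eq0 g : locally_integrable setT g ->
  (forall phi, test_function phi -> \int[mu]_x (g x * phi x) = 0) ->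
  {ae mu, forall x, g x = 0}.
Proof.
move=> lg h; apply: ae_imp (lebesgue_differentiation lg) => a /(lebesgue_pt_mollify lg).
rewrite (_ : (fun n => _) = fun=> 0); last first.
  by apply/funext => n; apply: h; exact: test_derive1_stepn.
by move=> /(cvg_lim (@Rhausdorff R)); rewrite lim_cst.
Qed.

Lemma is_weak_deriv_unique k u g g' : is_weak_deriv k u g -> is_weak_deriv k u g' ->
  {ae mu, forall x, g x = g' x}.
Proof.
move=> [_ lg hg] [_ lg' hg'].
have := @locint_eq0 (fun x => g x - g' x) (locally_integrableB lg lg').
move=> h; apply: ae_imp (h _) => [x /subr0_eq//|phi tp].
under eq_Int do rewrite mulrBl.
rewrite (IntB (locint_test lg tp) (locint_test lg' tp)); apply/eqP; rewrite subr_eq0; apply/eqP.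
have := hg _ tp; rewrite hg'// => /(congr1 (fun z => (-1) ^+ k * z)).
by rewrite !mulrA -!expr2 -!exprM mulnC !exprM sqrrN !expr1n !mul1r.
Qed.

(** The test function is a difference of two transitions: it tends to the indicator of ]a, b], while
    its derivative is the difference of the mollifiers at [a] and at [b]. *)
Lemma weak_deriv1_lebesgue_pt u g a b : is_weak_deriv 1 u g ->
  lebesgue_pt u a -> lebesgue_pt u b -> a < b ->
  u b - u a = \int[mu]_x (g x * \1_(`]a, b]%classic) x).
Proof.
move=> [lu lg h] la lb ab.
pose p n x := stepn n a x - stepn n b x.
have tp n : test_function (p n).
  apply: (@test_functionI _ _ a (b + 1)).
    move=> m; rewrite (_ : p n = fun x => stepn n a x + (-1) * stepn n b x).
      by apply: CkD; [exact: Ck_stepn|apply: CkZ; exact: Ck_stepn].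
    by apply/funext => x; rewrite mulN1r.
  move=> x; rewrite negb_and -!ltNge /p => /orP[xa|xb].
    by rewrite !stepn_le ?subrr// ltW// (lt_trans xa).
  rewrite !stepn_ge ?subrr//.
    by rewrite (le_trans _ (ltW xb))// lerD2l inv_nat_le1.
  by rewrite (le_trans _ (ltW xb))// lerD ?inv_nat_le1// ltW.
have dp n x : derive1 (p n) x = derive1 (stepn n a) x - derive1 (stepn n b) x.
  rewrite !derive1E; have [da _] := Ck_stepn n a 1; have [db _] := Ck_stepn n b 1.
  by rewrite -deriveB.
have lhs : \int[mu]_x (u x * derive1n 1 (p n) x) @[n --> \oo] --> u a - u b.
  rewrite (_ : (fun n => _) = fun n => \int[mu]_x (u x * derive1 (stepn n a) x) -
     \int[mu]_x (u x * derive1 (stepn n b) x)); last first.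
    apply/funext => n; rewrite -(IntB (locint_test lu (test_derive1_stepn n a))
      (locint_test lu (test_derive1_stepn n b))).
    by apply: eq_Int => x; rewrite -mulrBr -dp.
  by apply: cvgB; exact: lebesgue_pt_mollify.
have mg : measurable_fun setT g by case: lg.
have pcvg x : p n x @[n --> \oo] --> (\1_(`]a, b]%classic) x : R).
  have ev c : c < x -> \forall n \near \oo, stepn n c x = 1.
    move=> cx; near=> n; apply: stepn_ge; rewrite -lerBrDl.
    rewrite invf_ple ?posrE ?subr_gt0//.
    apply: (@le_trans _ _ n%:R); last by rewrite ler_nat.
    by near: n; exact: nbhs_infty_ger.
  apply: cvg_near_cst; rewrite indicE mem_setE/= in_itv/= /p.
  have [ax|xa] := ltP a x; last first.
    by apply: nearW => n; rewrite !stepn_le ?subrr// (le_trans xa)// ltW.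
  have [xb|bx] := leP x b => /=.
    by near=> n; rewrite (near (ev _ ax))// stepn_le// subr0.
  by near=> n; rewrite (near (ev _ ax))// (near (ev _ bx))// subrr.
have rhs : \int[mu]_x (g x * p n x) @[n --> \oo] -->
           \int[mu]_x (g x * \1_(`]a, b]%classic) x).
  apply: (@dct _ _ _ (fun x => `|g x| * \1_(`[a, b + 1]%classic) x) _ _ _ _ _).2.
  - move=> n; apply: measurable_funM => //; apply: continuous_meas.
    exact: test_function_continuous.
  - by apply: measurable_funM => //; exact: measurable_indic.
  - by apply: aeW => x; apply: cvgM; [exact: cvg_cst|exact: pcvg].
  - exact: locint_itv.
  - move=> n x; rewrite normrM ler_wpM2l// indicE mem_setE/= in_itv/=.
    have [xab|/negP xab] := boolP (a <= x <= b + 1).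
      rewrite (_ : true%:R = 1 :> R)// /p ler_norml.
       have := stepn_itv n a x; have := stepn_itv n b x.
      move=> /andP[h1 h2] /andP[h3 h4]; apply/andP; split; lra.
    move: xab => /negP; rewrite negb_and -!ltNge /p => /orP[xa|xb].
      by rewrite !stepn_le ?subrr ?normr0// ltW// (lt_trans xa).
    rewrite !stepn_ge ?subrr ?normr0//.
      by rewrite (le_trans _ (ltW xb))// lerD2l inv_nat_le1.
    by rewrite (le_trans _ (ltW xb))// lerD ?inv_nat_le1// ltW.
have e : (fun n => \int[mu]_x (u x * derive1n 1 (p n) x)) =
         (fun n => - \int[mu]_x (g x * p n x)).
  by apply/funext => n; rewrite h// expr1 mulN1r.
move: lhs; rewrite e => lhs.
have rhs' : - (\int[mu]_x (g x * p n x)) @[n --> \oo] -->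
    - (\int[mu]_x (g x * \1_(`]a, b]%classic) x)) by exact: cvgN.
have : u a - u b = - (\int[mu]_x (g x * \1_(`]a, b]%classic) x)).
  exact: (cvg_unique (@Rhausdorff R) lhs rhs').
by move=> /(congr1 -%R); rewrite opprB opprK.
Unshelve. all: by end_near. Qed.

End weak_derivatives.

(** * Square integrable functions and the continuous representative *)

Section square_integrable.
Context {R : realType}.
Implicit Types (f g phi u v : R -> R) (a b c : R).
Local Notation mu := (@lebesgue_measure R).

Definition L2 f : Prop := measurable_fun setT f /\ integR (fun x => f x ^+ 2).

Lemma L2_mul f g : L2 f -> L2 g -> integR (fun x => f x * g x).
Proof.
move=> [mf hf] [mg hg].
apply: (@integR_dom _ _ (fun x => f x ^+ 2 + g x ^+ 2)).
- exact: measurable_funM.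
- move=> x; rewrite normrM -[X in _ <= X + _]real_normK ?num_real//.
  rewrite -[X in _ <= _ + X]real_normK ?num_real//.
  by set s := `|f x|; set t := `|g x|; nra.
- exact: integRD.
Qed.

Lemma Lfun2P f : f \in Lfun mu 2%:E <-> L2 f.
Proof.
split=> [h|[mf hf]].
  split; first by move: h; rewrite inE => /andP[+ _]; rewrite inE.
  exact: Lfun2_integrable_sqr.
rewrite inE; apply/andP; split; rewrite inE//=.
rewrite /finite_norm unlock; apply: poweR_lty.
case/integrableP: hf => _; apply: le_lt_trans.
rewrite le_eqVlt; apply/orP; left; apply/eqP; apply: eq_integral => x _ /=.
by rewrite -[X in (X `^ _)%:E]normr_id powR_mulrn ?normr_ge0// normrX normr_id.
Qed.

Lemma L2Z c f : L2 f -> L2 (fun x => c * f x).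
Proof.
move=> [mf hf]; split; first exact: measurable_funM.
by apply: (@eq_integR _ (fun x => c ^+ 2 * f x ^+ 2)) (integRZ _ hf) => x; rewrite exprMn.
Qed.

Lemma L2D f g : L2 f -> L2 g -> L2 (fun x => f x + g x).
Proof.
move=> hf hg; have hfg := L2_mul hf hg; case: hf hg => mf hf [mg hg].
split; first exact: measurable_funD.
apply: (@eq_integR _ (fun x => f x ^+ 2 + (2 * (f x * g x) + g x ^+ 2))).
  by move=> x; ring.
by apply: integRD => //; apply: integRD => //; exact: integRZ.
Qed.

Lemma L2B f g : L2 f -> L2 g -> L2 (fun x => f x - g x).
Proof.
move=> hf hg; rewrite (_ : (fun _ => _) = (fun x => f x + (-1) * g x)).
  by apply: L2D => //; exact: L2Z.
by apply/funext => x; rewrite mulN1r.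
Qed.

Lemma L2_norm f : L2 f -> L2 (fun x => `|f x|).
Proof.
move=> [mf hf]; split; first exact: measurableT_comp.
by apply: eq_integR hf => x; rewrite real_normK// num_real.
Qed.

Lemma L2_ae f g : measurable_fun setT g -> {ae mu, forall x, f x = g x} ->
  L2 f -> L2 g.
Proof.
move=> mg fg [mf hf]; split => //; apply: ae_integR hf.
  exact: measurable_funX.
by apply: ae_imp fg => x ->.
Qed.

Lemma L2_dom f g : measurable_fun setT f -> (forall x, `|f x| <= `|g x|) ->
  L2 g -> L2 f.
Proof.
move=> mf fg [_ hg]; split => //; apply: integR_dom hg; first exact: measurable_funX.
move=> x; rewrite normrX -[leRHS]real_normK ?num_real//.
by rewrite lerXn2r// nnegrE.
Qed.

Lemma Int_sqrD f g c : L2 f -> L2 g ->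
  \int[mu]_x ((f x + c * g x) ^+ 2) =
  \int[mu]_x (f x ^+ 2) + 2 * c * \int[mu]_x (f x * g x) +
  c ^+ 2 * \int[mu]_x (g x ^+ 2).
Proof.
move=> hf hg; have hfg := L2_mul hf hg; case: hf hg => mf hf [mg hg].
have h1 := integRZ (2 * c) hfg; have h2 := integRZ (c ^+ 2) hg.
rewrite -(IntZ _ hfg) -(IntZ _ hg) -(IntD hf h1) -(IntD (integRD hf h1) h2).
by apply: eq_Int => x; ring.
Qed.

Lemma Int_sqr_ge0 f : 0 <= \int[mu]_x (f x ^+ 2).
Proof. by apply: Int_ge0 => x; exact: sqr_ge0. Qed.

Lemma cauchy_schwarz_Int f g : L2 f -> L2 g ->
  (\int[mu]_x (f x * g x)) ^+ 2 <= \int[mu]_x (f x ^+ 2) * \int[mu]_x (g x ^+ 2).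
Proof.
move=> hf hg.
have h c : 0 <= \int[mu]_x (f x ^+ 2) + 2 * c * \int[mu]_x (f x * g x) +
    c ^+ 2 * \int[mu]_x (g x ^+ 2) by rewrite -Int_sqrD// Int_sqr_ge0.
have := Int_sqr_ge0 f; have := Int_sqr_ge0 g; move: h.
set A := \int[mu]_x (f x ^+ 2); set B := \int[mu]_x (f x * g x).
set C := \int[mu]_x (g x ^+ 2) => h C0 A0.
have [C_0|C_n0] := eqVneq C 0.
  have [->|B0] := eqVneq B 0; first by rewrite expr0n mulr_ge0.
  (* With C = 0 the nonnegative polynomial is A + 2 c B, and this c gives it the value -1. *)
  have := h (- (A + 1) / (2 * B)); rewrite C_0 mulr0 addr0.
  rewrite (_ : 2 * (- (A + 1) / (2 * B)) * B = - (A + 1)); last by field.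
  by lra.
have {}C0 : 0 < C by rewrite lt_def C_n0.
(* The minimum point of the quadratic polynomial in c. *)
have := h (- B / C).
rewrite (_ : _ + _ = (A * C - B ^+ 2) / C); last by field.
by rewrite pmulr_lge0 ?invr_gt0// subr_ge0.
Qed.

(** On a compact set, |f| <= f^2 + 1 and the latter is integrable. *)
Lemma L2_locint f : L2 f -> locally_integrable setT f.
Proof.
move=> [mf hf]; split => //; first exact: openT.
move=> K _ cK.
have mK : measurable K by exact: compact_measurable.
have hK : mu.-integrable K (EFin \o (fun x => f x ^+ 2 + 1)).
  have h1 : mu.-integrable K (EFin \o (fun x => f x ^+ 2)).
    by apply: integrableS hf.
  have h2 : mu.-integrable K (EFin \o (fun=> 1)).
    apply/integrableP; split; first exact: measurable_cst.
    rewrite (_ : integral _ _ _ = \int[mu]_(x in K) (cst 1%E x))%E; last first.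
      by apply: eq_integral => x _; rewrite /= normr1.
    by rewrite integral_cst//= mul1e; exact: compact_finite_measure.
  have mK' : (measurable : set (set (measurableTypeR R))) K by exact: compact_measurable.
  exact: (integrableD mK' h1 h2).
case/integrableP: hK => m1; apply: le_lt_trans; apply: ge0_le_integral => //.
- apply/measurable_EFinP; apply: measurableT_comp => //.
  exact: measurable_funS mf.
- by apply: measurableT_comp.
- move=> x _; rewrite lee_fin /= [leRHS]ger0_norm ?addr_ge0 ?sqr_ge0//.
  rewrite -[X in _ <= X + _]real_normK ?num_real//.
  by set s := `|f x|; nra.
Qed.

Lemma L2_test phi : test_function phi -> L2 phi.
Proof.
move=> h; split; first by apply: continuous_meas; exact: test_function_continuous.
have [B B0 hB] := test_function_bounded h.
apply: (@integR_dom _ _ (fun x => B * `|phi x|)).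
- apply: measurable_funX; apply: continuous_meas; exact: test_function_continuous.
- by move=> x; rewrite normrX expr2 ler_wpM2r.
- by apply: integRZ; apply: integR_norm; exact: integR_test.
Qed.

Lemma L2_indic_itv a b : L2 (\1_(`]a, b]%classic) : R -> R).
Proof.
split; first exact: measurable_indic.
apply: (@eq_integR _ (\1_(`]a, b]%classic))); last exact: integrable_indic_itv.
by move=> x; rewrite indicE; case: (_ \in _); rewrite ?expr1n ?expr0n.
Qed.

Lemma Int_indic_itv a b : a <= b -> \int[mu]_x (\1_(`]a, b]%classic) x : R) = b - a.
Proof.
move=> ab; rewrite /Rintegral.
have -> : (\int[mu]_x (\1_(`]a, b]%classic) x)%:E = mu `]a, b]%classic)%E.
  by rewrite integral_indic// setIT.
rewrite lebesgue_measure_itv/=.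
rewrite lte_fin; have [//|ba|->] := ltgtP a b; last by rewrite subrr.
by have := lt_le_trans ba ab; rewrite ltxx.
Qed.

Lemma indic_sqr (A : set R) x : (\1_A x : R) ^+ 2 = \1_A x.
Proof. by rewrite indicE; case: (_ \in _); rewrite ?expr1n ?expr0n. Qed.

Lemma L2_mul_indic f a b : L2 f -> L2 (fun x => f x * \1_(`]a, b]%classic) x).
Proof.
move=> hf; have [mf _] := hf; apply: L2_dom hf.
  by apply: measurable_funM => //; exact: measurable_indic.
move=> x; rewrite normrM indicE; case: (_ \in _); first by rewrite normr1 mulr1.
by rewrite normr0 mulr0.
Qed.

(** Cauchy-Schwarz against the indicator of the interval; the factor b - a is the source of the
    Holder exponent 1/2 of functions with a square integrable derivative. *)
Lemma sqr_Int_itv f a b : L2 f -> a <= b ->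
  (\int[mu]_x (f x * \1_(`]a, b]%classic) x)) ^+ 2 <=
  (b - a) * \int[mu]_x (f x ^+ 2 * \1_(`]a, b]%classic) x).
Proof.
move=> hf ab.
have := cauchy_schwarz_Int (L2_mul_indic a b hf) (L2_indic_itv a b).
rewrite (@eq_Int _ _ (fun x => f x * \1_(`]a, b]%classic) x)); last first.
  by move=> x; rewrite -mulrA -expr2 indic_sqr.
move/le_trans; apply; rewrite mulrC; rewrite (@eq_Int _ _ (\1_(`]a, b]%classic))); last first.
  by move=> x; rewrite indic_sqr.
rewrite Int_indic_itv//; rewrite (@eq_Int _ _ (fun x => f x ^+ 2 * \1_(`]a, b]%classic) x))//.
by move=> x; rewrite exprMn indic_sqr.
Qed.

Lemma sqr_Int_itv_le f a b : L2 f -> a <= b ->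
  (\int[mu]_x (f x * \1_(`]a, b]%classic) x)) ^+ 2 <= (b - a) * \int[mu]_x (f x ^+ 2).
Proof.
move=> hf ab; apply: (le_trans (sqr_Int_itv hf ab)).
apply: ler_wpM2l; first by rewrite subr_ge0.
have [mf hf2] := hf; apply: le_Int => //.
  have [_] := L2_mul_indic a b hf; apply: eq_integR => x.
  by rewrite exprMn indic_sqr.
move=> x; rewrite indicE; case: (_ \in _); rewrite ?mulr1// mulr0.
exact: sqr_ge0.
Qed.

Lemma weak_deriv1_rep u g : is_weak_deriv 1 u g -> L2 g ->
  exists v, [/\ continuous v, {ae mu, forall x, u x = v x} &
    forall a b, a <= b -> v b - v a = \int[mu]_x (g x * \1_(`]a, b]%classic) x)].
Proof.
move=> hw hg; have [lu lg _] := hw.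
have ael := lebesgue_differentiation lu.
have [c [_ lc]] := ae_ex_itv (@ltr01 R) ael.
have ig a b : integR (fun x => g x * \1_(`]a, b]%classic) x).
  by apply: L2_mul => //; exact: L2_indic_itv.
(* At least one of the two intervals is empty, so the difference is the oriented integral of [g]
   from the Lebesgue point [c] to [x]. *)
pose v x := u c + (\int[mu]_t (g t * \1_(`]c, x]%classic) t) -
                   \int[mu]_t (g t * \1_(`]x, c]%classic) t)).
have vd a b : a <= b -> v b - v a = \int[mu]_x (g x * \1_(`]a, b]%classic) x).
  move=> ab; rewrite /v opprD addrACA subrr add0r -!IntB//; first last.
  - exact: integRB.
  - exact: integRB.
  apply: eq_Int => t; rewrite -!mulrBr; congr (_ * _).
  rewrite !indicE !mem_setE/= !in_itv/=.
  have [ct|tc] := ltP c t; have [at_|ta] := ltP a t; have [bt|tb] := ltP b t; 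
    rewrite /= ?subrr ?subr0 ?sub0r ?opprK ?opprB//;
    try by have := lt_le_trans bt (le_trans ta ab); rewrite ltxx.
have hol a b : a <= b -> (v b - v a) ^+ 2 <= (b - a) * \int[mu]_x (g x ^+ 2).
  by move=> ab; rewrite vd//; exact: sqr_Int_itv_le.
exists v; split => //.
- move=> x; apply/cvgrPdist_le => e e0.
  set G := \int[mu]_x (g x ^+ 2) in hol.
  have G0 : 0 <= G by exact: Int_sqr_ge0.
  near=> y.
  have hxy : (v x - v y) ^+ 2 <= `|x - y| * G.
    have [xy|yx] := leP x y.
      by rewrite -sqrrN opprB distrC ger0_norm ?subr_ge0//; exact: hol.
    by rewrite ger0_norm ?subr_ge0 ?(ltW yx)//; apply: hol; exact: ltW.
  have hd : `|x - y| <= e ^+ 2 / (G + 1).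
    near: y; apply: cvgr_dist_le; first exact: cvg_id.
    by rewrite divr_gt0 ?exprn_gt0// ltr_wpDl.
  rewrite -(@ler_pXn2r _ 2)// ?nnegrE// ?(ltW e0)//.
  rewrite real_normK ?num_real//; apply: (le_trans hxy).
  rewrite ler_pdivlMr ?ltr_wpDl// in hd; apply: le_trans hd.
  by rewrite ler_wpM2l// lerDl.
- apply: ae_imp ael => x lx; rewrite /v.
  have [xc|cx|->] := ltgtP x c.
  + rewrite [`]c, x]%classic]set_itv_ge ?bnd_simp -?leNgt ?(ltW xc)//.
    under eq_Int do rewrite indic0 mulr0.
    rewrite Rintegral_cst//= mul0r sub0r -(weak_deriv1_lebesgue_pt hw lx lc xc).
    by rewrite opprB addrC subrK.
  + rewrite [`]x, c]%classic]set_itv_ge ?bnd_simp -?leNgt ?(ltW cx)//.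
    rewrite -(weak_deriv1_lebesgue_pt hw lc lx cx).
    under eq_Int do rewrite indic0 mulr0.
    by rewrite Rintegral_cst//= mul0r subr0 addrC subrK.
  + by rewrite subrr addr0.
Unshelve. all: by end_near. Qed.

End square_integrable.

(** * Affine changes of variables *)

Section affine_change_of_variables.
Context {R : realType}.
Implicit Types (f g phi u v : R -> R) (s h : R).
Local Notation mu := (@lebesgue_measure R).

Lemma affine_continuous s h : continuous (fun x : R => s * x + h).
Proof.
move=> x; apply: cvgD; last exact: cvg_cst.
by apply: cvgM; [exact: cvg_cst|exact: cvg_id].
Qed.

Lemma affine_meas s h : measurable_fun setT (fun x : R => s * x + h).
Proof. by apply: continuous_meas; exact: affine_continuous. Qed.

(** Lebesgue measure is s times its image under x |-> s x + h, since both measures agree on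
    half-open intervals. *)
Lemma ge0_integral_affine s h (f : R -> \bar R) : 0 < s ->
  measurable_fun setT f -> (forall x, 0 <= f x)%E ->
  (\int[mu]_x f x = s%:E * \int[mu]_x f (s * x + h)%R)%E.
Proof.
move=> s0 mf f0.
pose phi : measurableTypeR R -> measurableTypeR R := fun x => s * x + h.
have mphi : measurable_fun setT phi by exact: affine_meas.
pose nu := mscale (NngNum (ltW s0))
  (measure_function_pushforward__canonical__measure_function_Measure mu mphi).
have e A : measurable A -> A `<=` setT -> mu A = nu A.
  move=> mA _; apply: lebesgue_measure_unique => //= X [[a b]] _ <-.
  rewrite /nu /mscale/= /pushforward (_ : phi @^-1` _ =
    `]((a - h) / s), ((b - h) / s)]%classic); last first.
    apply/seteqP; split=> x /=; rewrite !in_itv/= ltr_pdivrMr// ler_pdivlMr//;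
      by rewrite ltrBlDr lerBrDr (mulrC x).
  rewrite !lebesgue_measure_itv/= !lte_fin ltr_pM2r ?invr_gt0// ltrD2r.
  case: ifP => _; last by rewrite mule0.
  by rewrite -!EFinB -EFinM; congr EFin; field; rewrite gt_eqF.
rewrite (eq_measure_integral nu e) ge0_integral_mscale//=.
by rewrite ge0_integral_pushforward.
Qed.

Lemma ge0_integR_affine s h f : 0 < s -> (forall x, 0 <= f x) -> integR f ->
  integR (fun x => f (s * x + h)) /\
  \int[mu]_x f x = s * \int[mu]_x f (s * x + h).
Proof.
move=> s0 f0 hf.
have mf := integR_meas hf.
have e := @ge0_integral_affine s h (EFin \o f) s0 (EFin_meas mf).
have {}e := e (fun x => f0 x : (0 <= (f x)%:E)%E).
have mfa : measurable_fun setT (fun x => f (s * x + h)).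
  by apply: measurableT_comp => //; exact: affine_meas.
have hfa : integR (fun x => f (s * x + h)).
  apply: integR_ge0 => //.
  have := integrable_lty measurableT hf; rewrite e.
  have : (0 <= \int[mu]_x (f (s * x + h)%R)%:E)%E by apply: integral_ge0 => x _; rewrite lee_fin.
  case: (\int[mu]_x (f (s * x + h))%:E)%E => [r _ _|_|//]; first exact: ltry.
  by rewrite mulry gtr0_sg// mul1e.
split=> //.
by have := e; rewrite /= (integR_EFin hf) (integR_EFin hfa) -EFinM => -[].
Qed.

(** The nonnegative case, applied to |f| + f and to |f|. *)
Lemma integR_affine s h f : 0 < s -> integR f ->
  integR (fun x => f (s * x + h)) /\
  \int[mu]_x f x = s * \int[mu]_x f (s * x + h).
Proof.
move=> s0 hf; have hn := integR_norm hf.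
have h1 : integR (fun x => `|f x| + f x) by exact: integRD.
have [n1 n2] := ge0_integR_affine h s0 (fun x => normr_ge0 (f x)) hn.
have p0 x : 0 <= `|f x| + f x by rewrite -lerBlDr sub0r -normrN ler_norm.
have [p1 p2] := ge0_integR_affine h s0 p0 h1.
have hfa : integR (fun x => f (s * x + h)).
  by apply: eq_integR (integRB p1 n1) => x; rewrite addrAC subrr add0r.
split=> //; move: p2; rewrite (IntD hn hf) (IntD n1 hfa) n2 mulrDr.
exact: addrI.
Qed.

Lemma L2_affine s h f : 0 < s -> L2 f -> L2 (fun x => f (s * x + h)) /\
  \int[mu]_x (f x ^+ 2) = s * \int[mu]_x (f (s * x + h) ^+ 2).
Proof.
move=> s0 [mf hf]; have [h1 h2] := integR_affine h s0 hf.
by split=> //; split=> //; apply: measurableT_comp => //; exact: affine_meas.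
Qed.

Lemma test_function_affine s h phi : 0 < s -> test_function phi ->
  test_function (fun x => phi (s * x + h)).
Proof.
move=> s0 tp; have [r r0 hr] := test_function_supp tp.
apply: (@test_functionI _ _ ((- r - h) / s) ((r - h) / s)).
  by move=> n; apply: Ck_affine; exact: test_function_Ck.
move=> x hx; apply: hr; rewrite ltNge; apply: contra hx.
by rewrite ler_norml ler_pdivrMr// ler_pdivlMr// lerBlDr lerBrDr (mulrC x).
Qed.

(** The change of variables for the indicator of a null set shows that its preimage is null. *)
Lemma ae_affine s h (P : R -> Prop) : 0 < s -> {ae mu, forall x, P x} ->
  {ae mu, forall x, P (s * x + h)}.
Proof.
move=> s0 [N [mN N0 sub]].
have mphi := affine_meas s h.
have mA : measurable ((fun x => s * x + h) @^-1` N).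
  by rewrite -[X in measurable X]setTI; exact: mphi.
exists ((fun x => s * x + h) @^-1` N); split => //; last by move=> x /= hx; apply: sub.
have e : (\int[mu]_x (\1_N x)%:E = s%:E * \int[mu]_x (\1_N (s * x + h)%R)%:E)%E.
  apply: (@ge0_integral_affine s h (EFin \o \1_N)) => //.
    by apply: EFin_meas; exact: measurable_indic.
  by move=> x; rewrite lee_fin.
have e1 : (\int[mu]_x (\1_N x)%:E = mu N)%E by rewrite integral_indic// setIT.
have e2 : (\int[mu]_x (\1_N (s * x + h)%R)%:E =
    mu ((fun x => (s * x + h)%R) @^-1` N))%E.
  rewrite -[in RHS](setIT (_ @^-1` _)) -integral_indic//.
move: e; rewrite e1 e2 N0 => /esym/eqP; rewrite mule_eq0 eqe gt_eqF//=.
by move/eqP.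
Qed.

End affine_change_of_variables.

(** * Calculus of weak derivatives and closure properties of H^m *)

Section weak_derivative_calculus.
Context {R : realType}.
Implicit Types (f g phi u v : R -> R) (s h : R) (k m n : nat).
Local Notation mu := (@lebesgue_measure R).

(** Square integrability of both functions is carried along, so that every pairing with a test
    function is integrable by [L2_mul]. *)
Definition wd k u g : Prop := [/\ L2 u, L2 g & is_weak_deriv k u g].

Lemma wdI k u g : L2 u -> L2 g ->
  (forall phi, test_function phi -> \int[mu]_x (u x * derive1n k phi x) =
     (-1) ^+ k * \int[mu]_x (g x * phi x)) -> wd k u g.
Proof. by move=> hu hg h; split=> //; split=> //; exact: L2_locint. Qed.

Lemma sobolevHP m u : sobolevH m u <->
  L2 u /\ forall k, (k <= m)%N -> exists g, wd k u g.
Proof.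
split=> [[hu h]|[hu h]].
  split; first exact/Lfun2P.
  by move=> k /h [g hg hw]; exists g; split=> //; exact/Lfun2P.
split; first exact/Lfun2P.
by move=> k /h [g [_ hg hw]]; exists g => //; exact/Lfun2P.
Qed.

Lemma sobolevH_wd m u : sobolevH m u -> exists g, wd m u g.
Proof. by move=> /sobolevHP[_]; apply. Qed.

Lemma wd_unique k u g g' : wd k u g -> wd k u g' -> {ae mu, forall x, g x = g' x}.
Proof. by move=> [_ _ h] [_ _ h']; exact: is_weak_deriv_unique h h'. Qed.

Lemma wd0 u : L2 u -> wd 0 u u.
Proof. by move=> hu; apply: wdI => // phi _; rewrite mul1r. Qed.

Lemma wdD k u g u' g' : wd k u g -> wd k u' g' ->
  wd k (fun x => u x + u' x) (fun x => g x + g' x).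
Proof.
move=> [hu hg [_ _ hw]] [hu' hg' [_ _ hw']]; apply: wdI; [exact: L2D..|].
move=> phi tp; have tk := L2_test (test_function_derive1n k tp).
have tL := L2_test tp.
under eq_Int do rewrite mulrDl; under [in RHS]eq_Int do rewrite mulrDl.
rewrite (IntD (L2_mul hu tk) (L2_mul hu' tk)) (IntD (L2_mul hg tL) (L2_mul hg' tL)).
by rewrite hw// hw'// mulrDr.
Qed.

Lemma wdZ k c u g : wd k u g -> wd k (fun x => c * u x) (fun x => c * g x).
Proof.
move=> [hu hg [_ _ hw]]; apply: wdI; [exact: L2Z..|].
move=> phi tp; have tk := L2_test (test_function_derive1n k tp).
have tL := L2_test tp.
under eq_Int do rewrite -mulrA; under [in RHS]eq_Int do rewrite -mulrA.
by rewrite (IntZ c (L2_mul hu tk)) (IntZ c (L2_mul hg tL)) hw// mulrCA.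
Qed.

Lemma wdB k u g u' g' : wd k u g -> wd k u' g' ->
  wd k (fun x => u x - u' x) (fun x => g x - g' x).
Proof.
move=> h h'; have := wdD h (wdZ (-1) h').
rewrite (_ : (fun x => u x + _) = (fun x => u x - u' x)); last first.
  by apply/funext => x; rewrite mulN1r.
rewrite (_ : (fun x => g x + _) = (fun x => g x - g' x))//.
by apply/funext => x; rewrite mulN1r.
Qed.

Lemma wd_ae k u g u' g' : measurable_fun setT u' -> measurable_fun setT g' ->
  {ae mu, forall x, u x = u' x} -> {ae mu, forall x, g x = g' x} ->
  wd k u g -> wd k u' g'.
Proof.
move=> mu' mg' uu gg [hu hg [_ _ hw]].
have hu' := L2_ae mu' uu hu; have hg' := L2_ae mg' gg hg.
apply: wdI => // phi tp; have [mp _] := L2_test (test_function_derive1n k tp).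
have [mp0 _] := L2_test tp.
rewrite -(@ae_Int _ (fun x => u x * derive1n k phi x)); last first.
- by apply: ae_imp uu => x ->.
- exact: measurable_funM.
- by apply: measurable_funM => //; case: hu.
rewrite hw// (@ae_Int _ (fun x => g x * phi x) (fun x => g' x * phi x))//.
- by apply: measurable_funM => //; case: hg.
- exact: measurable_funM.
- by apply: ae_imp gg => x ->.
Qed.

(** If phi is a test function, so is phi': testing the k-th derivative against phi' is testing the
    next one against phi, up to sign. *)
Lemma wd_chain k u g g' : wd k u g -> wd k.+1 u g' -> wd 1 g g'.
Proof.
move=> [_ hg [_ _ hw]] [_ hg' [_ _ hw']]; apply: wdI => // phi tp.
have := hw' _ tp; rewrite {1}/derive1n iterSr -/(derive1n _ _).
rewrite hw; last exact: test_function_derive1.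
rewrite exprS -mulrA mulrCA => /(congr1 (fun z => (-1) ^+ k * z)).
by rewrite !mulrA -exprMn mulrNN mul1r expr1n !mul1r.
Qed.

Lemma wd_affine k s h u g : 0 < s -> wd k u g ->
  wd k (fun x => u (s * x + h)) (fun x => s ^+ k * g (s * x + h)).
Proof.
move=> s0 [hu hg [_ _ hw]].
have [hu' _] := L2_affine h s0 hu; have [hg' _] := L2_affine h s0 hg.
apply: wdI => //; first exact: L2Z.
move=> phi tp; have sn0 : s != 0 by rewrite gt_eqF.
(* The test function transported by the inverse map, so that psi (s x + h) = phi x. *)
pose psi x := phi (s^-1 * x + - (s^-1 * h)).
have si0 : 0 < s^-1 by rewrite invr_gt0.
have tpsi : test_function psi by exact: test_function_affine.
have psiE x : psi (s * x + h) = phi x.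
  by rewrite /psi mulrDr mulKf// addrK.
have dpsiE x : derive1n k psi (s * x + h) = s ^- k * derive1n k phi x.
  rewrite /psi derive1n_affine; last exact: test_function_Ck.
  by rewrite mulrDr mulKf// addrK exprVn.
have i1 := L2_mul hu (L2_test (test_function_derive1n k tpsi)).
have i2 := L2_mul hg (L2_test tpsi).
have [j1 e1] := integR_affine h s0 i1; have [j2 e2] := integR_affine h s0 i2.
have := hw _ tpsi; rewrite e1 e2.
have -> : \int[mu]_x (u (s * x + h) * derive1n k psi (s * x + h)) =
   s ^- k * \int[mu]_x (u (s * x + h) * derive1n k phi x).
  rewrite -IntZ; first by apply: eq_Int => x; rewrite dpsiE mulrCA.
  by apply: L2_mul => //; apply: L2_test; exact: test_function_derive1n.
have -> : \int[mu]_x (g (s * x + h) * psi (s * x + h)) =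
   \int[mu]_x (g (s * x + h) * phi x) by apply: eq_Int => x; rewrite psiE.
have ig : integR (fun x => g (s * x + h) * phi x) by apply: L2_mul => //; exact: L2_test.
rewrite [(-1) ^+ k * (s * _)]mulrCA => /(mulfI sn0) /(congr1 (fun z => s ^+ k * z)).
rewrite mulrA divff ?expf_neq0// mul1r => ->.
rewrite mulrCA -(IntZ _ ig); congr (_ * _); apply: eq_Int => x.
by rewrite mulrA.
Qed.

Lemma test_functionM phi psi : test_function phi -> test_function psi ->
  test_function (fun x => phi x * psi x).
Proof.
move=> tp tq; have [r r0 hr] := test_function_supp tp.
apply: (@test_functionI _ _ (- r) r).
  by move=> n; apply: CkM; exact: test_function_Ck.
by move=> x; rewrite -ler_norml -ltNge => /hr ->; rewrite mul0r.
Qed.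

Lemma test_function_parts phi psi : test_function phi -> test_function psi ->
  \int[mu]_x (phi x * derive1 psi x) = - \int[mu]_x (derive1 phi x * psi x).
Proof.
move=> tp tq; have tL := L2_test tp; have tL' := L2_test tq.
have dL := L2_test (test_function_derive1 tp).
have dL' := L2_test (test_function_derive1 tq).
apply/eqP; rewrite -addr_eq0 -IntD; [|exact: L2_mul..].
rewrite -[X in _ == X](Int_dtest (test_functionM tp tq)); apply/eqP/eq_Int => x.
have [dp _] := test_function_Ck tp 1; have [dq _] := test_function_Ck tq 1.
rewrite !derive1E deriveM// /GRing.scale/= [psi x * _]mulrC.
by [].
Qed.

Lemma wd_test k phi : test_function phi -> wd k phi (derive1n k phi).
Proof.
move=> tp; apply: wdI; [exact: L2_test|by apply: L2_test; exact: test_function_derive1n|].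
move=> psi tq; elim: k phi tp => [|k ih] phi tp; first by rewrite mul1r.
have -> : derive1n k.+1 phi = derive1n k (derive1 phi) by rewrite /derive1n iterSr.
rewrite [derive1n k.+1 psi]/derive1n iterS -/(derive1n _ _).
rewrite test_function_parts//; last exact: test_function_derive1n.
by rewrite ih ?exprS -?mulrA ?mulN1r//; exact: test_function_derive1.
Qed.

(** The representative picked by [xget] is known to be locally integrable only; agreement a.e. with
    [g] makes it square integrable. *)
Lemma weak_derivE k u g : wd k u g ->
  wd k u (weak_deriv k u) /\ {ae mu, forall x, weak_deriv k u x = g x}.
Proof.
move=> hw; have [hu hg h] := hw.
have w : is_weak_deriv k u (weak_deriv k u).
  by rewrite /weak_deriv; case: xgetP => [f -> //|/(_ g)].
have e := is_weak_deriv_unique w h.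
split=> //; split=> //; apply: L2_ae hg; first by case: w => _ [].
by apply: ae_imp e => x ->.
Qed.

Lemma sobolevH_ae m u v : measurable_fun setT v -> {ae mu, forall x, u x = v x} ->
  sobolevH m u -> sobolevH m v.
Proof.
move=> mv uv /sobolevHP[hu h]; apply/sobolevHP; split; first exact: L2_ae hu.
move=> k /h [g hg]; exists g; have [_ [mg _] _] := hg; apply: wd_ae hg => //.
exact: aeW.
Qed.

Lemma sobolevH_affine m s h u : 0 < s -> sobolevH m u ->
  sobolevH m (fun x => u (s * x + h)).
Proof.
move=> s0 /sobolevHP[hu hk]; apply/sobolevHP; split.
  by case: (L2_affine h s0 hu).
move=> k /hk [g hg]; exists (fun x => s ^+ k * g (s * x + h)); exact: wd_affine.
Qed.

Lemma sobolevHD m u v : sobolevH m u -> sobolevH m v -> sobolevH m (fun x => u x + v x).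
Proof.
move=> /sobolevHP[hu hk] /sobolevHP[hv hl]; apply/sobolevHP; split; first exact: L2D.
move=> k km; have [g hg] := hk _ km; have [g' hg'] := hl _ km.
by exists (fun x => g x + g' x); exact: wdD.
Qed.

Lemma sobolevHZ m c u : sobolevH m u -> sobolevH m (fun x => c * u x).
Proof.
move=> /sobolevHP[hu hk]; apply/sobolevHP; split; first exact: L2Z.
by move=> k /hk [g hg]; exists (fun x => c * g x); exact: wdZ.
Qed.

Lemma sobolevHB m u v : sobolevH m u -> sobolevH m v -> sobolevH m (fun x => u x - v x).
Proof.
move=> hu hv; have := sobolevHD hu (sobolevHZ (-1) hv).
rewrite (_ : (fun x => u x + _) = (fun x => u x - v x))//.
by apply/funext => x; rewrite mulN1r.
Qed.

Lemma sobolevH_test m phi : test_function phi -> sobolevH m phi.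
Proof.
move=> tp; apply/sobolevHP; split; first exact: L2_test.
by move=> k _; exists (derive1n k phi); exact: wd_test.
Qed.

Lemma energyE m (F : R -> R) u g : continuous F -> wd m u g ->
  integR (fun x => F (u x)) ->
  energy m F u = 1 / 2 * \int[mu]_x (g x ^+ 2) - \int[mu]_x F (u x).
Proof.
move=> cF hw hF; have [hw' e] := weak_derivE hw.
have [[mu_ _] [mg ig] _] := hw; have [_ [mg' ig'] _] := hw'.
rewrite /energy IntB//; last exact: integRZ.
rewrite IntZ//; congr (_ * _ - _); apply: ae_Int; [exact: measurable_funX..|].
by apply: ae_imp e => x ->.
Qed.

End weak_derivative_calculus.

(** * Interpolation and the Gagliardo-Nirenberg inequality *)

Section interpolation.
Context {R : realType}.
Implicit Types (f g phi u v w : R -> R) (s h : R) (k m n : nat).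
Local Notation mu := (@lebesgue_measure R).

Lemma integR_shift h f : integR f -> integR (fun x => f (x + h)) /\
  \int[mu]_x f x = \int[mu]_x f (x + h).
Proof.
move=> hf; have [h1 h2] := integR_affine h ltr01 hf.
split; first by apply: eq_integR h1 => x; rewrite mul1r.
by rewrite h2 mul1r; apply: eq_Int => x; rewrite mul1r.
Qed.

Lemma L2_shift h f : L2 f -> L2 (fun x => f (x + h)).
Proof.
move=> hf; have [h1 _] := L2_affine h ltr01 hf.
by rewrite (_ : (fun x => _) = fun x => f (1 * x + h))//; apply/funext => x; rewrite mul1r.
Qed.

Lemma wd_shift k h u g : wd k u g -> wd k (fun x => u (x + h)) (fun x => g (x + h)).
Proof.
move=> /(wd_affine h ltr01).
rewrite (_ : (fun x => u _) = fun x => u (x + h)); last by apply/funext => x; rewrite mul1r.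
rewrite (_ : (fun x => _ * g _) = fun x => g (x + h))//.
by apply/funext => x; rewrite expr1n !mul1r.
Qed.

Lemma cvg_at_dist f x (l e : R) : f y @[y --> x] --> l -> 0 < e ->
  exists2 d, 0 < d & forall y, `|x - y| < d -> `|l - f y| <= e.
Proof. by move=> /cvgrPdist_le h e0; have [d d0 hd] := h _ e0; exists d. Qed.

Lemma continuous_ae_eq f g : continuous f -> continuous g ->
  {ae mu, forall x, f x = g x} -> forall x, f x = g x.
Proof.
move=> cf cg fg x; apply/eqP; rewrite -subr_eq0 -normr_le0; apply/ler_addgt0Pr => e e0.
rewrite add0r.
have cd : (fun y => f y - g y) y @[y --> x] --> f x - g x by apply: cvgB; [exact: cf|exact: cg].
have [d d0 hd] := cvg_at_dist cd e0.
have [y [yx e_]] := @ae_ex_itv _ _ x (x + d) (ltac:(by rewrite ltrDl)) fg.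
have := hd y; rewrite e_ subrr subr0; apply => /=.
case/andP: yx => xy yd.
by rewrite distrC gtr0_norm ?subr_gt0// ltrBlDl.
Qed.

Lemma wd1_increment v g : continuous v -> wd 1 v g -> forall a b, a <= b ->
  v b - v a = \int[mu]_x (g x * \1_(`]a, b]%classic) x).
Proof.
move=> cv [_ hg hw]; have [w [cw vw hi]] := weak_deriv1_rep hw hg.
by have e := continuous_ae_eq cv cw vw; move=> a b ab; rewrite !e hi.
Qed.

Lemma wd1_continuous u g : wd 1 u g ->
  exists v, [/\ continuous v, {ae mu, forall x, u x = v x} & wd 1 v g].
Proof.
move=> hw; have [hu hg h] := hw; have [v [cv uv _]] := weak_deriv1_rep h hg.
exists v; split => //; apply: wd_ae hw => //.
- exact: continuous_meas.
- by case: hg.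
- exact: aeW.
Qed.

(** With z = (x, t), the condition x < t <= x + h is expressed through t - x, which makes joint
    measurability a matter of composition. *)
Definition window h g (z : measurableTypeR R * measurableTypeR R) : \bar R :=
  (g z.2 ^+ 2 * \1_(`]0, h]%classic) (z.2 - z.1))%:E.

Lemma window_ge0 h g z : (0 <= window h g z)%E.
Proof. by rewrite lee_fin mulr_ge0 ?sqr_ge0. Qed.

Lemma measurable_window h g : measurable_fun setT g -> measurable_fun setT (window h g).
Proof.
move=> mg; apply/measurable_EFinP; apply: measurable_funM.
  apply: measurable_funX; apply: measurableT_comp => //; exact: measurable_snd.
apply: measurableT_comp; first exact: measurable_indic.
by apply: measurable_funB; [exact: measurable_snd|exact: measurable_fst].
Qed.

Lemma windowE h g : (fun x => \int[mu]_t (g t ^+ 2 * \1_(`]x, x + h]%classic) t)%:E)%E =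
  (fun x => \int[mu]_t window h g (x, t))%E.
Proof.
apply/funext => x; apply: eq_integral => t _.
rewrite /window /= !indicE; congr (_ * _%:R)%:E; congr nat_of_bool.
by rewrite !mem_setE/= !in_itv/= subr_gt0 lerBlDl.
Qed.

(** For fixed t, the points x with x < t <= x + h form the interval [t - h, t[, of length h. *)
Lemma tonelli_window h (g : R -> R) : 0 < h -> L2 g ->
  (\int[mu]_x \int[mu]_t (g t ^+ 2 * \1_(`]x, x + h]%classic) t)%:E)%E =
  (h * \int[mu]_t (g t ^+ 2))%:E.
Proof.
move=> h0 [mg hg]; rewrite windowE fubini_tonelli//; first last.
- by move=> z; exact: window_ge0.
- exact: measurable_window.
rewrite -(IntZ h hg) -(integR_EFin (integRZ h hg)); apply: eq_integral => t _.
rewrite /window /=.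
transitivity ((g t ^+ 2)%:E * \int[mu]_x (\1_(`[t - h, t[%classic) x)%:E)%E.
  rewrite -ge0_integralZl//; last first.
  - by rewrite lee_fin sqr_ge0.
  - by apply: EFin_meas; exact: measurable_indic.
  apply: eq_integral => x _; rewrite EFinM; congr (_ * (_%:R)%:E)%E.
  congr nat_of_bool; rewrite !mem_setE/= !in_itv/= subr_gt0 lerBlDl lerBlDr.
  by rewrite andbC.
have -> : (\int[mu]_x (\1_(`[(t - h)%R, t[%classic) x)%:E = mu `[(t - h)%R, t[%classic)%E.
  by rewrite integral_indic// setIT.
rewrite lebesgue_measure_itv/= lte_fin gtrBl h0.
by rewrite -EFinB -EFinM opprB addrC subrK mulrC.
Qed.

(** By Cauchy-Schwarz, (u(x+h) - u(x))^2 is at most h times the integral of g^2 over ]x, x + h];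
    integration in x by [tonelli_window] gives the second factor h. *)
Lemma wd1_diff_le u g h : 0 < h -> wd 1 u g ->
  \int[mu]_x ((u (x + h) - u x) ^+ 2) <= h ^+ 2 * \int[mu]_x (g x ^+ 2).
Proof.
move=> h0 hw; have [v [cv uv hv]] := wd1_continuous hw.
have [hu [mg ig] _] := hw; have [hv2 hg _] := hv.
have dv : L2 (fun x => v (x + h) - v x) by apply: L2B => //; exact: L2_shift.
have du : L2 (fun x => u (x + h) - u x) by apply: L2B => //; exact: L2_shift.
rewrite (@ae_Int _ _ (fun x => (v (x + h) - v x) ^+ 2)); last first.
- have uvh := ae_affine h ltr01 uv.
  by apply: ae_imp (ae_and uv uvh) => x [->]; rewrite mul1r => ->.
- by case: dv => m _; exact: measurable_funX.
- by case: du => m _; exact: measurable_funX.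
have inc := wd1_increment cv hv.
have [_ idv] := dv.
rewrite -lee_fin -(integR_EFin idv).
apply: (@le_trans _ _ (\int[mu]_x
      (h%:E * \int[mu]_t (g t ^+ 2 * \1_(`]x, x + h]%classic) t)%:E))%E).
  have iw x : integR (fun t => g t ^+ 2 * \1_(`]x, x + h]%classic) t).
    have [_] := L2_mul_indic x (x + h) hg; apply: eq_integR => t.
    by rewrite exprMn indic_sqr.
  apply: ge0_le_integral => //.
  - by move=> x _; rewrite lee_fin sqr_ge0.
  - by apply: EFin_meas; case: dv => m _; exact: measurable_funX.
  - apply: measurable_funeM; rewrite windowE.
    by apply: measurable_fun_fubini_tonelli_F;
      [exact: measurable_window|move=> z; exact: window_ge0].
  - move=> x _; rewrite (integR_EFin (iw x)) -EFinM lee_fin inc ?lerDl ?(ltW h0)//.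
    have xh : x <= x + h by rewrite lerDl ltW.
    by have := sqr_Int_itv hg xh; rewrite [x + h - x]addrC addKr.
rewrite ge0_integralZl//.
- by rewrite tonelli_window// -EFinM lee_fin mulrA expr2.
- rewrite windowE.
  by apply: measurable_fun_fubini_tonelli_F;
    [exact: measurable_window|move=> z; exact: window_ge0].
- by move=> x _; apply: integral_ge0 => t _; rewrite lee_fin mulr_ge0 ?sqr_ge0.
- by rewrite lee_fin ltW.
Qed.

(** The quotient is the mean of [g] over a shrinking interval next to x. *)
Lemma wd1_diff_quotient_cvg v g : continuous v -> wd 1 v g -> continuous g ->
  forall x, n.+1%:R * (v (x + n.+1%:R^-1) - v x) @[n --> \oo] --> g x.
Proof.
move=> cv hv cg x; apply/cvgrPdist_le => e e0.
have [d d0 hd] := cvg_at_dist (cg x) e0.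
have [_ hg _] := hv.
near=> n.
have n0 : 0 < n.+1%:R^-1 :> R by rewrite invr_gt0.
have xn : x <= x + n.+1%:R^-1 by rewrite lerDl ltW.
have nd : n.+1%:R^-1 < d.
  rewrite invf_plt ?posrE//.
  apply: (@lt_trans _ _ n%:R); last by rewrite ltr_nat.
  by near: n; exact: nbhs_infty_gtr.
rewrite (wd1_increment cv hv xn).
have i0 : integR (\1_(`]x, x + n.+1%:R^-1]%classic) : R -> R).
  exact: integrable_indic_itv.
have i1 : integR (fun t => g t * \1_(`]x, x + n.+1%:R^-1]%classic) t).
  by apply: L2_mul => //; exact: L2_indic_itv.
have -> : g x = n.+1%:R * \int[mu]_t (g x * \1_(`]x, x + n.+1%:R^-1]%classic) t).
  rewrite (IntZ _ i0) Int_indic_itv// addrC addKr mulrCA divff ?mulr1//.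
rewrite -mulrBr -IntB//; last exact: integRZ.
rewrite normrM ger0_norm// -ler_pdivlMl//.
have -> : n.+1%:R^-1 * e = \int[mu]_t (e * \1_(`]x, x + n.+1%:R^-1]%classic) t).
  by rewrite (IntZ _ i0) Int_indic_itv// [x + _]addrC addrK mulrC.
apply: le_norm_Int; [by apply: integRB => //; exact: integRZ|exact: integRZ|].
move=> t; rewrite -mulrBl normrM indicE mem_setE/= in_itv/=.
case: (boolP (x < t <= _)) => [/andP[xt tx]|_]; last by rewrite !mulr0 normr0 mulr0.
rewrite normr1 !mulr1; apply: hd => /=.
by rewrite distrC gtr0_norm ?subr_gt0// ltrBlDl (le_lt_trans tx)// ltrD2l.
Unshelve. all: by end_near. Qed.

(* Summation by parts replaces integration by parts: with z = u(.+h) - u,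
   \int z^2 = - \int u(.+h) (z(.+h) - z). *)
Lemma wd1_log_convex u g1 g2 : wd 1 u g1 -> wd 1 g1 g2 ->
  (\int[mu]_x (g1 x ^+ 2)) ^+ 2 <= \int[mu]_x (u x ^+ 2) * \int[mu]_x (g2 x ^+ 2).
Proof.
move=> h1 h2.
(* Continuous representatives of both [u] and its derivative make the difference quotients converge
   at every point. *)
have [w [cw gw hw2]] := wd1_continuous h2.
have [v [cv uv hv1]] := wd1_continuous h1.
have hu := let: And3 a _ _ := h1 in a.
have hL1 := let: And3 a _ _ := h2 in a.
have hL2 := let: And3 _ a _ := h2 in a.
have hv := let: And3 a _ _ := hv1 in a.
have hw := let: And3 a _ _ := hw2 in a.
have hv1' : wd 1 v w.
  apply: wd_ae hv1 => //; [by case: hv|by case: hw|exact: aeW].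
set A := \int[mu]_x (u x ^+ 2); set G := \int[mu]_x (g2 x ^+ 2).
have AE : A = \int[mu]_x (v x ^+ 2).
  apply: ae_Int; [by case: hu => m _; exact: measurable_funX|
    by case: hv => m _; exact: measurable_funX|by apply: ae_imp uv => x ->].
have -> : \int[mu]_x (g1 x ^+ 2) = \int[mu]_x (w x ^+ 2).
  apply: ae_Int; [by case: hL1 => m _; exact: measurable_funX|
    by case: hw => m _; exact: measurable_funX|by apply: ae_imp gw => x ->].
have A0 : 0 <= A by exact: Int_sqr_ge0.
have G0 : 0 <= G by exact: Int_sqr_ge0.
(* Cauchy-Schwarz after the summation by parts, then [wd1_diff_le] for z and for w. Division by h^4
   with h = 1/(n+1), followed by Fatou's lemma, gives the claim. *)
have key h : 0 < h ->
    (\int[mu]_x ((v (x + h) - v x) ^+ 2)) ^+ 2 <= A * (h ^+ 4 * G).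
  move=> h0.
  pose z x := v (x + h) - v x.
  have vh := L2_shift h hv; have vhh := L2_shift h vh.
  have hz : L2 z by exact: L2B.
  have hzh := L2_shift h hz.
  have hdz : L2 (fun x => z (x + h) - z x) by exact: L2B.
  have e : \int[mu]_x (z x ^+ 2) = - \int[mu]_x (v (x + h) * (z (x + h) - z x)).
    have [_ iv] := hv; have ivv := L2_mul vh hv; have [_ ivh] := vh.
    have [j1 e1] := integR_shift h iv; have [j2 e2] := integR_shift h ivv.
    have -> : \int[mu]_x (z x ^+ 2) = 2 * \int[mu]_x (v x ^+ 2) -
        2 * \int[mu]_x (v (x + h) * v x).
      have := Int_sqrD (-1) vh hv.
      rewrite (@eq_Int _ _ (fun x => z x ^+ 2)); last by move=> x; rewrite mulN1r.
      by move=> ->; rewrite -e1 sqrrN expr1n; ring.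
    have -> : \int[mu]_x (v (x + h) * (z (x + h) - z x)) =
        \int[mu]_x (v (x + h + h) * v (x + h) +
          ((-2) * v (x + h) ^+ 2 + v (x + h) * v x)).
      by apply: eq_Int => x; rewrite /z; ring.
    rewrite (IntD j2 (integRD (integRZ (-2) ivh) ivv)) (IntD (integRZ (-2) ivh) ivv).
    by rewrite (IntZ _ ivh) -e1 -e2; ring.
  rewrite -/z e sqrrN; apply: (le_trans (cauchy_schwarz_Int vh hdz)).
  rewrite -(integR_shift h (let: conj _ a := hv in a)).2 -AE.
  apply: ler_wpM2l => //.
  have wz : wd 1 z (fun x => w (x + h) - w x) by apply: wdB => //; exact: wd_shift.
  apply: (le_trans (wd1_diff_le h0 wz)).
  rewrite (_ : h ^+ 4 = h ^+ 2 * h ^+ 2); last by rewrite -exprD.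
  rewrite -mulrA.
  apply: ler_wpM2l; first exact: sqr_ge0.
  exact: wd1_diff_le h0 hw2.
have cvg x := wd1_diff_quotient_cvg cv hv1' cw x.
pose q n x := (n.+1%:R * (v (x + n.+1%:R^-1) - v x)) ^+ 2.
have hq n : L2 (fun x => v (x + n.+1%:R^-1) - v x) by apply: L2B => //; exact: L2_shift.
have iq n : integR (q n) by case: (L2Z n.+1%:R (hq n)).
have hI : forall n, \int[mu]_x q n x <= Num.sqrt (A * G).
  move=> n; have n0 : 0 < n.+1%:R^-1 :> R by rewrite invr_gt0.
  have nn0 : n.+1%:R != 0 :> R by rewrite pnatr_eq0.
  have := key _ n0; rewrite /q.
  under [in X in _ -> X]eq_Int do rewrite exprMn.
  rewrite (IntZ _ (let: conj _ a := hq n in a)); set D := \int[mu]_x _ => hD.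
  have D0 : 0 <= D by exact: Int_sqr_ge0.
  rewrite -(@ler_pXn2r _ 2)// ?nnegrE ?sqrtr_ge0 ?mulr_ge0//.
  rewrite sqr_sqrtr ?mulr_ge0// exprMn -exprM.
  apply: le_trans (ler_wpM2l _ hD) _; first by rewrite exprn_ge0.
  by rewrite le_eqVlt; apply/orP; left; apply/eqP; field.
have mw2 : measurable_fun setT (fun x => w x ^+ 2).
  by case: hw => m _; exact: measurable_funX.
have cq : {ae mu, forall x, q n x @[n --> \oo] --> w x ^+ 2}.
  by apply: aeW => x; apply: cvgM; exact: cvg.
have [_ hf] := fatouR iq mw2 (fun n x => sqr_ge0 _) cq hI.
rewrite -[leRHS]sqr_sqrtr ?mulr_ge0//.
by rewrite lerXn2r ?nnegrE ?sqrtr_ge0 ?Int_sqr_ge0.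
Qed.

(** Once a log-convex sequence increases strictly, it keeps increasing; hence each term lies below
    one of the two ends. *)
Lemma log_convex_le_ends (a : nat -> R) m : (forall k, 0 <= a k) ->
  (forall k, (k.+2 <= m)%N -> a k.+1 ^+ 2 <= a k * a k.+2) ->
  forall k, (k <= m)%N -> a k <= a 0 + a m.
Proof.
move=> a0 lc.
have up k j : a k < a k.+1 -> (k.+1 + j <= m)%N -> a k.+1 <= a (k.+1 + j)%N /\
    a (k + j)%N < a (k.+1 + j)%N.
  move=> h; elim: j => [|j ih]; first by rewrite !addn0.
  rewrite addnS => hj; have [h1 h2] := ih (ltnW hj).
  have l := lc (k + j)%N; rewrite -!addSn in l.
  have {}l := l hj.
  have p1 : 0 < a (k.+1 + j)%N by apply: le_lt_trans h2.
  have : a (k.+1 + j)%N < a (k.+2 + j)%N.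
    rewrite ltNge; apply/negP => h3.
    have : a (k + j)%N * a (k.+2 + j)%N < a (k.+1 + j)%N ^+ 2.
      apply: (@le_lt_trans _ _ (a (k + j)%N * a (k.+1 + j)%N)).
        by rewrite ler_wpM2l.
      by rewrite expr2 ltr_pM2r.
    by rewrite ltNge l.
  by move=> h4; rewrite !addnS -addSn; split=> //; rewrite (le_trans h1)// ltW.
suff H k : (k <= m)%N -> a k <= a 0%N \/ a k <= a m.
  by move=> k /H [h|h]; rewrite (le_trans h)// ?lerDl ?lerDr.
elim: k => [|k ih] km; first by left.
have [h|h] := leP (a k.+1) (a k).
  by case: (ih (ltnW km)) => h'; [left|right]; rewrite (le_trans h).
right; have [] := up k (m - k.+1)%N h; first by rewrite subnKC.
by rewrite subnKC.
Qed.

Lemma sobolev_interpolation m u g k gk : sobolevH m u -> wd m u g -> (k <= m)%N ->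
  wd k u gk -> \int[mu]_x (gk x ^+ 2) <= \int[mu]_x (u x ^+ 2) + \int[mu]_x (g x ^+ 2).
Proof.
move=> /sobolevHP[hu hk] hg km hgk.
(* One derivative per order; [u] is a dummy value for the orders above m. *)
have /choice [d hd] : forall k, exists d, (k <= m)%N -> wd k u d.
  move=> j; have [jm|jm] := leqP j m; last by exists u.
  by have [d hd] := hk _ jm; exists d.
have E j gj : (j <= m)%N -> wd j u gj -> \int[mu]_x (gj x ^+ 2) = \int[mu]_x (d j x ^+ 2).
  move=> jm hj; have := wd_unique hj (hd _ jm) => e.
  have [_ [m1 _] _] := hj; have [_ [m2 _] _] := hd _ jm.
  apply: ae_Int; [exact: measurable_funX..|].
  by apply: ae_imp e => x ->.
rewrite (E _ _ km hgk) (E _ _ (leqnn m) hg) (E _ _ (leq0n m) (wd0 hu)).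
apply: (@log_convex_le_ends (fun j => \int[mu]_x (d j x ^+ 2)) m) => //.
  by move=> j; exact: Int_sqr_ge0.
move=> j jm; have j1 := ltnW jm.
apply: wd1_log_convex.
- exact: wd_chain (hd _ (ltnW j1)) (hd _ j1).
- exact: wd_chain (hd _ j1) (hd _ jm).
Qed.

(** The inequality v(x)^2 <= 2 v(t)^2 + 2 (v(t) - v(x))^2 is averaged over t in ]x, x + 1], where
    the increment squared is at most the integral of g^2. *)
Lemma wd1_sup_bound v g : continuous v -> wd 1 v g -> forall x,
  v x ^+ 2 <= 2 * (\int[mu]_x (v x ^+ 2) + \int[mu]_x (g x ^+ 2)).
Proof.
move=> cv hw x; have [hv hg _] := hw; set G := \int[mu]_x (g x ^+ 2).
have G0 : 0 <= G by exact: Int_sqr_ge0.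
have i0 : integR (\1_(`]x, x + 1]%classic) : R -> R) by exact: integrable_indic_itv.
have i1 : integR (fun t => v t ^+ 2 * \1_(`]x, x + 1]%classic) t).
  have [_] := L2_mul_indic x (x + 1) hv; apply: eq_integR => t.
  by rewrite exprMn indic_sqr.
have x1 : x <= x + 1 by rewrite lerDl.
have inc := wd1_increment cv hw.
have -> : v x ^+ 2 = \int[mu]_t (v x ^+ 2 * \1_(`]x, x + 1]%classic) t).
  by rewrite (IntZ _ i0) Int_indic_itv// [x + 1]addrC addrK mulr1.
apply: (@le_trans _ _ (\int[mu]_t (2 * (v t ^+ 2 * \1_(`]x, x + 1]%classic) t) +
   (2 * G) * \1_(`]x, x + 1]%classic) t))).
  apply: le_Int; [exact: integRZ|by apply: integRD; exact: integRZ|].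
  move=> t; rewrite mulrA -mulrDl indicE mem_setE/= in_itv/=.
  case: (boolP (x < t <= _)) => [/andP[xt tx]|_]; last by rewrite !mulr0.
  rewrite !mulr1.
  have h : (v t - v x) ^+ 2 <= G.
    rewrite (inc _ _ (ltW xt)); apply: (le_trans (sqr_Int_itv_le hg (ltW xt))).
    by rewrite -[leRHS]mul1r ler_wpM2r// lerBlDl.
  by have := sqr_ge0 (2 * v t - v x); nra.
rewrite (IntD (integRZ _ i1) (integRZ _ i0)) (IntZ _ i0) (IntZ _ i1) Int_indic_itv//.
rewrite (_ : x + 1 - x = 1); last by rewrite addrC addKr.
rewrite mulr1 -mulrDr ler_wpM2l// lerD2r.
have [_ iv] := hv; apply: le_Int => // t; rewrite indicE; case: (_ \in _).
  by rewrite mulr1.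
by rewrite mulr0 sqr_ge0.
Qed.

End interpolation.

(** * Sup norm bounds and the Gagliardo-Nirenberg inequality at the critical exponent *)

Section gagliardo_nirenberg.
Context {R : realType}.
Implicit Types (f g phi u v w F : R -> R) (s h : R) (k m n : nat).
Local Notation mu := (@lebesgue_measure R).

Lemma sobolevH_L2 m u : sobolevH m u -> L2 u.
Proof. by move=> /sobolevHP[]. Qed.

Lemma sobolevH_continuous m u : (1 <= m)%N -> sobolevH m u ->
  exists v, [/\ continuous v, {ae mu, forall x, u x = v x} & sobolevH m v].
Proof.
move=> m1 hu; have /sobolevHP[_ hk] := hu; have [g hg] := hk _ m1.
have [v [cv uv _]] := wd1_continuous hg; exists v; split=> //.
by apply: sobolevH_ae hu => //; exact: continuous_meas.
Qed.

Lemma wd_aeW k u v g : measurable_fun setT v -> {ae mu, forall x, u x = v x} ->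
  wd k u g -> wd k v g.
Proof. by move=> mv uv hg; have [_ [mg _] _] := hg; apply: wd_ae hg => //; exact: aeW. Qed.

(** The factor 2 of [wd1_sup_bound] doubles because the first derivative is itself controlled by the
    sum of both integrals. *)
Lemma sobolev_sup_bound m v g : (1 <= m)%N -> continuous v -> sobolevH m v -> wd m v g ->
  forall x, v x ^+ 2 <= 4 * (\int[mu]_x (v x ^+ 2) + \int[mu]_x (g x ^+ 2)).
Proof.
move=> m1 cv hv hg x; have /sobolevHP[_ hk] := hv; have [g1 hg1] := hk _ m1.
have := sobolev_interpolation hv hg m1 hg1.
have := wd1_sup_bound cv hg1 x.
have := Int_sqr_ge0 g; lra.
Qed.

Lemma integR_comp F v M K : continuous F -> L2 v -> (forall x, `|v x| <= M) ->
  (forall s, `|s| <= M -> `|F s| <= K * s ^+ 2) -> integR (fun x => F (v x)).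
Proof.
move=> cF [mv iv] hM hF.
apply: (@integR_dom _ _ (fun x => K * v x ^+ 2)).
- by apply: measurableT_comp => //; exact: continuous_meas.
- by move=> x; apply: hF.
- exact: integRZ.
Qed.

Lemma continuous_expn n : continuous (fun x : R => x ^+ n).
Proof. by move=> x; exact: exprn_continuous. Qed.

(** Since t <= 1 + t^2, the bound on the square yields one on |v| without a square root. *)
Lemma sobolev_bounded m v g : (1 <= m)%N -> continuous v -> sobolevH m v -> wd m v g ->
  forall x, `|v x| <= 1 + 4 * (\int[mu]_x (v x ^+ 2) + \int[mu]_x (g x ^+ 2)).
Proof.
move=> m1 cv hv hg x; have := sobolev_sup_bound m1 cv hv hg x.
have := Int_sqr_ge0 g; have := Int_sqr_ge0 v.
rewrite -[v x ^+ 2]real_normK ?num_real//; have := normr_ge0 (v x); nra.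
Qed.

Lemma expr_even_split m (x : R) : x ^+ (2 + 4 * m) = (x ^+ 2) ^+ (2 * m) * x ^+ 2.
Proof. by rewrite -exprM -exprD mulnA addnC. Qed.

Lemma integR_pow m v g : (1 <= m)%N -> continuous v -> sobolevH m v -> wd m v g ->
  integR (fun x => v x ^+ (2 + 4 * m)).
Proof.
move=> m1 cv hv hg; have hM := sobolev_bounded m1 cv hv hg.
set M := (1 + _) in hM.
apply: (@integR_comp (fun x => x ^+ (2 + 4 * m)) v M ((M ^+ 2) ^+ (2 * m))
    (@continuous_expn _) _ hM).
  exact: sobolevH_L2 hv.
move=> s sM; rewrite expr_even_split normrM [X in _ * X]ger0_norm ?sqr_ge0//.
have M0 : 0 <= M by apply: le_trans sM.
have s2 : s ^+ 2 <= M ^+ 2.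
  by rewrite -[s ^+ 2]real_normK ?num_real//; apply: lerXn2r; rewrite ?nnegrE.
rewrite ler_wpM2r ?sqr_ge0// [leLHS]ger0_norm; last by rewrite exprn_ge0// sqr_ge0.
by apply: lerXn2r; rewrite ?nnegrE ?sqr_ge0.
Qed.

Lemma gn_additive m v g : (1 <= m)%N -> continuous v -> sobolevH m v -> wd m v g ->
  \int[mu]_x (v x ^+ (2 + 4 * m)) <=
  (4 * (\int[mu]_x (v x ^+ 2) + \int[mu]_x (g x ^+ 2))) ^+ (2 * m) * \int[mu]_x (v x ^+ 2).
Proof.
move=> m1 cv hv hg; have sb := sobolev_sup_bound m1 cv hv hg.
have [_ iv] := sobolevH_L2 hv.
rewrite -(IntZ _ iv); apply: le_Int; [exact: integR_pow hg|exact: integRZ|].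
move=> x; rewrite expr_even_split ler_wpM2r ?sqr_ge0//.
by rewrite lerXn2r ?nnegrE ?sqr_ge0// mulr_ge0// addr_ge0// Int_sqr_ge0.
Qed.

Lemma wd_affine_norms k s h u g : 0 < s -> wd k u g ->
  \int[mu]_x (u (s * x + h) ^+ 2) = s^-1 * \int[mu]_x (u x ^+ 2) /\
  \int[mu]_x ((s ^+ k * g (s * x + h)) ^+ 2) =
    s^-1 * (s ^+ k) ^+ 2 * \int[mu]_x (g x ^+ 2).
Proof.
move=> s0 [hu hg _]; have sn0 : s != 0 by rewrite gt_eqF.
have [_ ->] := L2_affine h s0 hu; have [[_ ig] ->] := L2_affine h s0 hg.
split; first by rewrite mulKf.
under eq_Int do rewrite exprMn.
by rewrite (IntZ _ ig); field.
Qed.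

(* The additive inequality, applied to dilations of v, becomes scale invariant. *)
Lemma gn_homogeneous m v g : (1 <= m)%N -> continuous v -> sobolevH m v -> wd m v g ->
  \int[mu]_x (v x ^+ (2 + 4 * m)) <=
  8 ^+ (2 * m) * (\int[mu]_x (v x ^+ 2)) ^+ (2 * m) * \int[mu]_x (g x ^+ 2).
Proof.
move=> m1 cv hv hg.
have key s : 0 < s -> \int[mu]_x (v x ^+ (2 + 4 * m)) <=
  (4 * (s^-1 * \int[mu]_x (v x ^+ 2) + s^-1 * (s ^+ m) ^+ 2 * \int[mu]_x (g x ^+ 2)))
    ^+ (2 * m) * \int[mu]_x (v x ^+ 2).
  move=> s0; have [e1 e2] := wd_affine_norms 0 s0 hg.
  have cvs : continuous (fun x => v (s * x + 0)).
    move=> x; apply: (@continuous_comp _ _ _ (fun x => s * x + 0) v).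
      exact: affine_continuous.
    exact: cv.
  have := gn_additive m1 cvs (sobolevH_affine 0 s0 hv) (wd_affine 0 s0 hg).
  rewrite e1 e2.
  have [_ e] := integR_affine 0 s0 (integR_pow m1 cv hv hg).
  by move=> h; rewrite e -ler_pdivlMl// mulrCA.
move: key; set P := \int[mu]_x (v x ^+ (2 + 4 * m)).
set U := \int[mu]_x (v x ^+ 2); set A := \int[mu]_x (g x ^+ 2) => key.
have U0 : 0 <= U by exact: Int_sqr_ge0.
have A0 : 0 <= A by exact: Int_sqr_ge0.
have [U_0|Un0] := eqVneq U 0.
  have := key 1 ltr01; rewrite U_0 mulr0 => /le_trans; apply.
  by rewrite !mulr_ge0// exprn_ge0.
have {}U0 : 0 < U by rewrite lt_def Un0.
(* The optimal dilation divides by A, which is not yet known to be nonzero; hence A + e. *)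
suff H e : 0 < e -> P <= 8 ^+ (2 * m) * U ^+ (2 * m) * (A + e).
  apply/ler_addgt0Pr => e e0; set c := 8 ^+ (2 * m) * U ^+ (2 * m).
  have c0 : 0 < c by rewrite mulr_gt0// exprn_gt0.
  have := H (e / c) (divr_gt0 e0 c0); rewrite -/c mulrDr.
  by rewrite [c * (e / c)]mulrCA divff ?mulr1// gt_eqF.
move=> e0; have Ae0 : 0 < A + e by rewrite ltr_wpDl.
(* The dilation that balances the two terms: s^(2m) (A + e) = U. *)
pose s := (U / (A + e)) `^ ((2 * m)%:R^-1).
have s0 : 0 < s by rewrite powR_gt0// divr_gt0.
have m0 : (2 * m)%:R != 0 :> R by rewrite pnatr_eq0 muln_eq0/= -lt0n.
have sm : s ^+ (2 * m) = U / (A + e).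
  by rewrite -powR_mulrn ?powR_ge0// -powRrM mulVf// powRr1// ltW// divr_gt0.
have sn0 : s != 0 by rewrite gt_eqF.
apply: (le_trans (key s s0)).
rewrite -exprM (mulnC m) sm.
apply: (@le_trans _ _ ((8 * U / s) ^+ (2 * m) * U)).
  have si0 : 0 <= s^-1 by rewrite invr_ge0 ltW.
  have sU0 : 0 <= s^-1 * U by rewrite mulr_ge0// ltW.
  have q0 : 0 <= U / (A + e) by rewrite divr_ge0// ltW.
  rewrite ler_wpM2r ?(ltW U0)//; apply: lerXn2r; rewrite ?nnegrE.
  - by apply: mulr_ge0 => //; apply: addr_ge0 => //; exact: mulr_ge0 (mulr_ge0 si0 q0) A0.
  - by rewrite !mulr_ge0// ltW.
  have -> : 8 * U / s = 4 * (s^-1 * U + s^-1 * U) by field.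
  rewrite ler_wpM2l// lerD2l -mulrA ler_wpM2l ?invr_ge0 ?(ltW s0)//.
  by rewrite -mulrA ger_pMr// ler_pdivrMl// mulr1 lerDl ltW.
rewrite exprMn exprMn exprVn sm le_eqVlt; apply/orP; left; apply/eqP.
by field; rewrite !gt_eqF.
Qed.

Lemma LqNormE q u : 0 < q -> integR (fun x => `|u x| `^ q) ->
  LqNorm q u = ((\int[mu]_x (`|u x| `^ q)) `^ q^-1)%:E.
Proof.
move=> q0 hi; rewrite /LqNorm unlock.
by rewrite -poweR_EFin -(integR_EFin hi).
Qed.

Lemma LqNorm2E u : L2 u -> LqNorm 2 u = ((\int[mu]_x (u x ^+ 2)) `^ 2^-1)%:E.
Proof.
move=> [_ iu]; have e x : `|u x| `^ 2 = u x ^+ 2.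
  by rewrite powR_mulrn// real_normK// num_real.
rewrite LqNormE//; last by apply: eq_integR iu.
by under eq_Int do rewrite e.
Qed.

(** For p = 2 + 4m the exponent satisfies p delta_p = 2 and p (1 - delta_p) = 4m, so the p-th power
    of the inequality contains integer powers of integrals only. *)
Lemma gn_ineqE m u g C : (1 <= m)%N -> sobolevH m u -> wd m u g -> 0 <= C ->
  (LqNorm (2 + 4 * m)%:R u <= C%:E *
    poweR (LqNorm 2 (weak_deriv m u)) (GN_exponent m (2 + 4 * m)%:R) *
    poweR (LqNorm 2 u) (1 - GN_exponent m (2 + 4 * m)%:R))%E <->
  \int[mu]_x (u x ^+ (2 + 4 * m)) <= C ^+ (2 + 4 * m) *
    \int[mu]_x (g x ^+ 2) * (\int[mu]_x (u x ^+ 2)) ^+ (2 * m).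
Proof.
move=> m1 hu hg C0.
have [v [cv uv hv]] := sobolevH_continuous m1 hu.
have hgv := wd_aeW (continuous_meas cv) uv hg.
have mu_ : measurable_fun setT u by case: (sobolevH_L2 hu).
have iu : integR (fun x => u x ^+ (2 + 4 * m)).
  apply: ae_integR (integR_pow m1 cv hv hgv); first exact: measurable_funX.
  by apply: ae_imp uv => x ->.
have e x : `|u x| `^ (2 + 4 * m)%:R = u x ^+ (2 + 4 * m).
  rewrite powR_mulrn// -normrX ger0_norm// expr_even_split mulr_ge0 ?sqr_ge0//.
  by rewrite exprn_ge0// sqr_ge0.
have [hw ew] := weak_derivE hg.
have Lw := let: And3 _ a _ := hw in a.
have Lg := let: And3 _ a _ := hg in a.
rewrite LqNormE; [|by rewrite ltr0n|exact: eq_integR iu].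
rewrite (LqNorm2E (sobolevH_L2 hu)) (LqNorm2E Lw) !poweR_EFin -!EFinM lee_fin.
have -> : \int[mu]_x (weak_deriv m u x ^+ 2) = \int[mu]_x (g x ^+ 2).
  apply: ae_Int; [by case: Lw => a _; exact: measurable_funX|
    by case: Lg => a _; exact: measurable_funX|by apply: ae_imp ew => x ->].
under eq_Int do rewrite e.
set P := \int[mu]_x (u x ^+ (2 + 4 * m)); set U := \int[mu]_x (u x ^+ 2).
set A := \int[mu]_x (g x ^+ 2).
have U0 : 0 <= U by exact: Int_sqr_ge0.
have A0 : 0 <= A by exact: Int_sqr_ge0.
have P0 : 0 <= P.
  by apply: Int_ge0 => x; rewrite expr_even_split mulr_ge0 ?sqr_ge0// exprn_ge0// sqr_ge0.
have p0 : (2 + 4 * m)%:R != 0 :> R by rewrite pnatr_eq0.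
have m0 : m%:R != 0 :> R by rewrite pnatr_eq0 -lt0n.
have E1 : (P `^ (2 + 4 * m)%:R^-1) ^+ (2 + 4 * m) = P.
  by rewrite -powR_mulrn ?powR_ge0// -powRrM mulVf// powRr1.
have E2 : ((A `^ 2^-1) `^ GN_exponent m (2 + 4 * m)%:R) ^+ (2 + 4 * m) = A.
  rewrite -powR_mulrn ?powR_ge0// -!powRrM (_ : _ * _ = 1) ?powRr1//.
  rewrite /GN_exponent; move: p0; rewrite natrD natrM => p0; field.
  by rewrite m0 p0.
have E3 : ((U `^ 2^-1) `^ (1 - GN_exponent m (2 + 4 * m)%:R)) ^+ (2 + 4 * m) = U ^+ (2 * m).
  rewrite -powR_mulrn ?powR_ge0// -!powRrM (_ : _ * _ = (2 * m)%:R) ?powR_mulrn//.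
  rewrite /GN_exponent; move: p0; rewrite natrD !natrM => p0; field.
  by rewrite m0 p0.
rewrite -(@ler_pXn2r _ (2 + 4 * m)) ?nnegrE ?powR_ge0 ?mulr_ge0 ?powR_ge0//.
by rewrite E1 exprMn E3 [(C * _) ^+ _]exprMn E2.
Qed.

(** The infimum is itself admissible: for fixed [u], the smallest constant [K] that works for [u] is
    a lower bound of the admissible ones. *)
Lemma GN_constant_le m u g : (1 <= m)%N -> sobolevH m u -> wd m u g ->
  \int[mu]_x (u x ^+ (2 + 4 * m)) <= GN_constant m ((2 + 4 * m)%:R : R) ^+ (2 + 4 * m) *
    \int[mu]_x (g x ^+ 2) * (\int[mu]_x (u x ^+ 2)) ^+ (2 * m).
Proof.
move=> m1 hu hg; rewrite /GN_constant; set S := [set C : R | _].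
have S0 : S !=set0.
  (* Admissible by [gn_homogeneous], since 8^(2m) <= 8^(2+4m). *)
  exists 8; split=> // v hv; have [gv hgv] := sobolevH_wd hv.
  apply/(gn_ineqE m1 hv hgv) => //.
  have [w [cw vw hw]] := sobolevH_continuous m1 hv.
  have hgw := wd_aeW (continuous_meas cw) vw hgv.
  have mv : measurable_fun setT v by case: (sobolevH_L2 hv).
  have mw := continuous_meas cw.
  rewrite (@ae_Int _ _ (fun x => w x ^+ (2 + 4 * m))); [|exact: measurable_funX..|
    by apply: ae_imp vw => x ->].
  rewrite (@ae_Int _ (fun x => v x ^+ 2) (fun x => w x ^+ 2)); [|exact: measurable_funX..|
    by apply: ae_imp vw => x ->].
  apply: (le_trans (gn_homogeneous m1 cw hw hgw)).
  rewrite [leRHS]mulrAC ler_wpM2r ?Int_sqr_ge0// ler_wpM2r ?exprn_ge0 ?Int_sqr_ge0//.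
  rewrite ler_eXn2l ?ltr1n//.
  by rewrite (leq_trans _ (leq_addl _ _))// leq_mul2r orbT.
set P := \int[mu]_x (u x ^+ (2 + 4 * m)).
set Z := \int[mu]_x (g x ^+ 2) * (\int[mu]_x (u x ^+ 2)) ^+ (2 * m).
have h C : S C -> P <= C ^+ (2 + 4 * m) * Z.
  by move=> [C0 /(_ u hu)] /(gn_ineqE m1 hu hg C0); rewrite -mulrA.
have Z0 : 0 <= Z by rewrite mulr_ge0 ?exprn_ge0 ?Int_sqr_ge0.
rewrite -mulrA -/Z.
(* The quotient P / Z is meaningless for Z = 0, but then any admissible constant gives P <= 0. *)
have [Z_0|Zn0] := eqVneq Z 0.
  by case: S0 => C /h; rewrite Z_0 !mulr0.
have {}Z0 : 0 < Z by rewrite lt_def Zn0.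
have P0 : 0 <= P.
  by apply: Int_ge0 => x; rewrite expr_even_split mulr_ge0 ?sqr_ge0// exprn_ge0// sqr_ge0.
pose K := (P / Z) `^ (2 + 4 * m)%:R^-1.
have KE : K ^+ (2 + 4 * m) = P / Z.
  rewrite -powR_mulrn ?powR_ge0// -powRrM mulVf ?pnatr_eq0// powRr1//.
  by rewrite divr_ge0// ltW.
have hK : K <= inf S.
  apply: lb_le_inf => // C SC.
  have C0 : 0 <= C by case: SC.
  by rewrite -(@ler_pXn2r _ (2 + 4 * m)) ?nnegrE ?powR_ge0// KE ler_pdivrMr//; exact: h.
rewrite -ler_pdivrMr// -KE lerXn2r ?nnegrE ?powR_ge0//.
by rewrite (le_trans _ hK) ?powR_ge0.
Qed.

End gagliardo_nirenberg.

(** * Weak and pointwise compactness *)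

Section weak_limits.
Context {R : realType}.
Implicit Types (f g u v w y : R -> R) (x : nat -> R -> R) (i j n : nat).
Local Notation mu := (@lebesgue_measure R).

Lemma cvgn_dist (a : nat -> R) (l e : R) : a n @[n --> \oo] --> l -> 0 < e ->
  exists N, forall n, (N <= n)%N -> `|l - a n| <= e.
Proof. by move=> /cvgrPdist_le h /h [N _ hN]; exists N. Qed.

Lemma geometric_bound_cvg (a : nat -> R) (C : R) :
  (forall j n, (j <= n)%N -> `|a n - a j| <= C * 2^-1 ^+ j) ->
  exists l : R, a n @[n --> \oo] --> l.
Proof.
move=> h; have C0 : 0 <= C.
  by have := h 0 0 (leqnn 0); rewrite subrr normr0 expr0 mulr1.
suff : cvg (a n @[n --> \oo]) by move=> /cvg_ex.
apply/cauchy_cvgP; apply: cauchy_exP => e e0.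
have : (fun j => C * 2^-1 ^+ j) @ \oo --> (C * 0 : R).
  by apply: cvgM; [exact: cvg_cst|apply: cvg_expr; rewrite ger0_norm ?invf_lt1 ?ltr1n].
rewrite mulr0 => /cvgr0_norm_lt /(_ e e0) [j _ hj].
exists (a j); exists j => // n jn.
rewrite /ball/= distrC; apply: le_lt_trans (h _ _ jn) _.
have := hj j (leqnn j); rewrite /= ger0_norm// mulr_ge0// exprn_ge0//.
Qed.

(** The rate leaves room for the weight 4^j: the functions 4^j (v_(j+1) - v_j)^2 have a summable
    sequence of integrals. Their sum is therefore finite a.e., which bounds the increments by a
    geometric sequence at almost every point; Fatou's lemma carries the rate over to the limit. *)
Lemma L2_complete (v : nat -> R -> R) : (forall j, L2 (v j)) ->
  (forall i j, (j <= i)%N -> \int[mu]_t ((v i t - v j t) ^+ 2) <= 2^-1 ^+ (4 * j)) ->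
  exists g, L2 g /\ forall j, \int[mu]_t ((v j t - g t) ^+ 2) <= 2^-1 ^+ (4 * j).
Proof.
move=> hv hc.
pose d j t := 2 ^+ (2 * j) * (v j.+1 t - v j t) ^+ 2.
have d0 j t : 0 <= d j t by apply: mulr_ge0; [exact: exprn_ge0|exact: sqr_ge0].
have hd j : L2 (fun t => v j.+1 t - v j t) by exact: L2B.
have id_ j : integR (d j) by apply: integRZ; case: (hd j).
have Id j : \int[mu]_t d j t <= 2^-1 ^+ (2 * j).
  rewrite (IntZ _ (let: conj _ a := hd j in a)).
  have := hc _ _ (leqnSn j); rewrite -(@ler_pM2l _ (2 ^+ (2 * j)))// ?exprn_gt0//.
  move/le_trans; apply; rewrite (_ : 4 * j = 2 * j + 2 * j)%N; last by rewrite -mulnDl.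
  by rewrite exprD mulrA -exprMn divff// expr1n mul1r.
have sfin : (\int[mu]_t (\sum_(j <oo) (d j t)%:E) < +oo)%E.
  rewrite integral_nneseries//; last 2 first.
  - by move=> j; apply: EFin_meas; exact: integR_meas.
  - by move=> j t _; rewrite lee_fin.
  apply: (@le_lt_trans _ _ (\sum_(j <oo) (2^-1 ^+ j)%:E)%E).
    apply: lee_nneseries => [j _ _|j _] /=.
      by apply: integral_ge0 => t _; rewrite lee_fin.
    rewrite (integR_EFin (id_ j)) lee_fin (le_trans (Id j))//.
    by rewrite ler_wiXn2l// ?invf_le1 ?ler1n// leq_pmull.
  have g : 2^-1 ^+ n @[n --> \oo] --> (0:R).
    by apply: cvg_expr; rewrite ger0_norm ?invf_lt1 ?ltr1n.
  apply: (@le_lt_trans _ _ 2%:E); last exact: ltry.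
  apply: lime_le; first by apply: is_cvg_nneseries => j _ _; rewrite lee_fin exprn_ge0.
  apply: nearW => n; rewrite sumEFin lee_fin.
  have -> : \sum_(0 <= j < n) 2^-1 ^+ j = 2 - 2 * 2^-1 ^+ n :> R.
    elim: n => [|n ih]; first by rewrite big_geq// expr0 mulr1 subrr.
    by rewrite big_nat_recr//= ih exprS; field.
  by rewrite gerBl mulr_ge0// exprn_ge0.
have aefin : {ae mu, forall t, exists l : R, v n t @[n --> \oo] --> l}.
  have is_ : mu.-integrable setT (fun t => \sum_(j <oo) (d j t)%:E)%E.
    apply/integrableP; split.
      apply: (emeasurable_fun_cvg (fun n t => \sum_(0 <= j < n) (d j t)%:E)%E).
        move=> n; apply: emeasurable_sum => j; apply: EFin_meas; exact: integR_meas.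
      by move=> t _; apply: is_cvg_nneseries => j _ _; rewrite lee_fin.
    apply: le_lt_trans sfin; rewrite le_eqVlt; apply/orP; left; apply/eqP.
    apply: eq_integral => t _; rewrite gee0_abs//.
    by apply: nneseries_ge0 => j _ _; rewrite lee_fin.
  apply: ae_imp (integrable_ae measurableT is_) => t /(_ I).
  have s0 : (0 <= \sum_(j <oo) (d j t)%:E)%E.
    by apply: nneseries_ge0 => j _ _; rewrite lee_fin.
  move: s0; case E : (\sum_(j <oo) (d j t)%:E)%E => [B||]// B0 _.
  have dB j : d j t <= B.
    rewrite -lee_fin -E.
    apply: (@le_trans _ _ (\sum_(0 <= i < j.+1) (d i t)%:E)%E).
      rewrite big_nat_recr//= leeDr//.
      by apply: sume_ge0 => i _; rewrite lee_fin.
    by apply: nneseries_lim_ge => i _ _; rewrite lee_fin.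
  rewrite lee_fin in B0.
  have step_ j : `|v j.+1 t - v j t| <= Num.sqrt B * 2^-1 ^+ j.
    rewrite -(@ler_pXn2r _ 2)// ?nnegrE ?mulr_ge0 ?sqrtr_ge0 ?exprn_ge0//.
    rewrite real_normK ?num_real// exprMn sqr_sqrtr//.
    have := dB j; rewrite /d mulrC -ler_pdivlMr ?exprn_gt0// => /le_trans; apply.
    by rewrite -exprM mulnC exprVn.
  have tele j k : `|v (j + k)%N t - v j t| <= Num.sqrt B * (2 * 2^-1 ^+ j - 2 * 2^-1 ^+ (j + k)).
    elim: k => [|k ih]; first by rewrite addn0 !subrr normr0 mulr0.
    rewrite addnS; set a := v (j + k).+1 t; set b := v (j + k)%N t.
    have -> : a - v j t = (a - b) + (b - v j t) by ring.
    apply: (le_trans (ler_normD _ _)).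
    have := lerD (step_ (j + k)%N) ih => /le_trans; apply.
    rewrite le_eqVlt; apply/orP; left; apply/eqP; rewrite exprS.
    by field.
  apply: (@geometric_bound_cvg _ (2 * Num.sqrt B)) => j n jn.
  rewrite -(subnKC jn); apply: (le_trans (tele _ _)).
  rewrite [2 * Num.sqrt B]mulrC -mulrA ler_wpM2l ?sqrtr_ge0// gerBl.
  by rewrite mulr_ge0// exprn_ge0.
have mv j : measurable_fun setT (v j) by case: (hv j).
(* The upper limit is measurable, and it is the limit wherever the latter exists. *)
pose g t := fine (limn_esup (fun n => (v n t)%:E)).
have mg : measurable_fun setT g.
  apply: measurableT_comp => //; apply: measurable_fun_limn_esup => n.
  exact: EFin_meas.
have cg : {ae mu, forall t, v n t @[n --> \oo] --> g t}.
  apply: ae_imp aefin => t [l hl]; rewrite /g.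
  have hl' : (v n t)%:E @[n --> \oo] --> l%:E by apply: cvg_EFin => //; exact: nearW.
  by have [_ ->] := cvg_limn_einf_sup hl'.
have fat j : integR (fun t => (v j t - g t) ^+ 2) /\
    \int[mu]_t ((v j t - g t) ^+ 2) <= 2^-1 ^+ (4 * j).
  apply: (@fatouR _ (fun n t => (v j t - v (n + j)%N t) ^+ 2)).
  - by move=> n; case: (L2B (hv j) (hv (n + j)%N)).
  - by apply: measurable_funX; exact: measurable_funB.
  - by move=> n t; exact: sqr_ge0.
  - apply: ae_imp cg => t ct.
    have h : v j t - v (n + j)%N t @[n --> \oo] --> v j t - g t.
      by apply: cvgB; [exact: cvg_cst|rewrite (cvg_shiftn j (fun n => v n t))].
    exact: cvgM.
  - move=> n; apply: le_trans (hc (n + j)%N j (leq_addl _ _)).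
    by rewrite le_eqVlt; apply/orP; left; apply/eqP/eq_Int => t; rewrite -sqrrN opprB.
exists g; split; last by move=> j; case: (fat j).
have h : L2 (fun t => v 0 t - g t).
  by split; [exact: measurable_funB|case: (fat 0)].
have := L2B (hv 0) h; rewrite (_ : (fun t => _) = g)//.
by apply/funext => t; rewrite opprB addrC subrK.
Qed.

(** Dyadic convex combinations of the terms of index at least j; the parallelogram identity asks for
    closure under midpoints only. *)
Inductive tail_hull x j : (R -> R) -> Prop :=
| tail_hull_base n : (j <= n)%N -> tail_hull x j (x n)
| tail_hull_mid v w : tail_hull x j v -> tail_hull x j w ->
    tail_hull x j (fun t => 2^-1 * (v t + w t)).

Lemma tail_hull_le x i j v : (j <= i)%N -> tail_hull x i v -> tail_hull x j v.
Proof.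
move=> ji; elim=> [n ni|{}v w _ hv _ hw]; first by constructor; exact: leq_trans ni.
exact: tail_hull_mid.
Qed.

Lemma tail_hull_L2 x j v : (forall n, L2 (x n)) -> tail_hull x j v -> L2 v.
Proof. by move=> hx; elim=> // {}v w _ hv _ hw; apply: L2Z; exact: L2D. Qed.

Lemma midpoint_Int_mul v w y : L2 v -> L2 w -> L2 y ->
  \int[mu]_t (2^-1 * (v t + w t) * y t) =
  2^-1 * (\int[mu]_t (v t * y t) + \int[mu]_t (w t * y t)).
Proof.
move=> hv hw hy; rewrite -(IntD (L2_mul hv hy) (L2_mul hw hy)).
rewrite -(IntZ _ (integRD (L2_mul hv hy) (L2_mul hw hy))).
by apply: eq_Int => t; rewrite -mulrDl mulrA.
Qed.

Lemma tail_hull_Int x j v y a (e : R) : (forall n, L2 (x n)) -> L2 y ->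
  tail_hull x j v ->
  (forall n, (j <= n)%N -> `|\int[mu]_t (x n t * y t) - a| <= e) ->
  `|\int[mu]_t (v t * y t) - a| <= e.
Proof.
move=> hx hy hv h; elim: hv => [n jn|{}v w hv ihv hw ihw]; first exact: h.
rewrite midpoint_Int_mul//; [|exact: tail_hull_L2 hv|exact: tail_hull_L2 hw].
move: ihv ihw; rewrite !ler_norml => /andP[a1 a2] /andP[b1 b2].
by apply/andP; split; lra.
Qed.

(** An average never exceeds the largest of its terms. *)
Lemma tail_hull_Int_le x j v y : (forall n, L2 (x n)) -> L2 y -> tail_hull x j v ->
  exists2 n, (j <= n)%N & \int[mu]_t (v t * y t) <= \int[mu]_t (x n t * y t).
Proof.
have mid (a b c : R) : a <= b -> b <= c -> 2^-1 * (a + b) <= c by lra.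
move=> hx hy; elim=> [n jn|{}v w hv [n jn hn] hw [k jk hk]]; first by exists n.
rewrite midpoint_Int_mul//; [|exact: tail_hull_L2 hv|exact: tail_hull_L2 hw].
have [h|h] := leP (\int[mu]_t (v t * y t)) (\int[mu]_t (w t * y t)).
  by exists k => //; exact: mid hk.
by exists n => //; rewrite addrC; exact: mid (ltW h) hn.
Qed.

(* Almost minimizers of the norm in the hulls of the tails form a Cauchy
   sequence by the parallelogram identity; their limit is the weak limit. *)
Lemma weak_limit x (B : R) : (forall n, L2 (x n)) ->
  (forall n, \int[mu]_t (x n t ^+ 2) <= B) ->
  exists g, [/\ L2 g,
    forall y a, L2 y -> \int[mu]_t (x n t * y t) @[n --> \oo] --> a ->
      \int[mu]_t (g t * y t) = a &
    forall e N, 0 < e -> exists2 n, (N <= n)%N &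
      \int[mu]_t (g t ^+ 2) - e <= \int[mu]_t (x n t * g t)].
Proof.
move=> hx hB.
pose N2 v := \int[mu]_t (v t ^+ 2).
pose S j := [set r | exists2 v, tail_hull x j v & r = N2 v].
have Sx j : S j (N2 (x j)) by exists (x j) => //; constructor.
have Sl j : has_lbound (S j).
  by exists 0 => _ [v _ ->]; exact: Int_sqr_ge0.
have Si j : has_inf (S j) by split; [exists (N2 (x j))|].
pose d j := inf (S j).
have dle i j : (j <= i)%N -> d j <= d i.
  move=> ji; apply: lb_le_inf; first by exists (N2 (x i)).
  move=> _ [v hv ->]; apply: ge_inf => //; exists v => //.
  exact: tail_hull_le hv.
have dB j : d j <= B.
  by apply: le_trans (hB j); apply: ge_inf; [exact: Sl|exact: Sx].
pose D := sup (range d).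
have hD : has_sup (range d) by split; [exists (d 0); exists 0|exists B => _ [j _ <-]].
have dD j : d j <= D by apply: ub_le_sup; [case: hD|exists j].
(* The parallelogram identity bounds the squared distance of two almost minimizers by 2 (D - d (M
   j)) + 4 eta j < 6 eta j, to be at most the rate of [L2_complete]. *)
pose eta j : R := 2^-1 ^+ (4 * j) / 6.
have eta0 j : 0 < eta j by rewrite divr_gt0// exprn_gt0.
have eta_le i j : (j <= i)%N -> eta i <= eta j.
  move=> ji; rewrite ler_pM2r// ler_wiXn2l// ?invf_le1 ?ler1n//.
  by rewrite leq_mul2l ji orbT.
have /choice [n0 hn0] : forall j, exists n, D - eta j < d n.
  by move=> j; have [_ [n _ <-] h] := sup_adherent (eta0 j) hD; exists n.
(* Cumulative sums turn the chosen indices into a monotone sequence that dominates both [n0 j] and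
   j. *)
pose M j := (\sum_(i < j.+1) (n0 i).+1)%N.
have MS j : M j.+1 = (M j + (n0 j.+1).+1)%N by rewrite /M big_ord_recr.
have Mle i j : (j <= i)%N -> (M j <= M i)%N.
  move=> /subnKC <-; elim: (i - j)%N => [|k ih]; first by rewrite addn0.
  by rewrite addnS MS (leq_trans ih)// leq_addr.
have Mge j : (j <= M j)%N.
  by elim: j => // j ih; rewrite MS addnS ltnS (leq_trans ih)// leq_addr.
have n0M j : (n0 j <= M j)%N by rewrite /M big_ord_recr /= addnS ltnW// ltnS leq_addl.
have MD j : D - eta j < d (M j) by apply: lt_le_trans (hn0 j) (dle _ _ (n0M j)).
have /choice [v hv] : forall j, exists v, tail_hull x (M j) v /\ N2 v < d (M j) + eta j.
  by move=> j; have [_ [v hv ->] h] := inf_adherent (eta0 j) (Si (M j)); exists v.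
have vL j : L2 (v j) by apply: tail_hull_L2 (hv j).1.
have cau i j : (j <= i)%N -> \int[mu]_t ((v i t - v j t) ^+ 2) <= 2^-1 ^+ (4 * j).
  move=> ji.
  have [[h1 h2] [h3 h4]] := (hv i, hv j).
  have hm : tail_hull x (M j) (fun t => 2^-1 * (v i t + v j t)).
    by apply: tail_hull_mid => //; apply: tail_hull_le h1; exact: Mle.
  have h5 : d (M j) <= N2 (fun t => 2^-1 * (v i t + v j t)).
    by apply: ge_inf => //; exists (fun t => 2^-1 * (v i t + v j t)).
  have e1 : \int[mu]_t ((v i t - v j t) ^+ 2) = 2 * N2 (v i) + 2 * N2 (v j) -
      4 * N2 (fun t => 2^-1 * (v i t + v j t)).
    have a1 := Int_sqrD (-1) (vL i) (vL j); have a2 := Int_sqrD 1 (vL i) (vL j).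
    have -> : N2 (fun t => 2^-1 * (v i t + v j t)) =
              4^-1 * \int[mu]_t ((v i t + 1 * v j t) ^+ 2).
      rewrite -IntZ; last by case: (L2D (vL i) (L2Z 1 (vL j))).
      by apply: eq_Int => t; field.
    have -> : \int[mu]_t ((v i t - v j t) ^+ 2) = \int[mu]_t ((v i t + -1 * v j t) ^+ 2).
      by apply: eq_Int => t; rewrite mulN1r.
    by rewrite a1 a2 /N2; field.
  have e2 : 2^-1 ^+ (4 * j) = 6 * eta j by rewrite /eta; field.
  rewrite e1 e2; have := eta_le _ _ ji; have := MD j; have := dD (M i); lra.
have [g [hg hgv]] := L2_complete vL cau.
have small (e : R) : 0 < e -> exists J, forall j, (J <= j)%N -> 2^-1 ^+ (4 * j) < e.
  move=> e0; have g0 : 2^-1 ^+ n @[n --> \oo] --> (0:R).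
    by apply: cvg_expr; rewrite ger0_norm ?invf_lt1 ?ltr1n.
  have e2 : 0 < e / 2 by rewrite divr_gt0.
  have [J hJ] := cvgn_dist g0 e2; exists J => j Jj.
  apply: (@le_lt_trans _ _ (e / 2)); last by rewrite ltr_pdivrMr// ltr_pMr// ltr1n.
  apply: le_trans (hJ j Jj); rewrite sub0r normrN ger0_norm ?exprn_ge0//.
  by rewrite ler_wiXn2l// ?invf_le1 ?ler1n// leq_pmull.
have vy y e : L2 y -> 0 < e -> exists J, forall j, (J <= j)%N ->
    `|\int[mu]_t (v j t * y t) - \int[mu]_t (g t * y t)| <= e.
  move=> hy e0; have Y0 := Int_sqr_ge0 y; set Y := \int[mu]_t (y t ^+ 2) in Y0.
  have Y1 : 0 < Y + 1 by rewrite ltr_wpDl.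
  have [J hJ] := small (e ^+ 2 / (Y + 1)) (divr_gt0 (exprn_gt0 2 e0) Y1).
  exists J => j /hJ; rewrite ltr_pdivlMr// => h.
  rewrite -(@ler_pXn2r _ 2)// ?nnegrE ?(ltW e0)// real_normK ?num_real//.
  rewrite -(IntB (L2_mul (vL j) hy) (L2_mul hg hy)).
  under eq_Int do rewrite -mulrBl.
  apply: (le_trans (cauchy_schwarz_Int (L2B (vL j) hg) hy)).
  apply: le_trans (ltW h); rewrite -/Y.
  apply: (@le_trans _ _ (2^-1 ^+ (4 * j) * Y)); first by rewrite ler_wpM2r.
  by rewrite ler_wpM2l ?exprn_ge0// lerDl.
exists g; split=> //.
- move=> y a hy ca; apply/eqP; rewrite -subr_eq0 -normr_le0; apply/ler_addgt0Pr => e e0.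
  rewrite add0r; have e2 : 0 < e / 2 by rewrite divr_gt0.
  have [J hJ] := vy _ _ hy e2.
  have [K hK] := cvgn_dist ca e2.
  set j := maxn J K.
  have h1 := hJ j (leq_maxl _ _).
  have h2 : `|\int[mu]_t (v j t * y t) - a| <= e / 2.
    apply: (tail_hull_Int hx hy (hv j).1) => n jn; rewrite distrC; apply: hK => /=.
    by rewrite (leq_trans _ jn)// (leq_trans (leq_maxr J K))// Mge.
  move: h1 h2; rewrite !ler_norml => /andP[a1 a2] /andP[b1 b2].
  by apply/andP; split; lra.
(* A hull element close to g pairs with g almost like g itself, and some term averaged in it pairs
   with g at least as well. *)
- move=> e N e0; have [J hJ] := vy _ _ hg e0.
  have := hJ (maxn J N) (leq_maxl _ _); rewrite ler_norml => /andP[a1 a2].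
  have [n Mn hn] := tail_hull_Int_le hx hg (hv (maxn J N)).1.
  exists n; first by rewrite (leq_trans _ Mn)// (leq_trans (leq_maxr J N))// Mge.
  have : \int[mu]_t (g t * g t) = \int[mu]_t (g t ^+ 2) by apply: eq_Int => t; rewrite expr2.
  move: a1 hn; lra.
Qed.

End weak_limits.

(** * Extraction of pointwise limits and the Brezis-Lieb lemma *)

Section compactness.
Context {R : realType}.
Implicit Types (f g u v w F : R -> R) (i j n : nat).
Local Notation mu := (@lebesgue_measure R).

(* Limits along a nonprincipal ultrafilter provide the candidate limits, and
   finitely many of them are approximated simultaneously along the sequence. *)
Lemma diagonal_extraction (a : nat -> nat -> R) (M : nat -> R) :
  (forall i n, `|a i n| <= M i) ->
  exists s : nat -> nat, (forall n, (n <= s n)%N) /\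
    forall i, exists l : R, a i (s n) @[n --> \oo] --> l.
Proof.
move=> hM; have [G [GU sG]] := ultraFilterLemma (@eventually_filter).
have /choice [l hl] : forall i, exists l : R, a i n @[n --> G] --> l.
  move=> i; have := @segment_compact R (- M i) (M i); rewrite compact_ultra.
  (* The image filter decides every set because [G] decides its preimage; compactness of the segment
     then provides the limit. *)
  have UI : UltraFilter (a i n @[n --> G]).
    have PF : ProperFilter (a i n @[n --> G]) by exact: fmap_proper_filter.
    split=> // H HF sH; apply/seteqP; split=> // A HA.
    have [h|h] := in_ultra_setVsetC ((a i) @^-1` A) GU; first exact: h.
    have : H (~` A) by apply: sH; exact: h.
    move=> /(filterI HA); rewrite setICr => H0.
    by have := @filter_not_empty _ H HF H0.
  move=> /(_ _ UI) [|p [_ hp]]; last by exists p.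
  have h : G ((a i) @^-1` `[- M i, M i]%classic).
    apply: (@filterS _ G _ setT); last exact: filterT.
    by move=> n _ /=; rewrite in_itv/= -ler_norml.
  exact: h.
have /choice [s hs] : forall k, exists n, (k <= n)%N /\
    forall i, (i <= k)%N -> `|l i - a i n| < k.+1%:R^-1.
  move=> k.
  have h1 : \forall n \near G, forall i : 'I_k.+1, `|l i - a i n| < k.+1%:R^-1.
    by apply: filter_forall => i; move/cvgrPdist_lt: (hl i); apply; rewrite invr_gt0.
  have h2 : G [set n | (k <= n)%N] by apply: sG; exists k.
  have [n [/= h3 h4]] := filter_ex (filterI h1 h2).
  exists n; split=> // i ik; exact: (h3 (Ordinal (n := k.+1) (m := i) ik)).
exists s; split; first by move=> n; case: (hs n).
move=> i; exists (l i); apply/cvgrPdist_le => e e0.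
near=> n.
have ni : (i <= n)%N by near: n; exists i.
have [_ /(_ i ni) /ltW h] := hs n; apply: (le_trans h).
rewrite invf_ple ?posrE//; apply: (@le_trans _ _ n%:R); last by rewrite ler_nat.
by near: n; exact: nbhs_infty_ger.
Unshelve. all: by end_near. Qed.

(** Convergence at the rationals extends to every point by the common Holder bound. The bound n <= s
    n sends the indices to infinity, so monotonicity of [s] is not demanded. *)
Lemma holder_extraction (u : nat -> R -> R) (M K : R) :
  (forall n x, `|u n x| <= M) ->
  (forall n x y, (u n x - u n y) ^+ 2 <= K * `|x - y|) ->
  exists (s : nat -> nat) (v : R -> R), (forall n, (n <= s n)%N) /\
    forall x, u (s n) x @[n --> \oo] --> v x.
Proof.
move=> hM hK.
(* An enumeration of the rationals, with 0 at the integers that encode none. *)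
pose q i : R := ratr (odflt 0 (unpickle i : option rat)).
have [s [sn hs]] := @diagonal_extraction (fun i n => u n (q i)) (fun=> M) (fun i n => hM n (q i)).
exists s.
have K0 : 0 <= K.
  have := hK 0 0 1; rewrite sub0r normrN normr1 mulr1; exact: le_trans (sqr_ge0 _).
suff /choice [v hv] : forall x, exists l : R, u (s n) x @[n --> \oo] --> l by exists v.
move=> x; suff : cvg (u (s n) x @[n --> \oo]) by move=> /cvg_ex.
apply/cauchy_cvgP; apply: cauchy_exP => e e0.
have e2 : 0 < e / 2 by rewrite divr_gt0.
have d0 : 0 < (e / 2) ^+ 2 / (K + 1) / 2 by rewrite !divr_gt0 ?exprn_gt0// ltr_wpDl.
set d := _ / 2 in d0.
have [r] := @rat_in_itvoo R (x - d) (x + d) (ltac:(by rewrite ltrD2l gtrN)).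
rewrite in_itv/= => /andP[r1 r2].
have qE : q (pickle r) = ratr r by rewrite /q pickleK.
have [l hl] := hs (pickle r); rewrite /= qE in hl.
exists l; have [N hN] := cvgn_dist hl e2.
exists N => // n Nn; rewrite /ball/=.
have h1 := hN n Nn.
have h2 : `|u (s n) (ratr r) - u (s n) x| < e / 2.
  rewrite -(@ltr_pXn2r _ 2)// ?nnegrE ?(ltW e2)// real_normK ?num_real//.
  apply: (le_lt_trans (hK _ _ _)).
  have : `|ratr r - x| < (e / 2) ^+ 2 / (K + 1).
    rewrite ltr_norml; apply/andP; rewrite /d in r1 r2.
    by split; move: r1 r2 d0; rewrite /d; set c := _ / (K + 1); lra.
  rewrite ltr_pdivlMr ?ltr_wpDl// => h; apply: le_lt_trans h.
  by rewrite mulrC ler_wpM2l// lerDl.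
have -> : l - u (s n) x = (l - u (s n) (ratr r)) + (u (s n) (ratr r) - u (s n) x) by ring.
apply: (le_lt_trans (ler_normD _ _)).
by have := ler_ltD h1 h2; rewrite -splitr.
Qed.

(* The error term is bounded by an integrable function up to e * w_n^2, whose
   integral is uniformly small. *)
Lemma brezis_lieb (G : R -> R) u (w : nat -> R -> R) (K M B : R) :
  0 <= K -> continuous G -> L2 u -> (forall x, `|u x| <= M) ->
  (forall n, L2 (w n)) -> (forall n x, `|w n x| <= M) ->
  (forall n, \int[mu]_x (w n x ^+ 2) <= B) ->
  (forall x, w n x @[n --> \oo] --> (0 : R)) ->
  (forall a, `|a| <= M + M -> `|G a| <= K * a ^+ 2) ->
  (forall a b, `|a| <= M -> `|b| <= M ->
    `|G (a + b) - G a - G b| <= K * (a ^+ 2 + `|a| * `|b|)) ->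
  forall e : R, 0 < e -> \forall n \near \oo,
    `|\int[mu]_x G (u x + w n x) - \int[mu]_x G (u x) - \int[mu]_x G (w n x)| <= e.
Proof.
move=> K0 cG hu uM hw wM wB w0 Gq Gs e e0.
have mG := continuous_meas cG.
have M0 : 0 <= M by apply: le_trans (uM 0).
have MM (a : R) : `|a| <= M -> `|a| <= M + M by move=> /le_trans; apply; rewrite lerDl.
have [mu_ iu] := hu; have mw n : measurable_fun setT (w n) by case: (hw n).
have huw n : L2 (fun x => u x + w n x) by exact: L2D.
have i1 n : integR (fun x => G (u x + w n x)).
  apply: (integR_comp cG (huw n) _ Gq) => x.
  by apply: (le_trans (ler_normD _ _)); exact: lerD.
have i2 : integR (fun x => G (u x)) by apply: (integR_comp cG hu _ Gq) => x; exact: MM.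
have i3 n : integR (fun x => G (w n x)) by apply: (integR_comp cG (hw n) _ Gq) => x; exact: MM.
pose r n x := `|G (u x + w n x) - G (u x) - G (w n x)|.
have ir n : integR (r n) by apply: integR_norm; apply: integRB => //; exact: integRB.
have B0 : 0 <= B by apply: le_trans (wB 0); exact: Int_sqr_ge0.
pose e1 := e / 2 / (B + 1).
have e10 : 0 < e1 by rewrite !divr_gt0// ltr_wpDl.
(* Young's inequality: K a b <= K^2 / (4 e1) a^2 + e1 b^2. *)
pose C := K + K ^+ 2 / (4 * e1).
have rC n x : r n x <= C * u x ^+ 2 + e1 * w n x ^+ 2.
  apply: (le_trans (Gs _ _ (uM x) (wM n x))).
  have h := sqr_ge0 (K * `|u x| / (2 * e1) - `|w n x|).
  rewrite mulrDr /C mulrDl -addrA lerD2l.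
  rewrite -[u x ^+ 2]real_normK ?num_real// -[w n x ^+ 2]real_normK ?num_real//.
  set a := `|u x| in h *; set b := `|w n x| in h *.
  rewrite -subr_ge0 (_ : _ - _ = e1 * (K * a / (2 * e1) - b) ^+ 2).
    by rewrite mulr_ge0// ltW.
  by field; rewrite gt_eqF.
(* The truncated error is dominated by an integrable function, and the truncation removes at most e1
   w_n^2. *)
pose t n x := Num.min (r n x) (C * u x ^+ 2).
have C0 : 0 <= C by rewrite addr_ge0// divr_ge0 ?sqr_ge0// mulr_ge0// ltW.
have tn n x : `|t n x| <= C * u x ^+ 2.
  rewrite ger0_norm; first by rewrite /t ge_min lexx orbT.
  by rewrite le_min normr_ge0 mulr_ge0// sqr_ge0.
have mt n : measurable_fun setT (t n).
  apply: measurable_minr; first exact: integR_meas.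
  by apply: measurable_funM => //; exact: measurable_funX.
have r0 x : r n x @[n --> \oo] --> (0 : R).
  have c1 : G (u x + w n x) @[n --> \oo] --> G (u x).
    have -> : G (u x) = G (u x + 0) by rewrite addr0.
    have h : u x + w n x @[n --> \oo] --> u x + 0 by apply: cvgD; [exact: cvg_cst|exact: w0].
    exact: (cvg_comp _ _ h (cG (u x + 0))).
  have G0 : G 0 = 0.
    apply/eqP; rewrite -normr_le0; have := Gq 0.
    by rewrite normr0 expr0n mulr0; apply; rewrite addr_ge0.
  have c2 : G (w n x) @[n --> \oo] --> (0 : R).
    by rewrite -G0; exact: (cvg_comp _ _ (w0 x) (cG 0)).
  have c3 : G (u x + w n x) - G (u x) - G (w n x) @[n --> \oo] --> (0 : R).
    rewrite (_ : 0 = G (u x) - G (u x) - 0); last by rewrite subrr subr0.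
    by apply: cvgB => //; apply: cvgB => //; exact: cvg_cst.
  by rewrite -[X in _ --> X](@normr0 _ R); exact: (cvg_norm c3).
have t0 x : t n x @[n --> \oo] --> (0 : R).
  apply: (squeeze_cvgr _ (cvg_cst 0) (r0 x)); apply: nearW => n.
  rewrite le_min normr_ge0 mulr_ge0 ?sqr_ge0//=.
  by rewrite ge_min lexx.
have cae : {ae mu, forall x, t n x @[n --> \oo] --> (0 : R)} by exact: aeW.
have [_ It] := dct mt (measurable_cst (0 : R)) cae (integRZ C iu) tn.
rewrite Rintegral_cst// mul0r in It.
have e2 : 0 < e / 2 by rewrite divr_gt0.
have [N hN] := cvgn_dist It e2; exists N => // n /hN; rewrite sub0r normrN => h.
have it n' : integR (t n') by apply: integR_dom (mt n') (tn n') (integRZ C iu).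
rewrite -IntB// -IntB//; last exact: integRB.
apply: (@le_trans _ _ (\int[mu]_x (t n x + e1 * w n x ^+ 2))).
  have [_ iw] := hw n.
  apply: le_norm_Int.
  - by apply: integRB => //; exact: integRB.
  - by apply: integRD => //; exact: integRZ.
  - move=> x; rewrite /t -/(r n x) -lerBlDr le_min lerBlDr lerDl lerBlDr.
    by rewrite rC andbT mulr_ge0 ?sqr_ge0// ltW.
have [_ iw] := hw n.
rewrite (IntD (it n) (integRZ _ iw)) (IntZ _ iw) [leRHS]splitr lerD//.
  by apply: le_trans h; exact: ler_norm.
rewrite /e1 -mulrA ler_piMr ?(ltW e2)// ler_pdivrMl ?ltr_wpDl// mulr1.
by rewrite (le_trans (wB n))// lerDl.
Qed.

End compactness.

(** * The energy functional *)

Section nonlinearity.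
Context {R : realType}.
Implicit Types (F : R -> R) (s t a b : R).

Lemma dnbhs0P (P : R -> Prop) : (\forall s \near (0 : R)^', P s) ->
  exists2 d : R, 0 < d & forall s, `|s| <= d -> s != 0 -> P s.
Proof.
move=> [d /= d0 hd]; exists (d / 2); first by rewrite divr_gt0.
move=> s sd s0; apply: hd => //=; rewrite sub0r normrN (le_lt_trans sd)//.
by rewrite ltr_pdivrMr// ltr_pMr// ltr1n.
Qed.

Lemma derivable_continuous F : (forall s, derivable F s 1) -> continuous F.
Proof. by move=> h x; apply: differentiable_continuous; exact/derivable1_diffP. Qed.

Section hypotheses_at_0.
Context (F : R -> R) (dF : forall s, derivable F s 1) (cF' : continuous (derive1 F)).
Context (F'O : exists K : R, \forall s \near (0 : R)^', `|derive1 F s| <= K * `|s|).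
Context (Fo : F s / s ^+ 2 @[s --> (0 : R)^'] --> (0 : R)).

Let cF : continuous F := derivable_continuous dF.

Lemma small_quadratic (e : R) : 0 < e -> exists2 d : R, 0 < d & forall s, `|s| <= d -> s != 0 ->
  `|F s| <= e * s ^+ 2.
Proof.
move=> e0; move/cvgrPdist_le: Fo => /(_ _ e0) /dnbhs0P [d d0 hd]; exists d => // s sd s0.
have := hd s sd s0; rewrite sub0r normrN normrM normfV [`|s ^+ 2|]ger0_norm ?sqr_ge0//.
by rewrite ler_pdivrMr// exprn_even_gt0.
Qed.

(** The limit (f1) only sees nonzero s; it forces F(s) to tend to 0, and F is continuous at 0. *)
Lemma nonlinearity0 : F 0 = 0.
Proof.
apply/eqP; rewrite -normr_le0; apply/ler_addgt0Pr => e e0; rewrite add0r.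
have e2 : 0 < e / 2 by rewrite divr_gt0.
have [d d0 hd] := cvg_at_dist (@cF 0) e2.
have [d' d'0 hd'] := small_quadratic e2.
pose s := Num.min 1 (Num.min (d / 2) d').
have s0 : 0 < s by rewrite !lt_min ltr01 d'0 divr_gt0.
have s1 : s <= 1 by rewrite ge_min lexx.
have sd : s < d.
  have : s <= d / 2 by rewrite !ge_min lexx orbT.
  by move=> /le_lt_trans; apply; rewrite ltr_pdivrMr// ltr_pMr// ltr1n.
have sd' : s <= d' by rewrite !ge_min lexx !orbT.
have h1 : `|F 0 - F s| <= e / 2 by apply: hd; rewrite sub0r normrN gtr0_norm.
have h2 : `|F s| <= e / 2 * s ^+ 2 by apply: hd'; rewrite ?gtr0_norm// gt_eqF.
have h3 : `|F s| <= e / 2.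
  by rewrite (le_trans h2)// ler_piMr ?(ltW e2)// exprn_ile1// ltW.
rewrite [leRHS]splitr -[F 0](subrK (F s)).
by apply: (le_trans (ler_normD _ _)); exact: lerD.
Qed.

Lemma small_quadratic_all (e : R) : 0 < e -> exists2 d : R, 0 < d & forall s, `|s| <= d ->
  `|F s| <= e * s ^+ 2.
Proof.
move=> e0; have [d d0 hd] := small_quadratic e0; exists d => // s sd.
have [->|s0] := eqVneq s 0; first by rewrite nonlinearity0 normr0 expr0n mulr0.
exact: hd.
Qed.

(** As for F: the bound near 0 makes F'(s) tend to 0, and F' is continuous. *)
Lemma derive1_nonlinearity0 : derive1 F 0 = 0.
Proof.
have [K hK] := F'O; have [d d0 hd] := dnbhs0P hK.
apply/eqP; rewrite -normr_le0; apply/ler_addgt0Pr => e e0; rewrite add0r.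
have e2 : 0 < e / 2 by rewrite divr_gt0.
have [d' d'0 hd'] := cvg_at_dist (@cF' 0) e2.
have K1 : 0 < `|K| + 1 by rewrite ltr_wpDl.
pose s := Num.min (e / 2 / (`|K| + 1)) (Num.min (d' / 2) d).
have s0 : 0 < s by rewrite !lt_min d0 !divr_gt0.
have sd : s <= d by rewrite !ge_min lexx !orbT.
have sd' : s < d'.
  have : s <= d' / 2 by rewrite !ge_min lexx orbT.
  by move=> /le_lt_trans; apply; rewrite ltr_pdivrMr// ltr_pMr// ltr1n.
have h1 : `|derive1 F 0 - derive1 F s| <= e / 2.
  by apply: hd'; rewrite sub0r normrN gtr0_norm.
have h2 : `|derive1 F s| <= e / 2.
  have : `|derive1 F s| <= K * `|s| by apply: hd; rewrite ?gtr0_norm// gt_eqF.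
  move/le_trans; apply; rewrite gtr0_norm//.
  have h : s <= e / 2 / (`|K| + 1) by rewrite ge_min lexx.
  rewrite ler_pdivlMr// in h; apply: le_trans h; rewrite mulrC ler_wpM2l ?(ltW s0)//.
  by rewrite (le_trans (ler_norm _))// lerDl.
rewrite [leRHS]splitr -[derive1 F 0](subrK (derive1 F s)).
by apply: (le_trans (ler_normD _ _)); exact: lerD.
Qed.

(** Away from 0, where |s| > d, a bound B on |F'| is at most (B / d) |s|. *)
Lemma derive1_linear_bound (M : R) : exists2 K : R, 0 <= K & forall s, `|s| <= M ->
  `|derive1 F s| <= K * `|s|.
Proof.
have [K hK] := F'O; have [d d0 hd] := dnbhs0P hK.
have [B B0 hB] := @continuous_bounded_itv R _ (- M) M cF'.
exists (`|K| + B / d); first by rewrite addr_ge0// divr_ge0// ltW.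
move=> s sM; have [->|s0] := eqVneq s 0.
  by rewrite derive1_nonlinearity0 !normr0 mulr0.
have Bd0 : 0 <= B / d by rewrite divr_ge0// ltW.
have [sd|ds] := leP `|s| d.
  apply: (le_trans (hd s sd s0)); rewrite ler_wpM2r//.
  by rewrite (le_trans (ler_norm _))// lerDl.
apply: (@le_trans _ _ B); first by apply: hB; rewrite -ler_norml.
apply: (@le_trans _ _ (B / d * `|s|)); last by rewrite ler_wpM2r// lerDr.
by rewrite mulrAC ler_pdivlMr// ler_wpM2l// ltW.
Qed.

(** Mean value theorem; the intermediate point has modulus at most |s| + |t|. *)
Lemma nonlinearity_lipschitz (M K : R) : 0 <= K ->
  (forall s, `|s| <= M -> `|derive1 F s| <= K * `|s|) ->
  forall s t, `|s| <= M -> `|t| <= M -> `|F s - F t| <= K * (`|s| + `|t|) * `|s - t|.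
Proof.
move=> K0 hK.
have lem s t : t < s -> `|s| <= M -> `|t| <= M ->
    `|F s - F t| <= K * (`|s| + `|t|) * `|s - t|.
  move=> ts sM tM.
  have [||c] := @MVT R F (derive1 F) t s ts.
  - by move=> x _; rewrite derive1E; exact: derivableP.
  - by apply: continuous_subspaceT => x; exact: cF.
  rewrite in_itv/= => /andP[tc cs] ->.
  have cM : `|c| <= `|s| + `|t|.
    have := ler_norm s; have := ler_norm (- t); rewrite normrN => h1 h2.
    have := normr_ge0 s; have := normr_ge0 t => h3 h4.
    by rewrite ler_norml; apply/andP; split; lra.
  have cM' : `|c| <= M.
    move: sM tM; rewrite !ler_norml => /andP[a1 a2] /andP[b1 b2].
    by apply/andP; split; lra.
  rewrite normrM ler_wpM2r//; apply: (le_trans (hK c cM')).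
  by rewrite ler_wpM2l.
move=> s t sM tM; have [ts|st|->] := ltgtP t s.
- exact: lem.
- by rewrite distrC [`|s| + _]addrC [`|s - t|]distrC; exact: lem.
- by rewrite !subrr normr0 mulr0.
Qed.

(** Bounds on bounded sets are enough because elements of H^m are bounded. For the second one, F(a +
    b) - F(b) is estimated by the Lipschitz bound and F(a) by the quadratic one, whence the factor
    2. *)
Lemma nonlinearity_quadratic (M : R) : exists2 K : R, 0 <= K &
  (forall s, `|s| <= M -> `|F s| <= K * s ^+ 2) /\
  (forall a b, `|a| <= M -> `|b| <= M -> `|a + b| <= M ->
    `|F (a + b) - F a - F b| <= K * (a ^+ 2 + `|a| * `|b|)) /\
  (forall s, `|s| <= M -> `|derive1 F s| <= K * `|s|) /\
  (forall s t, `|s| <= M -> `|t| <= M -> `|F s - F t| <= K * (`|s| + `|t|) * `|s - t|).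
Proof.
have [K K0 hK] := derive1_linear_bound M.
have lip := nonlinearity_lipschitz K0 hK.
have K2 : 0 <= 2 * K by rewrite mulr_ge0.
have KK x : 0 <= x -> K * x <= 2 * K * x.
  by move=> x0; rewrite ler_wpM2r// ler_peMl// ler1n.
have q s : `|s| <= M -> `|F s| <= K * s ^+ 2.
  move=> sM; have := lip s 0 sM; rewrite normr0 => /(_ (le_trans (normr_ge0 s) sM)).
  rewrite nonlinearity0 !subr0 addr0 -mulrA -expr2 real_normK ?num_real//.
exists (2 * K) => //; split; [|split; [|split]].
- by move=> s sM; apply: (le_trans (q s sM)); apply: KK; exact: sqr_ge0.
- move=> a b aM bM abM.
  have h1 := lip _ _ abM bM; rewrite addrK in h1.
  have h2 := q _ aM.
  have -> : F (a + b) - F a - F b = (F (a + b) - F b) - F a by ring.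
  apply: (le_trans (ler_normB _ _)); apply: (le_trans (lerD h1 h2)).
  rewrite -[a ^+ 2]real_normK ?num_real//.
  have h3 := ler_normD a b; have h4 := normr_ge0 a; have h5 := normr_ge0 b.
  apply: (@le_trans _ _ (K * (`|a| + `|b| + `|b|) * `|a| + K * `|a| ^+ 2)).
    by rewrite lerD2r ler_wpM2r// ler_wpM2l// lerD2r.
  by rewrite le_eqVlt; apply/orP; left; apply/eqP; ring.
- by move=> s sM; apply: (le_trans (hK s sM)); exact: KK.
- move=> s t sM tM; apply: (le_trans (lip s t sM tM)).
  by rewrite -[leLHS]mulrA -[leRHS]mulrA; apply: KK; rewrite mulr_ge0// addr_ge0.
Qed.

Lemma superpower_lower n : F s / s ^+ n @[s --> (0 : R)^'] --> +oo -> ~~ odd n -> (0 < n)%N ->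
  forall L : R, exists2 d : R, 0 < d & forall s, `|s| <= d -> L * s ^+ n <= F s.
Proof.
move=> h on n0 L; move/cvgryPge: h => /(_ L) /dnbhs0P [d d0 hd].
exists d => // s sd; have [->|s0] := eqVneq s 0.
  by rewrite nonlinearity0 expr0n gtn_eqF// mulr0.
by have := hd s sd s0; rewrite ler_pdivlMr// exprn_even_gt0//= s0 orbT.
Qed.

(** The strict smallness condition leaves room for a positive s' strictly above sigma, even if sigma
    is negative or -oo; above the upper limit, the bound holds for all large |s|. *)
Lemma limsup_upper n (sigma : \bar R) (c : R) : ~~ odd n -> 0 <= c ->
  sigma = limf_esup (fun s : R => (F s / s ^+ n)%:E) (@norm_infty_nbhs R) ->
  (sigma < +oo)%E -> (2%:E * sigma * c%:E < 1)%E ->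
  exists2 s' : R, 0 < s' & 2 * s' * c < 1 /\
    exists M : R, forall s, M < `|s| -> F s <= s' * s ^+ n.
Proof.
move=> on c0 sE soo sc.
have [s' [s'0 s'c ss']] : exists s', [/\ 0 < s', 2 * s' * c < 1 & (sigma < s'%:E)%E].
  have H r : 2 * r * c < 1 -> exists s', [/\ 0 < s', 2 * s' * c < 1 & r < s'].
    move=> rc; have [c_0|cn0] := eqVneq c 0.
      exists (Num.max r 0 + 1); split.
      - by rewrite ltr_wpDl// le_max lexx orbT.
      - by rewrite c_0 mulr0.
      - by rewrite (@le_lt_trans _ _ (Num.max r 0)) ?ltrDl// le_max lexx.
    have {}c0 : 0 < c by rewrite lt_def cn0.
    (* T is the largest value allowed by smallness; s' is the midpoint of q and T. *)
    pose q := Num.max r 0; pose T := (2 * c)^-1.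
    have T0 : 0 < T by rewrite invr_gt0 mulr_gt0.
    have Tc : 2 * T * c = 1 by rewrite /T; field.
    have qT : q < T.
      rewrite gt_max T0 andbT -[ltRHS]mul1r ltr_pdivlMr ?mulr_gt0//.
      by rewrite mulrA [r * 2]mulrC.
    have q0 : 0 <= q by rewrite le_max lexx orbT.
    have rq : r <= q by rewrite le_max lexx.
    exists ((q + T) / 2); split; [lra| |lra].
    have h : q * c < T * c by rewrite ltr_pM2r.
    by lra.
  move: sigma {sE} soo sc => [r||]// _.
  - by rewrite -!EFinM lte_fin => /H[s' [h1 h2 h3]]; exists s'; rewrite lte_fin.
  - by have [|s' [h1 h2 h3]] := H 0; [rewrite mulr0 mul0r|exists s'; rewrite ltNyr].
exists s' => //; split=> //.
move: ss'; rewrite sE => /ereal_inf_lt [_ [A [M hM] <-]] hA.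
exists (Num.max M 0) => s; rewrite gt_max => /andP[Ms s0].
have := hM s Ms => As.
have : ((F s / s ^+ n)%:E <= s'%:E)%E.
  by apply: le_trans (ltW hA); apply: ereal_sup_ubound; exists s.
by rewrite lee_fin ler_pdivrMr// exprn_even_gt0//= -normr_gt0 s0 orbT.
Qed.

Lemma nonlinearity_upper n (s' M : R) : ~~ odd n -> 0 <= s' ->
  (forall s, M < `|s| -> F s <= s' * s ^+ n) ->
  exists2 C : R, 0 <= C & forall s, F s <= C * s ^+ 2 + s' * s ^+ n.
Proof.
move=> on s'0 h; have [K K0 [hK _]] := nonlinearity_quadratic M.
exists K => // s; have [sM|Ms] := leP `|s| M.
  rewrite (le_trans (ler_norm _))// (le_trans (hK s sM))// lerDl mulr_ge0//.
  exact: exprn_even_ge0.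
by rewrite (le_trans (h s Ms))// lerDr mulr_ge0 ?sqr_ge0.
Qed.

End hypotheses_at_0.
End nonlinearity.

(** * Energy, mass and kinetic energy: dilations, coercivity, negativity *)

Section energy_functional.
Context {R : realType} (m : nat) (F : R -> R).
Context (m1 : (1 <= m)%N) (cF : continuous F).
Context (Fq : forall M : R, exists2 K : R, 0 <= K & forall s, `|s| <= M -> `|F s| <= K * s ^+ 2).
Implicit Types (u v w g : R -> R) (s h rho : R).
Local Notation mu := (@lebesgue_measure R).

Definition dirichlet v : R := \int[mu]_x (weak_deriv m v x ^+ 2).

Lemma dirichlet_ge0 v : 0 <= dirichlet v.
Proof. exact: Int_sqr_ge0. Qed.

Lemma mass_ge0 v : 0 <= mass v.
Proof. exact: Int_sqr_ge0. Qed.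

Lemma sobolevH_weak_deriv v : sobolevH m v -> wd m v (weak_deriv m v).
Proof. by move=> /sobolevH_wd [g /weak_derivE[]]. Qed.

Lemma dirichletE v g : wd m v g -> dirichlet v = \int[mu]_x (g x ^+ 2).
Proof.
move=> hg; have [hw e] := weak_derivE hg.
have [_ [a _] _] := hw; have [_ [b _] _] := hg.
apply: ae_Int; [exact: measurable_funX..|].
by apply: ae_imp e => x ->.
Qed.

Lemma sobolev_le v : continuous v -> sobolevH m v ->
  forall x, `|v x| <= 1 + 4 * (mass v + dirichlet v).
Proof. by move=> cv hv; exact: (sobolev_bounded m1 cv hv (sobolevH_weak_deriv hv)). Qed.

Lemma integR_F v : continuous v -> sobolevH m v -> integR (fun x => F (v x)).
Proof.
move=> cv hv; have hM := sobolev_le cv hv; have [K _ hK] := Fq (1 + 4 * (mass v + dirichlet v)).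
exact: (integR_comp cF (sobolevH_L2 hv) hM hK).
Qed.

Lemma energy_dirichlet v : continuous v -> sobolevH m v ->
  energy m F v = 1 / 2 * dirichlet v - \int[mu]_x F (v x).
Proof.
move=> cv hv; apply: energyE => //; first exact: sobolevH_weak_deriv.
exact: integR_F.
Qed.

Lemma mass_ae u v : measurable_fun setT u -> measurable_fun setT v ->
  {ae mu, forall x, u x = v x} -> mass u = mass v.
Proof.
move=> mu_ mv uv; apply: ae_Int; [exact: measurable_funX..|].
by apply: ae_imp uv => x ->.
Qed.

(** This justifies the restriction to continuous representatives. *)
Lemma energy_ae u v : sobolevH m u -> continuous v -> {ae mu, forall x, u x = v x} ->
  energy m F u = energy m F v.
Proof.
move=> hu cv uv; have mv := continuous_meas cv.
have hv := sobolevH_ae mv uv hu.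
have [mu_ _] := sobolevH_L2 hu.
have hg := sobolevH_weak_deriv hu.
have iF : integR (fun x => F (u x)).
  apply: ae_integR (integR_F cv hv).
    by apply: measurableT_comp => //; exact: continuous_meas.
  by apply: ae_imp uv => x ->.
rewrite (energyE cF hg iF) energy_dirichlet// (dirichletE (wd_aeW mv uv hg)).
congr (_ - _); apply: ae_Int.
- by apply: measurableT_comp => //; exact: continuous_meas.
- by apply: measurableT_comp => //; exact: continuous_meas.
- by apply: ae_imp uv => x ->.
Qed.

Lemma affine_comp_continuous s h v : continuous v -> continuous (fun x => v (s * x + h)).
Proof.
move=> cv x; apply: (@continuous_comp _ _ _ (fun x => s * x + h) v).
  exact: affine_continuous.
exact: cv.
Qed.

Lemma mass_affine s h v : 0 < s -> sobolevH m v ->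
  mass (fun x => v (s * x + h)) = s^-1 * mass v.
Proof.
by move=> s0 hv; have [e _] := wd_affine_norms h s0 (sobolevH_weak_deriv hv).
Qed.

Lemma dirichlet_affine s h v : 0 < s -> sobolevH m v ->
  dirichlet (fun x => v (s * x + h)) = s^-1 * s ^+ (2 * m) * dirichlet v.
Proof.
move=> s0 hv; have hg := sobolevH_weak_deriv hv.
have [_ e] := wd_affine_norms h s0 hg.
by rewrite (dirichletE (wd_affine h s0 hg)) e -exprM (mulnC m).
Qed.

Lemma energy_affine s h v : 0 < s -> continuous v -> sobolevH m v ->
  energy m F (fun x => v (s * x + h)) =
  s^-1 * (1 / 2 * s ^+ (2 * m) * dirichlet v - \int[mu]_x F (v x)).
Proof.
move=> s0 cv hv; have hs := sobolevH_affine h s0 hv.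
rewrite energy_dirichlet//; last exact: affine_comp_continuous.
rewrite dirichlet_affine//; have [_ ->] := integR_affine h s0 (integR_F cv hv).
by field; rewrite gt_eqF.
Qed.

Lemma continuous_ae0 v : continuous v -> {ae mu, forall x, v x = 0} -> forall x, v x = 0.
Proof.
move=> cv h; apply: (continuous_ae_eq cv _ h) => x; exact: cvg_cst.
Qed.

Lemma mass_eq0 v : continuous v -> L2 v -> mass v = 0 -> forall x, v x = 0.
Proof.
move=> cv [_ iv] v0; have := Int_eq0 iv (fun x => sqr_ge0 (v x)) v0 => h.
apply: continuous_ae0 => //.
by apply: ae_imp h => x /eqP; rewrite sqrf_eq0 => /eqP.
Qed.

Lemma mass_gt0 v x : continuous v -> L2 v -> v x != 0 -> 0 < mass v.
Proof.
move=> cv hv vx; rewrite lt_def mass_ge0 andbT; apply: contra vx => /eqP h.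
by rewrite (mass_eq0 cv hv h).
Qed.

(** With zero kinetic energy, the Gagliardo-Nirenberg inequality makes the integral of v^(2+4m)
    vanish, hence v. *)
Lemma dirichlet_gt0 v x : continuous v -> sobolevH m v -> v x != 0 -> 0 < dirichlet v.
Proof.
move=> cv hv vx; rewrite lt_def dirichlet_ge0 andbT; apply: contra vx => /eqP h.
have hg := sobolevH_weak_deriv hv.
have := GN_constant_le m1 hv hg; rewrite -/(dirichlet v) h mulr0 mul0r => I0.
have p0 y : 0 <= v y ^+ (2 + 4 * m).
  by rewrite expr_even_split mulr_ge0 ?sqr_ge0// exprn_ge0// sqr_ge0.
have I1 : \int[mu]_y (v y ^+ (2 + 4 * m)) = 0.
  by apply/eqP; rewrite eq_le I0 Int_ge0.
have hz := Int_eq0 (integR_pow m1 cv hv hg) p0 I1.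
apply/eqP; apply: continuous_ae0 => //.
by apply: ae_imp hz => y /eqP; rewrite expf_eq0 => /andP[_ /eqP].
Qed.

Lemma F0 : F 0 = 0.
Proof.
have [K _ hK] := Fq 0; apply/eqP; rewrite -normr_le0; have := hK 0.
by rewrite normr0 expr0n mulr0; apply.
Qed.

(* Dilating w to mass rho multiplies the potential energy by rho / mass w and
   the kinetic energy by a smaller factor. *)
Lemma energy_scaling rho c w : 0 < rho ->
  (forall v, continuous v -> sobolevH m v -> mass v <= rho -> c <= energy m F v) ->
  continuous w -> sobolevH m w -> mass w <= rho ->
  mass w / rho * c + 1 / 2 * (1 - (mass w / rho) ^+ (2 * m)) * dirichlet w <= energy m F w.
Proof.
move=> r0 hc cw hw wr.
(* The dilation factor mass w / rho would be 0; but then w = 0 and its potential energy is 0. *)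
have [w0|wn0] := eqVneq (mass w) 0.
  rewrite w0 mul0r mul0r add0r expr0n muln_eq0/= -[m == 0%N]negbK -lt0n m1/= subr0 mulr1.
  rewrite energy_dirichlet// lerBrDr gerDl.
  under eq_Int do rewrite (mass_eq0 cw (sobolevH_L2 hw) w0) F0.
  by rewrite Rintegral_cst// mul0r.
have W0 : 0 < mass w by rewrite lt_def wn0 mass_ge0.
have s0 : 0 < mass w / rho by rewrite divr_gt0.
have rn0 : rho != 0 by rewrite gt_eqF.
have := hc _ (@affine_comp_continuous (mass w / rho) 0 w cw) (sobolevH_affine 0 s0 hw).
have e1 : (mass w / rho)^-1 * mass w = rho by field; rewrite rn0 wn0.
rewrite (mass_affine 0 s0 hw) (energy_affine 0 s0 cw hw) e1.
move=> /(_ (lexx _)); rewrite energy_dirichlet//; set s := mass w / rho in s0 *.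
rewrite ler_pdivlMl//; lra.
Qed.

(** At the critical exponent, Gagliardo-Nirenberg is linear in the kinetic energy, so the critical
    part of F only lowers the coefficient 1/2; the quadratic part is bounded by the mass. *)
Lemma energy_coercive rho C s' v : 0 <= C -> 0 <= s' ->
  (forall s, F s <= C * s ^+ 2 + s' * s ^+ (2 + 4 * m)) ->
  continuous v -> sobolevH m v -> mass v <= rho ->
  (1 / 2 - s' * (GN_constant m ((2 + 4 * m)%:R : R) ^+ (2 + 4 * m) * rho ^+ (2 * m))) *
    dirichlet v - C * rho <= energy m F v.
Proof.
move=> C0 s0 hF cv hv vr; have hg := sobolevH_weak_deriv hv.
have [_ iv] := sobolevH_L2 hv; have ip := integR_pow m1 cv hv hg.
have gn := GN_constant_le m1 hv hg.
set G := GN_constant _ _ ^+ _ in gn *.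
have G0 : 0 <= G.
  by rewrite /G expr_even_split mulr_ge0 ?sqr_ge0// exprn_ge0// sqr_ge0.
rewrite energy_dirichlet//.
have : \int[mu]_x F (v x) <= C * mass v + s' * \int[mu]_x (v x ^+ (2 + 4 * m)).
  rewrite -(IntZ _ iv) -(IntZ _ ip) -IntD; [|exact: integRZ..].
  apply: le_Int => //; first exact: integR_F.
  by apply: integRD; exact: integRZ.
have h1 : C * mass v <= C * rho by rewrite ler_wpM2l.
have h2 : s' * \int[mu]_x (v x ^+ (2 + 4 * m)) <= s' * (G * rho ^+ (2 * m)) * dirichlet v.
  rewrite -mulrA ler_wpM2l//; apply: (le_trans gn).
  rewrite -/(dirichlet v) -/(mass v) mulrAC ler_wpM2r ?dirichlet_ge0// ler_wpM2l//.
  apply: lerXn2r; rewrite ?nnegrE ?mass_ge0//.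
  by rewrite (le_trans _ vr)// mass_ge0.
lra.
Qed.

(* A fixed test function phi, multiplied by a small e and dilated to mass rho. *)
Lemma energy_negative rho : 0 < rho ->
  (forall L : R, exists2 d : R, 0 < d & forall s, `|s| <= d -> L * s ^+ (2 + 4 * m) <= F s) ->
  exists v, [/\ continuous v, sobolevH m v, mass v = rho & energy m F v < 0].
Proof.
(* Any nonzero test function would do; this one is nonzero because its integral is 1. *)
move=> r0 hL; pose phi := derive1 (@stepn R 0 0).
have tp : test_function phi by exact: test_derive1_stepn.
have cp := test_function_continuous tp.
have hp : sobolevH m phi by exact: sobolevH_test.
have hg := sobolevH_weak_deriv hp.
have [x0 px0] : exists x, phi x != 0.
  apply: contrapT => /forallNP h; have := Int_derive1_stepn (R := R) 0 0.
  rewrite (@eq_Int _ _ (fun=> 0)) ?Rintegral_cst//=.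
    by rewrite mul0r => /eqP; rewrite eq_sym oner_eq0.
  by move=> x; apply/eqP/negPn/negP; exact: h.
have b0 : 0 < mass phi by apply: mass_gt0 px0 => //; exact: sobolevH_L2 hp.
have ip := integR_pow m1 cp hp hg.
have p0 y : 0 <= phi y ^+ (2 + 4 * m).
  by rewrite expr_even_split mulr_ge0 ?sqr_ge0// exprn_ge0// sqr_ge0.
pose B := \int[mu]_x (phi x ^+ (2 + 4 * m)).
have B0 : 0 < B.
  rewrite lt_def Int_ge0// andbT; apply: contra px0 => /eqP h.
  have hz := Int_eq0 ip p0 h; apply/eqP.
  apply: continuous_ae0 => //.
  by apply: ae_imp hz => y /eqP; rewrite expf_eq0 => /andP[_ /eqP].
set a := dirichlet phi; set b := mass phi in b0.
(* After multiplication by e and dilation by s = e^2 b / rho, the kinetic term and the lower bound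
   on the potential term both carry e^(2+4m); this L makes their difference exactly e^(2+4m). *)
pose L := (1 / 2 * (b / rho) ^+ (2 * m) * a + 1) / B.
have [d d0 hd] := hL L.
have [T T0 hT] := test_function_bounded tp.
pose e := d / T.
have e0 : 0 < e by rewrite divr_gt0.
have ce : continuous (fun x => e * phi x).
  by move=> x; apply: cvgM; [exact: cvg_cst|exact: cp].
have he : sobolevH m (fun x => e * phi x) by exact: sobolevHZ.
pose s := e ^+ 2 * b / rho.
have s0 : 0 < s by rewrite divr_gt0// mulr_gt0// exprn_gt0.
have [_ iphi] := sobolevH_L2 hp.
have me : mass (fun x => e * phi x) = e ^+ 2 * b.
  by rewrite /mass; under eq_Int do rewrite exprMn; rewrite IntZ.
have De : dirichlet (fun x => e * phi x) = e ^+ 2 * a.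
  rewrite (dirichletE (wdZ e hg)); under eq_Int do rewrite exprMn.
  by rewrite IntZ//; case: hg => _ [].
exists (fun x => e * phi (s * x + 0)); split.
- by move=> x; exact: (@affine_comp_continuous s 0 _ ce x).
- exact: (sobolevH_affine 0 s0 he).
- rewrite (mass_affine 0 s0 he) me /s invf_div -mulrA mulVf ?mulr1//.
  by rewrite mulf_neq0 ?expf_neq0// gt_eqF.
- rewrite (energy_affine 0 s0 ce he) De pmulr_rlt0 ?invr_gt0// subr_lt0.
  have h : L * e ^+ (2 + 4 * m) * B <= \int[mu]_x F (e * phi x).
    rewrite -(IntZ _ ip); apply: le_Int; [exact: integRZ|exact: integR_F|].
    move=> x; rewrite -mulrA -exprMn; apply: hd.
    by rewrite normrM gtr0_norm// /e mulrAC ler_pdivrMr// ler_wpM2l// ltW.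
  apply: lt_le_trans h; rewrite /L /s.
  have Bn0 : B != 0 by rewrite gt_eqF.
  have rn0 : rho != 0 by rewrite gt_eqF.
  rewrite (_ : (_ / B) * _ * B = (1 / 2 * (b / rho) ^+ (2 * m) * a + 1) * e ^+ (2 + 4 * m));
    last by field.
  rewrite -[e ^+ 2 * b / rho]mulrA exprMn -exprM (_ : 2 * (2 * m) = 4 * m)%N; last by rewrite mulnA.
  rewrite exprD; have e40 : 0 < e ^+ 2 * e ^+ (4 * m) by rewrite mulr_gt0 ?exprn_gt0.
  rewrite -subr_gt0 (_ : _ - _ = e ^+ 2 * e ^+ (4 * m))//.
  by field.
Qed.

End energy_functional.

(** * Existence of a minimizer *)

Section existence.
Context {R : realType} (m : nat).
Context (m1 : (1 <= m)%N).
Implicit Types (u v w g : R -> R) (s h rho : R).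
Local Notation mu := (@lebesgue_measure R).

Lemma cvgn_le (a : nat -> R) (l M : R) : a n @[n --> \oo] --> l ->
  (forall n, a n <= M) -> l <= M.
Proof. by move=> h hM; apply: (ler_cvg_to h (cvg_cst M)); exact: nearW. Qed.

Lemma cvgn_norm (a : nat -> R) (l : R) : a n @[n --> \oo] --> l ->
  `|a n| @[n --> \oo] --> `|l|.
Proof. by move=> h; exact: (cvg_norm h). Qed.

Lemma inv_nat_small (e : R) : 0 < e -> exists N, forall n, (N <= n)%N -> n.+1%:R^-1 <= e.
Proof.
move=> e0; have [N hN] := cvgn_dist (@cvg_harmonic R) e0; exists N => n /hN.
by rewrite sub0r normrN ger0_norm.
Qed.

Lemma sobolev_holder v : continuous v -> sobolevH m v -> forall x y,
  (v x - v y) ^+ 2 <= (mass v + dirichlet m v) * `|x - y|.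
Proof.
move=> cv hv.
have /sobolevHP[_ hk] := hv; have [g1 hg1] := hk _ m1.
have := sobolev_interpolation hv (sobolevH_weak_deriv hv) m1 hg1.
rewrite -/(mass v) -/(dirichlet m v) => G.
have L1 := let: And3 _ a _ := hg1 in a.
have lem x y : x <= y -> (v y - v x) ^+ 2 <= (mass v + dirichlet m v) * (y - x).
  move=> xy; rewrite (wd1_increment cv hg1 xy).
  apply: (le_trans (sqr_Int_itv_le L1 xy)).
  by rewrite mulrC ler_wpM2r// subr_ge0.
move=> x y; have [xy|yx] := leP x y.
  by rewrite -sqrrN opprB distrC ger0_norm ?subr_ge0//; exact: lem.
by rewrite ger0_norm ?subr_ge0 ?(ltW yx)//; apply: lem; exact: ltW.
Qed.

(** The last conclusion is the only trace of weak convergence of the m-th derivatives; it makes the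
    cross term of the kinetic splitting large enough. *)
Lemma bounded_sobolev_limit (u : nat -> R -> R) (rho A : R) :
  (forall n, continuous (u n)) -> (forall n, sobolevH m (u n)) ->
  (forall n, mass (u n) <= rho) -> (forall n, dirichlet m (u n) <= A) ->
  exists (s : nat -> nat) v, [/\ (forall n, (n <= s n)%N),
    (forall x, u (s n) x @[n --> \oo] --> v x),
    continuous v, sobolevH m v &
    forall e N, 0 < e -> exists2 n, (N <= n)%N &
      dirichlet m v - e <= \int[mu]_x (weak_deriv m (u (s n)) x * weak_deriv m v x)].
Proof.
move=> cu hu mu_ Au.
pose M := 1 + 4 * (rho + A).
have uM n x : `|u n x| <= M.
  by apply: (le_trans (sobolev_le m1 (cu n) (hu n) x)); rewrite lerD2l ler_wpM2l// lerD.
have uK n x y : (u n x - u n y) ^+ 2 <= (rho + A) * `|x - y|.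
  by apply: (le_trans (sobolev_holder (cu n) (hu n) x y)); rewrite ler_wpM2r// lerD.
have [s [v [sn cv]]] := holder_extraction uM uK.
have muv : measurable_fun setT v.
  by apply: (lim_meas (f_ := fun n => u (s n))) => // n; exact: continuous_meas.
have vM x : `|v x| <= M.
  exact: (cvgn_le (cvgn_norm (cv x)) (fun n => uM (s n) x)).
have fv : integR (fun x => v x ^+ 2) /\ \int[mu]_x (v x ^+ 2) <= rho.
  apply: (@fatouR _ (fun n x => u (s n) x ^+ 2)).
  - by move=> n; case: (sobolevH_L2 (hu (s n))).
  - exact: measurable_funX.
  - by move=> n x; exact: sqr_ge0.
  - by apply: aeW => x; apply: cvgM; exact: cv.
  - by move=> n; exact: mu_.
have hv : L2 v by split=> //; case: fv.
have lim_test k phi : test_function phi ->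
    \int[mu]_x (u (s n) x * derive1n k phi x) @[n --> \oo] -->
    \int[mu]_x (v x * derive1n k phi x).
  move=> tp; have tk := test_function_derive1n k tp.
  have mk := continuous_meas (test_function_continuous tk).
  apply: (@dct _ _ _ (fun x => M * `|derive1n k phi x|) _ _ _ _ _).2.
  - by move=> n; apply: measurable_funM => //; exact: continuous_meas.
  - exact: measurable_funM.
  - by apply: aeW => x; apply: cvgM; [exact: cv|exact: cvg_cst].
  - by apply: integRZ; apply: integR_norm; exact: integR_test.
  - by move=> n x; rewrite normrM ler_wpM2r.
(* Pairings with test functions converge by dominated convergence of the functions themselves, and
   this identifies the weak limit of the k-th derivatives as a derivative of [v]. *)
have wk k : (k <= m)%N -> exists g, wd k v g /\
    forall e N, 0 < e -> exists2 n, (N <= n)%N &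
      \int[mu]_x (g x ^+ 2) - e <= \int[mu]_x (weak_deriv k (u (s n)) x * g x).
  move=> km.
  have wn n : wd k (u (s n)) (weak_deriv k (u (s n))).
    by have /sobolevHP[_ hk] := hu (s n); have [g /weak_derivE[]] := hk _ km.
  have wL n : L2 (weak_deriv k (u (s n))) by case: (wn n).
  have wB n : \int[mu]_x (weak_deriv k (u (s n)) x ^+ 2) <= rho + A.
    apply: (le_trans (sobolev_interpolation (hu (s n)) (sobolevH_weak_deriv (hu (s n))) km (wn n))).
    by rewrite lerD// ?mu_//; exact: Au.
  have [g [hg hg1 hg2]] := weak_limit wL wB.
  exists g; split=> //; apply: wdI => // phi tp.
  have := lim_test k _ tp.
  rewrite (_ : (fun n => _) = fun n => (-1) ^+ k *
      \int[mu]_x (weak_deriv k (u (s n)) x * phi x)); last first.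
    by apply/funext => n; have [_ _ [_ _ ->]] := wn n.
  move=> h.
  have h2 : \int[mu]_x (weak_deriv k (u (s n)) x * phi x) @[n --> \oo] -->
      (-1) ^+ k * \int[mu]_x (v x * derive1n k phi x).
    rewrite (_ : (fun n => _) = fun n => (-1) ^+ k * ((-1) ^+ k *
        \int[mu]_x (weak_deriv k (u (s n)) x * phi x))); last first.
      by apply/funext => n; rewrite mulrA -exprMn mulrNN mul1r expr1n mul1r.
    by apply: cvgM; [exact: cvg_cst|exact: h].
  by rewrite (hg1 _ _ (L2_test tp) h2) mulrA -exprMn mulrNN mul1r expr1n mul1r.
have hvm : sobolevH m v.
  by apply/sobolevHP; split=> // k /wk [g [hg _]]; exists g.
exists s, v; split=> //.
- move=> x; apply/cvgrPdist_le => e e0.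
  have rA : 0 < rho + A + 1.
    have := uK 0 0 1; rewrite sub0r normrN normr1 mulr1.
    by move/(le_trans (sqr_ge0 _)) => h; rewrite ltr_wpDl.
  have d0 : 0 < e ^+ 2 / (rho + A + 1) by rewrite divr_gt0// exprn_gt0.
  near=> y.
  have hxy : (v x - v y) ^+ 2 <= (rho + A) * `|x - y|.
    have h : (u (s n) x - u (s n) y) ^+ 2 @[n --> \oo] --> (v x - v y) ^+ 2.
      by apply: cvgM; apply: cvgB; exact: cv.
    by apply: (cvgn_le h) => n; exact: uK.
  have hd : `|x - y| <= e ^+ 2 / (rho + A + 1).
    by near: y; apply: cvgr_dist_le => //; exact: cvg_id.
  rewrite -(@ler_pXn2r _ 2)// ?nnegrE ?(ltW e0)// real_normK ?num_real//.
  rewrite ler_pdivlMr// in hd; apply: (le_trans hxy); apply: le_trans hd.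
  by rewrite mulrC ler_wpM2l// lerDl.
- move=> e N e0; have [g [hg hn]] := wk _ (leqnn m).
  have [n Nn h] := hn e N e0; exists n => //.
  rewrite (dirichletE hg); apply: (le_trans h); rewrite le_eqVlt; apply/orP; left; apply/eqP.
  have [hw ew] := weak_derivE hg.
  have [_ [a _] _] := hw; have [_ [b _] _] := hg.
  have [_ [c _] _] := sobolevH_weak_deriv (hu (s n)).
  apply: ae_Int; [exact: measurable_funM..|].
  by apply: ae_imp ew => x ->.
Unshelve. all: by end_near. Qed.

Context (F : R -> R) (cF : continuous F).
Context (Fn : forall M : R, exists2 K : R, 0 <= K &
  (forall s, `|s| <= M -> `|F s| <= K * s ^+ 2) /\
  (forall a b, `|a| <= M -> `|b| <= M -> `|a + b| <= M ->
    `|F (a + b) - F a - F b| <= K * (a ^+ 2 + `|a| * `|b|))).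
Context (Fs : forall e : R, 0 < e -> exists2 d : R, 0 < d &
  forall s, `|s| <= d -> `|F s| <= e * s ^+ 2).

Let Fq (M : R) : exists2 K : R, 0 <= K & forall s, `|s| <= M -> `|F s| <= K * s ^+ 2.
Proof. by have [K K0 [hK _]] := Fn M; exists K. Qed.

Lemma nonvanishing rho (c : R) : 0 < rho -> c < 0 -> exists2 d : R, 0 < d &
  forall v, continuous v -> sobolevH m v -> mass v <= rho -> energy m F v <= c ->
    exists y, d < `|v y|.
Proof.
move=> r0 c0.
(* If |v| <= d everywhere, then the integral of F(v) is at most - c / 2, so J(v) >= c / 2 > c. *)
have e0 : 0 < - c / (2 * rho) by rewrite divr_gt0 ?oppr_gt0// mulr_gt0.
have [d d0 hd] := Fs e0; exists d => // v cv hv vr vc.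
apply: contrapT => /forallNP h.
have iF := integR_F m1 cF Fq cv hv.
have [_ iv] := sobolevH_L2 hv.
have : \int[mu]_x F (v x) <= - c / (2 * rho) * mass v.
  rewrite -(IntZ _ iv); apply: le_Int => //; first exact: integRZ.
  move=> x; apply: (le_trans (ler_norm _)); apply: hd.
  by rewrite leNgt; apply/negP; exact: h.
have : - c / (2 * rho) * mass v <= - c / 2.
  rewrite (_ : - c / 2 = - c / (2 * rho) * rho); last by field; rewrite gt_eqF.
  by rewrite ler_wpM2l// ltW.
move: vc; rewrite (energy_dirichlet m1 cF Fq cv hv).
have := dirichlet_ge0 m v; lra.
Qed.

Lemma brezis_lieb_splitting (u : nat -> R -> R) v (rho A : R) :
  (forall n, continuous (u n)) -> (forall n, sobolevH m (u n)) ->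
  (forall n, mass (u n) <= rho) -> (forall n, dirichlet m (u n) <= A) ->
  continuous v -> sobolevH m v -> (forall x, u n x @[n --> \oo] --> v x) ->
  forall e : R, 0 < e -> exists N, forall n, (N <= n)%N ->
    `|\int[mu]_x F (u n x) - \int[mu]_x F (v x) - \int[mu]_x F (u n x - v x)| <= e /\
    `|mass (u n) - mass v - mass (fun x => u n x - v x)| <= e.
Proof.
move=> cu hu mu_ Au cv hv uv.
pose M0 := 1 + 4 * (rho + A).
have uM n x : `|u n x| <= M0.
  by apply: (le_trans (sobolev_le m1 (cu n) (hu n) x)); rewrite lerD2l ler_wpM2l// lerD.
have vM x : `|v x| <= M0.
  exact: (cvgn_le (cvgn_norm (uv x)) (fun n => uM n x)).
pose M := M0 + M0.
have M00 : 0 <= M0 by apply: le_trans (vM 0).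
have vM' x : `|v x| <= M by rewrite (le_trans (vM x))// lerDl.
pose w n x := u n x - v x.
have hw n : L2 (w n) by exact: (L2B (sobolevH_L2 (hu n)) (sobolevH_L2 hv)).
have wM n x : `|w n x| <= M by apply: (le_trans (ler_normB _ _)); exact: lerD.
have wB n : \int[mu]_x (w n x ^+ 2) <= 2 * rho + 2 * mass v.
  have [_ iu] := sobolevH_L2 (hu n); have [_ iv] := sobolevH_L2 hv.
  apply: (@le_trans _ _ (\int[mu]_x (2 * u n x ^+ 2 + 2 * v x ^+ 2))).
    apply: le_Int; [by case: (hw n)|by apply: integRD; exact: integRZ|].
    by move=> x; have := sqr_ge0 (u n x + v x); rewrite /w; lra.
  rewrite (IntD (integRZ _ iu) (integRZ _ iv)) (IntZ _ iu) (IntZ _ iv) lerD2r.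
  by rewrite ler_wpM2l//; exact: mu_.
have w0 x : w n x @[n --> \oo] --> (0 : R).
  by rewrite -(subrr (v x)); apply: cvgB; [exact: uv|exact: cvg_cst].
have hvL := sobolevH_L2 hv.
have e_ n x : v x + w n x = u n x by rewrite /w addrC subrK.
have [K K0 [K1 K2]] := Fn (M + M).
have M0' : 0 <= M by rewrite addr_ge0.
have MM (a : R) : `|a| <= M -> `|a| <= M + M by move=> /le_trans; apply; rewrite lerDl.
have bF := @brezis_lieb _ F v w K M _ K0 cF hvL vM' hw wM wB w0 K1.
have {}bF := bF (fun a b ha hb => K2 a b (MM a ha) (MM b hb)
   (le_trans (ler_normD a b) (lerD ha hb))).
(* The splitting of the mass is the same lemma for the square, where (a + b)^2 - a^2 - b^2 = 2 a
   b. *)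
have bm := @brezis_lieb _ (fun x => x ^+ 2) v w 2 M _ (ler0n R 2) (@continuous_expn R 2)
  hvL vM' hw wM wB w0.
have {}bm := bm (fun a _ => ltac:(by rewrite ger0_norm ?sqr_ge0// ler_peMl ?sqr_ge0// ler1n)).
have {}bm := bm (fun a b _ _ => ltac:(
  by rewrite (_ : (a + b) ^+ 2 - a ^+ 2 - b ^+ 2 = 2 * (a * b)); [|ring];
     rewrite !normrM ger0_norm// ler_wpM2l// lerDr sqr_ge0)).
move=> e e0; have [N1 _ h1] := bF e e0; have [N2 _ h2] := bm e e0.
exists (maxn N1 N2) => n; rewrite geq_max => /andP[n1 n2].
split; first by have := h1 n n1; rewrite /=; under eq_Int do rewrite e_.
by have := h2 n n2; rewrite /=; under eq_Int do rewrite e_.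
Qed.

Lemma mass_remainder_le (a b c r e : R) : `|a - b - c| <= e -> a <= r -> c <= r - b + e.
Proof. by rewrite ler_norml => /andP[h1 h2] h3; lra. Qed.

(** The linear arithmetic of the splitting: [Du], [Dv], [Dw] are the kinetic and [I2], [I3], [I4]
    the potential integrals of u_n, the limit and the remainder. The three errors e come from the
    cross term [Xi], from u_n being almost minimizing, and from Brezis-Lieb. *)
Lemma energy_splitting_le (c Du Dv Dw Xi I2 I3 I4 k e Y Z X : R) :
  Z + 1 / 2 * X * Dw <= 1 / 2 * Dw - I4 -> 0 <= X * Dw -> Y <= Z ->
  Dw = Du + Dv - 2 * Xi -> Dv - e <= Xi -> 1 / 2 * Du - I2 <= c + k -> k <= e ->
  `|I2 - I3 - I4| <= e -> 1 / 2 * Dv - I3 <= c + 3 * e - Y.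
Proof.
rewrite ler_norml -[1 / 2 * X * Dw]mulrA; set XD := X * Dw.
by move=> h4 h5 h6 h7 h8 h9 h10 /andP[h11 h12]; lra.
Qed.

Lemma minimizer_exists rho c theta C : 0 < rho -> c < 0 -> 0 < theta ->
  (forall v, continuous v -> sobolevH m v -> mass v <= rho ->
     theta * dirichlet m v - C <= energy m F v) ->
  (forall v, continuous v -> sobolevH m v -> mass v <= rho -> c <= energy m F v) ->
  (forall e, 0 < e -> exists v, [/\ continuous v, sobolevH m v, mass v <= rho &
     energy m F v <= c + e]) ->
  exists u, [/\ continuous u, sobolevH m u, mass u = rho & energy m F u <= c].
Proof.
move=> r0 c0 t0 coer hc hinf.
have c2 : c / 2 < 0 by rewrite pmulr_llt0// invr_gt0.
have [d d0 hd] := nonvanishing r0 c2.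
have /choice [u0 hu0] : forall n : nat, exists v, [/\ continuous v, sobolevH m v, mass v <= rho &
     energy m F v <= c + n.+1%:R^-1 /\ d < `|v 0|].
  (* The second bound gives energy at most c / 2, so that [nonvanishing] applies; the translation by
     y then brings a point with |v| > d to 0. *)
  move=> n; pose e := Num.min (n.+1%:R^-1) (- c / 2).
  have e0 : 0 < e by rewrite lt_min invr_gt0 ltr0Sn divr_gt0// oppr_gt0.
  have [v [v1 v2 v3 v4]] := hinf e e0.
  have ec : e <= - c / 2 by rewrite ge_min lexx orbT.
  have en : e <= n.+1%:R^-1 by rewrite ge_min lexx.
  have v5 : energy m F v <= c / 2 by lra.
  have [y hy] := hd v v1 v2 v3 v5.
  exists (fun x => v (1 * x + y)); split.
  - move=> x; exact: (@affine_comp_continuous _ 1 y v v1 x).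
  - exact: (sobolevH_affine y ltr01 v2).
  - by rewrite (mass_affine y ltr01 v2) invr1 mul1r.
  - split; last by rewrite mulr0 add0r.
    rewrite (energy_affine m1 cF Fq y ltr01 v1 v2) invr1 mul1r expr1n mulr1.
    by rewrite -energy_dirichlet// (le_trans v4)// lerD2l.
have cu0 n : continuous (u0 n) by case: (hu0 n).
have su0 n : sobolevH m (u0 n) by case: (hu0 n).
have mu0 n : mass (u0 n) <= rho by case: (hu0 n).
have ju0 n : energy m F (u0 n) <= c + n.+1%:R^-1 by case: (hu0 n) => _ _ _ [].
have du0 n : d < `|u0 n 0| by case: (hu0 n) => _ _ _ [].
pose A := (c + 1 + C) / theta.
have Au0 n : dirichlet m (u0 n) <= A.
  rewrite ler_pdivlMr// mulrC -lerBlDr; apply: (le_trans (coer _ (cu0 n) (su0 n) (mu0 n))).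
  by apply: (le_trans (ju0 n)); rewrite lerD2l inv_nat_le1.
have [s [v [sn uv cv hv weak]]] := bounded_sobolev_limit cu0 su0 mu0 Au0.
have vM : d <= `|v 0|.
  rewrite -lerN2; apply: (cvgn_le (a := fun n => - `|u0 (s n) 0|)).
    by apply: cvgN; exact: (cvgn_norm (uv 0)).
  by move=> n; rewrite lerN2 ltW.
have v0 : v 0 != 0 by rewrite -normr_gt0 (lt_le_trans d0).
have mv0 := mass_gt0 cv (sobolevH_L2 hv) v0.
have dv0 := dirichlet_gt0 m1 cv hv v0.
have split_ := @brezis_lieb_splitting (fun n => u0 (s n)) v rho A (fun n => cu0 (s n))
  (fun n => su0 (s n)) (fun n => mu0 (s n)) (fun n => Au0 (s n)) cv hv uv.
(* The restriction e <= mass v keeps the remainder in the ball, since its mass is at most rho - mass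
   v + e; hence [energy_scaling] applies to it. *)
have key (e : R) : 0 < e -> e <= mass v ->
    mass v <= rho + e /\ energy m F v <= c * (mass v / rho) + 3 * e - e * c / rho.
  move=> e0 ev; have [N hN] := split_ e e0.
  have [N' hN'] := inv_nat_small e0.
  have [n] := weak e (maxn N N') e0; rewrite geq_max => /andP[nN nN'] hweak.
  have [h1 h2] := hN n nN.
  pose w x := u0 (s n) x - v x.
  have cw : continuous w by move=> x; apply: cvgB; [exact: cu0|exact: cv].
  have hw : sobolevH m w by exact: sobolevHB.
  have wdw := wdB (sobolevH_weak_deriv (su0 (s n))) (sobolevH_weak_deriv hv).
  have L1 := let: And3 _ a _ := sobolevH_weak_deriv (su0 (s n)) in a.
  have L2_ := let: And3 _ a _ := sobolevH_weak_deriv hv in a.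
  have Dw : dirichlet m w = dirichlet m (u0 (s n)) + dirichlet m v -
      2 * \int[mu]_x (weak_deriv m (u0 (s n)) x * weak_deriv m v x).
    rewrite (dirichletE wdw).
    have := Int_sqrD (-1) L1 L2_.
    rewrite (@eq_Int _ _ (fun x => (weak_deriv m (u0 (s n)) x - weak_deriv m v x) ^+ 2)).
      have aux (a b i : R) : a + 2 * -1 * i + (-1) ^+ 2 * b = a + b - 2 * i by ring.
      by move=> ->; exact: aux.
    by move=> x; rewrite mulN1r.
  have mwr : mass w <= rho - mass v + e := mass_remainder_le h2 (mu0 (s n)).
  have h3 : `|\int[mu]_x F (u0 (s n) x) - \int[mu]_x F (v x) - \int[mu]_x F (w x)| <= e := h1.
  have mw0 := mass_ge0 w.
  have wr : mass w <= rho by rewrite (le_trans mwr)// -addrA gerDl addrC subr_le0.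
  split; first by rewrite -subr_ge0; have := le_trans mw0 mwr; rewrite addrAC.
  have hs := energy_scaling m1 cF Fq r0 hc cw hw wr.
  have q0 : 0 <= (1 - (mass w / rho) ^+ (2 * m)) * dirichlet m w.
    rewrite mulr_ge0 ?dirichlet_ge0// subr_ge0 exprn_ile1//.
      by rewrite divr_ge0// ltW.
    by rewrite ler_pdivrMr// mul1r.
  have q1 : (rho - mass v + e) / rho * c <= mass w / rho * c.
    by rewrite ler_wnM2r ?(ltW c0)// ler_wpM2r// invr_ge0 ltW.
  have hu1 := ju0 (s n); rewrite (energy_dirichlet m1 cF Fq (cu0 _) (su0 _)) in hu1.
  have sn1 : (s n).+1%:R^-1 <= e by apply: hN'; exact: leq_trans (sn n).
  have -> : c * (mass v / rho) + 3 * e - e * c / rho =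
      c + 3 * e - (rho - mass v + e) / rho * c by field; rewrite gt_eqF.
  rewrite (energy_dirichlet m1 cF Fq cw hw) in hs.
  rewrite (energy_dirichlet m1 cF Fq cv hv).
  exact: energy_splitting_le hs q0 q1 Dw hweak hu1 sn1 h3.
have mvr : mass v <= rho.
  apply/ler_addgt0Pr => e e0.
  have e10 : 0 < Num.min e (mass v) by rewrite lt_min e0.
  have [h _] := key _ e10 (ltac:(by rewrite ge_min lexx orbT)).
  by apply: (le_trans h); rewrite lerD2l ge_min lexx.
have Jv : energy m F v <= c * (mass v / rho).
  apply/ler_addgt0Pr => e e0.
  have k0 : 0 < 3 - c / rho.
    by rewrite ltr_wpDr// -mulNr divr_ge0 ?ltW// oppr_gt0.
  have ek : 0 < e / (3 - c / rho) by rewrite divr_gt0.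
  have e10 : 0 < Num.min (e / (3 - c / rho)) (mass v) by rewrite lt_min ek.
  have [_ h] := key _ e10 (ltac:(by rewrite ge_min lexx orbT)).
  apply: (le_trans h); rewrite -addrA lerD2l.
  rewrite (_ : _ - _ = Num.min (e / (3 - c / rho)) (mass v) * (3 - c / rho)); last first.
    by field; rewrite gt_eqF.
  by rewrite -ler_pdivlMr// ge_min lexx.
(* A mass below rho would make the kinetic surplus strictly positive, against [Jv]. *)
have := energy_scaling m1 cF Fq r0 hc cv hv mvr.
have [vr|vr] := ltP (mass v) rho; last first.
  have e : mass v = rho by apply/eqP; rewrite eq_le mvr.
  move=> _; exists v; split => //.
  by apply: (le_trans Jv); rewrite e divff ?mulr1// gt_eqF.
have h : 0 < 1 / 2 * (1 - (mass v / rho) ^+ (2 * m)) * dirichlet m v.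
  rewrite mulr_gt0// mulr_gt0// subr_gt0 exprn_ilt1//.
  - by rewrite muln_eq0/= -lt0n.
  - by rewrite divr_ge0// ltW.
  - by rewrite ltr_pdivrMr// mul1r.
move=> /le_trans /(_ Jv); rewrite [c * _]mulrC gerDl => h'.
by have := lt_le_trans h h'; rewrite ltxx.
Qed.

End existence.

(** * The Lagrange multiplier *)

(** The algebra of the difference quotients is kept apart from the integrals; [N] stands for the
    inverse n + 1 of the increment. *)
Lemma quadratic_difference_quotient (R : realType) (N I D Du A B : R) : N != 0 ->
  N * (1 / 2 * (Du + 2 * N^-1 * I + N^-1 ^+ 2 * D) - A - (1 / 2 * Du - B)) =
  I + N^-1 * (1 / 2 * D) - N * (A - B).
Proof. by move=> N0; field. Qed.

Lemma square_difference_quotient (R : realType) (N c : R) : N != 0 ->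
  - (2 * c) + N^-1 * c = N * ((1 - N^-1) ^+ 2 * c - c).
Proof. by move=> N0; field. Qed.

Lemma affine_difference (R : realType) (a b c d t : R) :
  a + t * b - (c + t * d) = a - c + t * (b - d).
Proof. by ring. Qed.

Section euler_lagrange.
Context {R : realType} (m : nat) (F : R -> R).
Context (m1 : (1 <= m)%N) (dF : forall s, derivable F s 1) (cF' : continuous (derive1 F)).
Context (Fn : forall M : R, exists2 K : R, 0 <= K &
  (forall s, `|s| <= M -> `|F s| <= K * s ^+ 2) /\
  (forall a b, `|a| <= M -> `|b| <= M -> `|a + b| <= M ->
    `|F (a + b) - F a - F b| <= K * (a ^+ 2 + `|a| * `|b|)) /\
  (forall s, `|s| <= M -> `|derive1 F s| <= K * `|s|) /\
  (forall s t, `|s| <= M -> `|t| <= M -> `|F s - F t| <= K * (`|s| + `|t|) * `|s - t|)).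
Implicit Types (u v w g : R -> R) (s h rho : R).
Local Notation mu := (@lebesgue_measure R).

Let cF : continuous F := derivable_continuous dF.

Let Fq (M : R) : exists2 K : R, 0 <= K & forall s, `|s| <= M -> `|F s| <= K * s ^+ 2.
Proof. by have [K K0 [hK _]] := Fn M; exists K. Qed.

Lemma L2_derive1_comp u : continuous u -> sobolevH m u -> L2 (fun x => derive1 F (u x)).
Proof.
move=> cu hu; have hM := sobolev_le m1 cu hu; set M := 1 + _ in hM.
have [K K0 [_ [_ [hK _]]]] := Fn M.
have mu_ := continuous_meas cu.
apply: (L2_dom (g := fun x => K * u x)); last by apply: L2Z; exact: sobolevH_L2 hu.
  by apply: measurableT_comp => //; exact: continuous_meas.
by move=> x; rewrite normrM ger0_norm//; exact: hK.
Qed.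

Lemma is_derive_seq (G : R -> R) (d : R) : is_derive (0 : R) (1 : R) G d ->
  n.+1%:R * (G (n.+1%:R^-1) - G 0) @[n --> \oo] --> d.
Proof.
move=> [hd <-]; have : h^-1 *: (G (h *: (1 : R) + 0) - G 0) @[h --> (0 : R)^'] --> 'D_1 G 0.
  exact: hd.
move=> /cvgrPdist_le hc; apply/cvgrPdist_le => e e0.
have [t t0 ht] := dnbhs0P (hc e e0).
have [N hN] := inv_nat_small t0; exists N => // n /hN hn.
have := ht (n.+1%:R^-1); rewrite addr0 /GRing.scale/= mulr1 invrK; apply.
  by rewrite ger0_norm.
by rewrite invr_neq0// pnatr_eq0.
Qed.

Lemma sobolevHDZ u v (t : R) : sobolevH m u -> sobolevH m v ->
  sobolevH m (fun x => u x + t * v x).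
Proof. by move=> hu hv; apply: sobolevHD => //; exact: sobolevHZ. Qed.

Lemma continuousDZ u v (t : R) : continuous u -> continuous v ->
  continuous (fun x => u x + t * v x).
Proof.
move=> cu cv x; apply: cvgD; first exact: cu.
by apply: cvgM; [exact: cvg_cst|exact: cv].
Qed.

(** For increments at most 1, the Lipschitz bound dominates the quotients by K (2 |u| + |v|) |v|, a
    product of square integrable functions. *)
Lemma potential_gateaux u v : continuous u -> sobolevH m u -> continuous v -> sobolevH m v ->
  n.+1%:R * (\int[mu]_x F (u x + n.+1%:R^-1 * v x) - \int[mu]_x F (u x)) @[n --> \oo] -->
  \int[mu]_x (derive1 F (u x) * v x).
Proof.
move=> cu hu cv hv.
have uM := sobolev_le m1 cu hu; have vM := sobolev_le m1 cv hv.
move: (1 + _) uM => M1 uM; move: (1 + _) vM => M2 vM.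
have [K K0 [_ [_ [_ lip]]]] := Fn (M1 + M2).
have M10 : 0 <= M1 by apply: le_trans (uM 0).
have M20 : 0 <= M2 by apply: le_trans (vM 0).
have Lu := L2_norm (sobolevH_L2 hu); have Lv := L2_norm (sobolevH_L2 hv).
have ti n : (0 : R) <= n.+1%:R^-1 /\ (n.+1%:R^-1 : R) <= 1.
  by rewrite invr_ge0 ler0n; split=> //; exact: inv_nat_le1.
have cw n := @continuousDZ _ _ (n.+1%:R^-1) cu cv.
have iw n := integR_F m1 cF Fq (cw n) (sobolevHDZ (n.+1%:R^-1) hu hv).
have iu := integR_F m1 cF Fq cu hu.
have nn0 n : n.+1%:R != 0 :> R by rewrite pnatr_eq0.
rewrite (_ : (fun n => _) = fun n => \int[mu]_x (n.+1%:R *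
   (F (u x + n.+1%:R^-1 * v x) - F (u x)))); last first.
  by apply/funext => n; rewrite IntZ ?IntB//; exact: integRB.
have Lw : L2 (fun x => K * (2 * `|u x| + `|v x|)).
  by apply: L2Z; apply: L2D => //; exact: L2Z.
apply: (@dct _ _ _ (fun x => K * (2 * `|u x| + `|v x|) * `|v x|) _ _ _ _ _).2.
- by move=> n; apply: integR_meas; apply: integRZ; exact: integRB.
- apply: measurable_funM; last exact: continuous_meas.
  by case: (L2_derive1_comp cu hu).
- apply: aeW => x; rewrite mulrC.
  have hd : is_derive (v x * 0 + u x) (1 : R) F (derive1 F (v x * 0 + u x)).
    by rewrite derive1E; exact: derivableP.
  have := is_derive_seq (is_derive_affine hd); rewrite !mulr0 !add0r.
  rewrite (_ : (fun n => n.+1%:R * (F (v x * n.+1%:R^-1 + u x) - F (u x))) =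
               (fun n => n.+1%:R * (F (u x + n.+1%:R^-1 * v x) - F (u x)))) //.
  by apply/funext => n; rewrite [v x * _]mulrC [_ + u x]addrC.
- exact: L2_mul.
- move=> n x; have [t0 t1] := ti n; set t := n.+1%:R^-1 in t0 t1 *.
  have tv : `|t * v x| <= `|v x| by rewrite normrM ger0_norm// ler_piMl.
  have h1 : `|u x + t * v x| <= `|u x| + `|v x|.
    by apply: (le_trans (ler_normD _ _)); rewrite lerD2l.
  have h2 : `|u x + t * v x| <= M1 + M2 by rewrite (le_trans h1)// lerD.
  have h3 : `|u x| <= M1 + M2 by rewrite (le_trans (uM x))// lerDl.
  have := lip _ _ h2 h3; rewrite addrAC subrr add0r normrM [`|t|]ger0_norm// => h4.
  rewrite normrM ger0_norm//; apply: (@le_trans _ _ (n.+1%:R *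
    (K * (`|u x + t * v x| + `|u x|) * (t * `|v x|)))); first by rewrite ler_wpM2l.
  rewrite mulrCA [_ * (t * _)]mulrA /t mulfV// mul1r -/t.
  rewrite ler_wpM2r// ler_wpM2l//.
  by move: h1; set a := `|u x + _|; set b := `|u x|; set c := `|v x|; lra.
Qed.

(** The Gateaux derivative J'(u) v; it is reached along the increments 1/(n+1) only. *)
Definition energy_diff u v : R :=
  \int[mu]_x (weak_deriv m u x * weak_deriv m v x) - \int[mu]_x (derive1 F (u x) * v x).

Lemma wdDZ u v (t : R) : sobolevH m u -> sobolevH m v ->
  wd m (fun x => u x + t * v x) (fun x => weak_deriv m u x + t * weak_deriv m v x).
Proof.
move=> hu hv; have := wdZ t (sobolevH_weak_deriv hv).
exact: wdD (sobolevH_weak_deriv hu).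
Qed.

Lemma dirichletDZ u v (t : R) : sobolevH m u -> sobolevH m v ->
  dirichlet m (fun x => u x + t * v x) = dirichlet m u +
    2 * t * \int[mu]_x (weak_deriv m u x * weak_deriv m v x) + t ^+ 2 * dirichlet m v.
Proof.
move=> hu hv; rewrite (dirichletE (wdDZ t hu hv)) Int_sqrD//.
  by case: (sobolevH_weak_deriv hu).
by case: (sobolevH_weak_deriv hv).
Qed.

Lemma energy_gateaux u v : continuous u -> sobolevH m u -> continuous v -> sobolevH m v ->
  n.+1%:R * (energy m F (fun x => u x + n.+1%:R^-1 * v x) - energy m F u) @[n --> \oo] -->
  energy_diff u v.
Proof.
move=> cu hu cv hv.
set I := \int[mu]_x (weak_deriv m u x * weak_deriv m v x).
have E n : n.+1%:R * (energy m F (fun x => u x + n.+1%:R^-1 * v x) - energy m F u) =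
   I + n.+1%:R^-1 * (1 / 2 * dirichlet m v) -
   n.+1%:R * (\int[mu]_x F (u x + n.+1%:R^-1 * v x) - \int[mu]_x F (u x)).
  rewrite (energy_dirichlet m1 cF Fq cu hu).
  rewrite (energy_dirichlet m1 cF Fq (@continuousDZ _ _ _ cu cv) (sobolevHDZ _ hu hv)).
  rewrite dirichletDZ// -/I.
  by apply: quadratic_difference_quotient; rewrite pnatr_eq0.
rewrite (funext E) (_ : energy_diff u v = I + 0 - \int[mu]_x (derive1 F (u x) * v x));
  last by rewrite addr0.
apply: cvgB; last exact: potential_gateaux.
apply: cvgD; first exact: cvg_cst.
rewrite -(mul0r (1 / 2 * dirichlet m v)).
by apply: cvgM; [exact: cvg_harmonic|exact: cvg_cst].
Qed.

Lemma energy_diffDZ u v w (t : R) : continuous u -> sobolevH m u -> sobolevH m v ->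
  sobolevH m w -> energy_diff u (fun x => v x + t * w x) =
  energy_diff u v + t * energy_diff u w.
Proof.
move=> cu hu hv hw.
have Lu := let: And3 _ a _ := sobolevH_weak_deriv hu in a.
have Lv := let: And3 _ a _ := sobolevH_weak_deriv hv in a.
have Lw := let: And3 _ a _ := sobolevH_weak_deriv hw in a.
have Lf := L2_derive1_comp cu hu.
have v2 := sobolevH_L2 hv; have w2 := sobolevH_L2 hw.
have [[_ [mvw _] _] e] := weak_derivE (wdDZ t hv hw).
rewrite /energy_diff.
have -> : \int[mu]_x (weak_deriv m u x * weak_deriv m (fun y => v y + t * w y) x) =
  \int[mu]_x (weak_deriv m u x * weak_deriv m v x + t * (weak_deriv m u x * weak_deriv m w x)).
  apply: ae_Int.
  - by apply: measurable_funM => //; case: Lu.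
  - apply: integR_meas; apply: integRD; first exact: L2_mul.
    by apply: integRZ; exact: L2_mul.
  - by apply: ae_imp e => x ->; ring.
have -> : \int[mu]_x (derive1 F (u x) * (v x + t * w x)) =
  \int[mu]_x (derive1 F (u x) * v x + t * (derive1 F (u x) * w x)).
  by apply: eq_Int => x; ring.
rewrite (IntD (L2_mul Lu Lv) (integRZ t (L2_mul Lu Lw))).
rewrite (IntD (L2_mul Lf v2) (integRZ t (L2_mul Lf w2))).
by rewrite (IntZ _ (L2_mul Lu Lw)) (IntZ _ (L2_mul Lf w2)) affine_difference.
Qed.

Lemma massDZ u v (t : R) : L2 u -> L2 v ->
  mass (fun x => u x + t * v x) = mass u + 2 * t * \int[mu]_x (u x * v x) + t ^+ 2 * mass v.
Proof. exact: Int_sqrD. Qed.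

Section minimizer.
Context (rho c : R) (u : R -> R).
Context (r0 : 0 < rho) (c0 : c < 0)
  (hc : forall v, continuous v -> sobolevH m v -> mass v <= rho -> c <= energy m F v)
  (cu : continuous u) (hu : sobolevH m u) (ur : mass u = rho) (Ju : energy m F u <= c).

Lemma energy_diff_ge0 v : continuous v -> sobolevH m v ->
  \int[mu]_x (u x * v x) < 0 -> 0 <= energy_diff u v.
Proof.
move=> cv hv uv; set I := \int[mu]_x (u x * v x) in uv.
have hu2 := sobolevH_L2 hu; have hv2 := sobolevH_L2 hv.
have mv0 := mass_ge0 v.
(* For t up to this bound the change 2 t I + t^2 mass v of the mass is nonpositive, so u + t v stays
   in the ball. *)
have t0 : 0 < - 2 * I / (mass v + 1).
  by rewrite divr_gt0 ?ltr_wpDl// mulNr oppr_gt0 pmulr_rlt0.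
have [N hN] := inv_nat_small t0.
apply: (ler_cvg_to (cvg_cst 0) (energy_gateaux cu hu cv hv)).
exists N => // n /hN; set t := n.+1%:R^-1 => ht.
have tp : 0 < t by rewrite invr_gt0.
rewrite mulr_ge0// subr_ge0; apply: (le_trans Ju); apply: hc.
- exact: (@continuousDZ _ _ t cu cv).
- exact: sobolevHDZ.
- rewrite massDZ// ur -/I -addrA gerDl.
  rewrite ler_pdivlMr ?ltr_wpDl// in ht.
  rewrite (_ : _ + _ = t * (2 * I + t * mass v)); last by ring.
  rewrite pmulr_rle0//; have : t * mass v <= t * (mass v + 1).
    by apply: ler_wpM2l; [exact: ltW|rewrite lerDl].
  by move: ht; set a := t * mass v; set b := t * (mass v + 1); lra.
Qed.

(* Comparison with (1 - t) u: its energy is at least (1 - t)^2 c by scaling. *)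
Lemma energy_diff_self : energy_diff u u <= 2 * c.
Proof.
have hNu := sobolevHZ (-1) hu.
have cNu : continuous (fun x => -1 * u x).
  by move=> x; apply: cvgM; [exact: cvg_cst|exact: cu].
have hu2 := sobolevH_L2 hu.
(* Writing -u as u - 2 u yields J'(u)(-u) = - J'(u) u from affine linearity. *)
have := energy_diffDZ (-2) cu hu hu hu.
rewrite (_ : (fun x => u x + -2 * u x) = (fun x => -1 * u x)); last first.
  by apply/funext => x; ring.
move=> e.
suff : - (2 * c) <= energy_diff u (fun x => -1 * u x) by rewrite e; lra.
have lim : - (2 * c) + n.+1%:R^-1 * c @[n --> \oo] --> - (2 * c).
  rewrite -[X in _ --> X]addr0; apply: cvgD; first exact: cvg_cst.
  by rewrite -(mul0r c); apply: cvgM; [exact: cvg_harmonic|exact: cvg_cst].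
apply: (ler_cvg_to lim (energy_gateaux cu hu cNu hNu)).
apply: nearW => n; set t := n.+1%:R^-1.
have t1 : t <= 1 by exact: inv_nat_le1.
have tp : 0 < t by rewrite invr_gt0.
have cw := @continuousDZ _ _ t cu cNu; have hw := sobolevHDZ t hu hNu.
have mw : mass (fun x => u x + t * (-1 * u x)) = (1 - t) ^+ 2 * rho.
  rewrite -ur /mass; have [_ iu] := hu2; rewrite -(IntZ _ iu).
  by apply: eq_Int => x; ring.
have s1 : (1 - t) ^+ 2 <= 1 by rewrite exprn_ile1// ?subr_ge0// lerBlDr lerDl ltW.
have wr : mass (fun x => u x + t * (-1 * u x)) <= rho.
  by rewrite mw ler_piMl// ltW.
have := energy_scaling m1 cF Fq r0 hc cw hw wr.
rewrite mw mulfK ?gt_eqF//.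
have : 0 <= 1 / 2 * (1 - ((1 - t) ^+ 2) ^+ (2 * m)) *
            dirichlet m (fun x => u x + t * (-1 * u x)).
  rewrite mulr_ge0 ?dirichlet_ge0// mulr_ge0// subr_ge0 exprn_ile1// ?sqr_ge0//.
set X := 1 / 2 * _ * _; set J := energy m F _ => X0 hJ.
have {X0}hJ : (1 - t) ^+ 2 * c <= J by apply: le_trans hJ; rewrite lerDl.
have -> : - (2 * c) + t * c = n.+1%:R * ((1 - t) ^+ 2 * c - c).
  by apply: square_difference_quotient; rewrite pnatr_eq0.
by rewrite ler_wpM2l// lerB.
Qed.

(** J'(u) is nonnegative on the orthogonal complement of u, hence zero there by symmetry. Splitting
    off the component of v along u leaves J'(u) v = (u, v) / rho times J'(u) u, which fixes lambda
    and its sign. *)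
Lemma lagrange_multiplier : exists2 lambda, 0 < lambda &
  forall v, continuous v -> sobolevH m v ->
    energy_diff u v = - lambda * \int[mu]_x (u x * v x).
Proof.
have self := energy_diff_self; set E := energy_diff u u in self.
have En0 : E < 0 by rewrite (le_lt_trans self)// pmulr_rlt0.
exists (- E / rho); first by rewrite divr_gt0// oppr_gt0.
have hu2 := sobolevH_L2 hu.
have uu : \int[mu]_x (u x * u x) = rho.
  by rewrite -ur; apply: eq_Int => x; rewrite expr2.
have orth v : continuous v -> sobolevH m v -> \int[mu]_x (u x * v x) = 0 ->
    0 <= energy_diff u v.
  move=> cv hv uv; apply/ler_addgt0Pr => e e0.
  have hv2 := sobolevH_L2 hv.
  (* Subtracting t u makes the product with u strictly negative, at the cost e in J'(u). *)
  pose t := e / (- E).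
  have E0 : 0 < - E by rewrite oppr_gt0.
  have t0 : 0 < t by rewrite divr_gt0.
  have := @energy_diff_ge0 (fun x => v x + (- t) * u x) 
    (@continuousDZ _ _ _ cv cu) (sobolevHDZ _ hv hu).
  rewrite (energy_diffDZ (- t) cu hu hv hu) -/E.
  have -> : - t * E = e by rewrite mulNr -mulrN /t divfK// gt_eqF.
  apply; under eq_Int do rewrite mulrDr mulrCA.
  rewrite (IntD (L2_mul hu2 hv2) (integRZ _ (L2_mul hu2 hu2))) (IntZ _ (L2_mul hu2 hu2)).
  by rewrite uv uu add0r mulNr oppr_lt0 mulr_gt0.
move=> v cv hv; have hv2 := sobolevH_L2 hv.
set I := \int[mu]_x (u x * v x).
pose a := - (I / rho).
have cw := @continuousDZ _ _ a cv cu; have hw := sobolevHDZ a hv hu.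
have rn0 : rho != 0 by rewrite gt_eqF.
have w0 : \int[mu]_x (u x * (v x + a * u x)) = 0.
  under eq_Int do rewrite mulrDr mulrCA.
  rewrite (IntD (L2_mul hu2 hv2) (integRZ _ (L2_mul hu2 hu2))) (IntZ _ (L2_mul hu2 hu2)).
  by rewrite uu -/I /a mulNr divfK// subrr.
have h1 := orth _ cw hw w0.
have cNw : continuous (fun x => -1 * (v x + a * u x)).
  by move=> x; apply: cvgM; [exact: cvg_cst|exact: cw].
have hNw := sobolevHZ (-1) hw.
have Nw0 : \int[mu]_x (u x * (-1 * (v x + a * u x))) = 0.
  under eq_Int do rewrite mulrCA.
  by rewrite (IntZ _ (L2_mul hu2 (sobolevH_L2 hw))) w0 mulr0.
have h2 := orth _ cNw hNw Nw0.
have := energy_diffDZ (-2) cu hu hw hw.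
rewrite (_ : (fun x => _ + -2 * _) = (fun x => -1 * (v x + a * u x))); last first.
  by apply/funext => x; ring.
move=> e2; rewrite e2 in h2.
have e1 := energy_diffDZ a cu hu hv hu.
have z : energy_diff u (fun x => v x + a * u x) = 0.
  by apply/eqP; rewrite eq_le h1 andbT; lra.
move: e1; rewrite z -/E /a => e1.
have -> : energy_diff u v = I / rho * E by lra.
by field.
Qed.

End minimizer.
End euler_lagrange.

(** * Assembly: the infimum on the ball, its minimizer and the weak equation *)

Theorem theorem1p4 (R : realType) (m : nat) (rho : R) (F : R -> R)
    (hm : (1 <= m)%N) (hrho : 0 < rho)
    (f0_C1 : (forall s, derivable F s 1) /\ continuous (derive1 F))
    (f0_O : exists K : R, \forall s \near (0 : R)^', `|derive1 F s| <= K * `|s|)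
    (f1 : F s / s ^+ 2 @[s --> (0 : R)^'] --> (0 : R))
    (sigma : \bar R)
    (sigmaE : sigma =
      limf_esup (fun s : R => (F s / s ^+ (2 + 4 * m))%:E) (@norm_infty_nbhs R))
    (f2 : (sigma < +oo)%E)
    (f3 : F s / s ^+ (2 + 4 * m) @[s --> (0 : R)^'] --> +oo)
    (hsmall : (2%:E * sigma *
       (GN_constant m ((2 + 4 * m)%:R : R) ^+ (2 + 4 * m) * rho ^+ (2 * m))%:E
       < 1)%E) :
  exists u : R -> R, exists lambda : R,
    [/\ mass_sphere m rho u /\ 0 < lambda,
        mass_ball m rho u /\
          (forall v, mass_ball m rho v -> energy m F u <= energy m F v),
        energy m F u < 0 &
        weak_solution m (derive1 F) lambda u /\ mass u = rho].
Proof.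
have [dF cF'] := f0_C1.
have cF : continuous F := derivable_continuous dF.
have Fn := nonlinearity_quadratic dF cF' f0_O f1.
have Fn' (M : R) : exists2 K : R, 0 <= K &
    (forall s, `|s| <= M -> `|F s| <= K * s ^+ 2) /\
    (forall a b, `|a| <= M -> `|b| <= M -> `|a + b| <= M ->
      `|F (a + b) - F a - F b| <= K * (a ^+ 2 + `|a| * `|b|)).
  by have [K K0 [h1 [h2 _]]] := Fn M; exists K.
have Fq (M : R) : exists2 K : R, 0 <= K & forall s, `|s| <= M -> `|F s| <= K * s ^+ 2.
  by have [K K0 [h1 _]] := Fn' M; exists K.
have Fs := small_quadratic_all dF f1.
have odd_p : ~~ odd (2 + 4 * m) by rewrite oddD oddM.
set G := GN_constant m ((2 + 4 * m)%:R : R) ^+ (2 + 4 * m) * rho ^+ (2 * m) in hsmall.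
have G0 : 0 <= G.
  rewrite mulr_ge0//; last by rewrite exprn_ge0// ltW.
  by rewrite expr_even_split mulr_ge0 ?sqr_ge0// exprn_ge0// sqr_ge0.
have [s' s'0 [s'G [M hM]]] := limsup_upper odd_p G0 sigmaE f2 hsmall.
have [C C0 hC] := nonlinearity_upper dF cF' f0_O f1 odd_p (ltW s'0) hM.
have coer v : continuous v -> sobolevH m v -> mass v <= rho ->
    (1 / 2 - s' * G) * dirichlet m v - C * rho <= energy m F v.
  exact: (energy_coercive hm cF Fq C0 (ltW s'0) hC).
have theta0 : 0 < 1 / 2 - s' * G by move: s'G; rewrite -mulrA; set q := s' * G; lra.
(* Only continuous competitors enter here; [energy_ae] and [mass_ae] extend the comparison to the
   whole ball. *)
pose S := [set r | exists v, [/\ continuous v, sobolevH m v, mass v <= rho & r = energy m F v]].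
have [v0 [cv0 hv0 mv0 Jv0]] : exists v, [/\ continuous v, sobolevH m v, mass v = rho &
    energy m F v < 0].
  by apply: (energy_negative hm cF Fq hrho); exact: (superpower_lower dF f1 f3 odd_p).
have S0 : S (energy m F v0) by exists v0; rewrite mv0.
have Slb : has_lbound S.
  exists (- (C * rho)) => _ [v [cv hv mv ->]]; apply: le_trans (coer _ cv hv mv).
  by rewrite lerDr mulr_ge0 ?dirichlet_ge0// ltW.
have Sinf : has_inf S by split; [exists (energy m F v0)|].
pose c := inf S.
have c0 : c < 0 by apply: le_lt_trans Jv0; exact: ge_inf.
have hc v : continuous v -> sobolevH m v -> mass v <= rho -> c <= energy m F v.
  by move=> cv hv mv; apply: ge_inf => //; exists v.
have [u [cu hu mu_ Ju]] : exists u, [/\ continuous u, sobolevH m u, mass u = rho &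
    energy m F u <= c].
  apply: (minimizer_exists hm cF Fn' Fs hrho c0 theta0 coer hc) => e e0.
  have [_ [v [cv hv mv ->]] h] := inf_adherent e0 Sinf.
  by exists v; split=> //; exact: ltW.
have [lambda l0 hl] := lagrange_multiplier hm dF cF' Fn hrho c0 hc cu hu mu_ Ju.
have uS : mass_sphere m rho u by split.
have uB : mass_ball m rho u by split=> //; rewrite mu_.
exists u, lambda; split.
- by split.
- split=> //  v [hv mv]; have [w [cw vw hw]] := sobolevH_continuous hm hv.
  have mev : measurable_fun setT v by case: (sobolevH_L2 hv).
  rewrite (energy_ae hm cF Fq hv cw vw); apply: (le_trans Ju); apply: hc => //.
  by rewrite -(mass_ae mev (continuous_meas cw) vw).
- exact: le_lt_trans Ju c0.
split=> //; split=> [//|v hv].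
have L2v := sobolevH_L2 hv; have [mev _] := L2v.
have L2f := L2_derive1_comp hm cF' Fn cu hu.
have L2u := sobolevH_L2 hu.
split; first exact: (L2_mul L2f L2v).
have [w [cw vw hw]] := sobolevH_continuous hm hv.
have mew := continuous_meas cw; have meu := continuous_meas cu.
have hgv := wd_aeW mew vw (sobolevH_weak_deriv hv).
have [_ eg] := weak_derivE hgv.
(* The equation is tested with the continuous representative w; each integral is then moved back to
   v. *)
have := hl w cw hw; rewrite /energy_diff.
have [_ [mDu _] _] := sobolevH_weak_deriv hu.
have [_ [mDv _] _] := sobolevH_weak_deriv hv.
have [_ [mDw _] _] := sobolevH_weak_deriv hw.
have [mf _] := L2f.
rewrite -(@ae_Int _ (fun x => weak_deriv m u x * weak_deriv m v x)
  (fun x => weak_deriv m u x * weak_deriv m w x)); last first.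
- by apply: ae_imp eg => x ->.
- exact: measurable_funM.
- exact: measurable_funM.
rewrite -(@ae_Int _ (fun x => derive1 F (u x) * v x)
  (fun x => derive1 F (u x) * w x)); last first.
- by apply: ae_imp vw => x ->.
- exact: measurable_funM.
- exact: measurable_funM.
rewrite -(@ae_Int _ (fun x => u x * v x) (fun x => u x * w x)); last first.
- by apply: ae_imp vw => x ->.
- exact: measurable_funM.
- exact: measurable_funM.
by move=> /eqP; rewrite subr_eq => /eqP ->; rewrite mulNr addrAC addNr add0r.
Qed.
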